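(* Let $k,l\ge 2$ be integers. There is a constant $C(k,l)>1$ such that a random homomorphism $\varphi:F_k\to F_l$ of length $n$ between free groups of ranks $k$ and $l$ is an isometry of stable commutator length (i.e. $\mathrm{scl}_{F_k}(\Gamma)=\mathrm{scl}_{F_l}(\varphi(\Gamma))$ for every $\Gamma\in B_1^H(F_k)$) with probability $1-O(C(k,l)^{-n})$ as $n\to\infty$.
   Context: Random homomorphisms: fix free generating sets of $F_k$ and $F_l$, and let $F_l(\le n)$ be the finite set of reduced words in $F_l$ of length at most $n$. A random homomorphism of length $n$ sends the $k$ free generators of $F_k$ to $k$ elements of $F_l(\le n)$ chosen independently and uniformly at random. Stable commutator length: for a group $G$ and $g\in[G,G]$, $\mathrm{cl}(g)$ is the least number of commutators in $G$ whose product is $g$. For elements $g_1,\dots,g_m\in G$ whose product lies in $[G,G]$, $\mathrm{cl}(\sum g_i)$ is the minimum of $\mathrm{cl}\left(\prod_i h_ig_ih_i^{-1}\right)$ over all $h_i\in G$, and $\mathrm{scl}(\sum g_i)=\lim_{n\to\infty}\mathrm{cl}(\sum g_i^n)/n$. Let $B_1(G)$ be the real vector space of real group $1$-boundaries (finite formal real linear combinations of elements of $G$ that are trivial in $H_1(G;\mathbb R)$). The function $\mathrm{scl}$ extends by homogeneity and continuity to a pseudo-norm on $B_1(G)$ which vanishes on the subspace $H$ spanned by all $g^n-ng$ ($g\in G$, $n\in\mathbb Z$) and all $g-hgh^{-1}$ ($g,h\in G$), hence descends to $B_1^H(G):=B_1(G)/H$. *)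

(* Defs.v *)
From HB Require Import structures.
From mathcomp Require Import all_boot all_order all_algebra.
From mathcomp Require Import all_classical all_reals all_analysis.
From mathcomp.multinomials Require Import freeg.

Set Implicit Arguments.
Unset Strict Implicit.
Unset Printing Implicit Defensive.

Import Order.TTheory GRing.Theory Num.Theory.
Import numFieldNormedType.Exports.

Local Open Scope classical_set_scope.
Local Open Scope ring_scope.

(* A letter (i, b) stands for the i-th free generator if b = false, and for
   its inverse if b = true. *)
Definition letter (k : nat) : finType := ('I_k * bool)%type.

Section ReducedWords.
Variable k : nat.
Implicit Types (x : letter k) (u v w : seq (letter k)).

Definition letter_inv x : letter k := (x.1, ~~ x.2).

Definition reduced_word w : bool := sorted (fun x y => y != letter_inv x) w.

(* Left multiplication of a reduced word by a letter, resp. by a word. *)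
Definition word_cons x w :=
  if w is y :: w' then if y == letter_inv x then w' else x :: w else [:: x].

Definition word_mul u v := foldr word_cons v u.

Definition word_inv w := rev (map letter_inv w).

Lemma letter_invK : involutive letter_inv.
Proof. by case=> i b; rewrite /letter_inv negbK. Qed.

Lemma reduced_word_behead x w : reduced_word (x :: w) -> reduced_word w.
Proof. by case: w => //= y w /andP[]. Qed.

Lemma reduced_word_cons x w : reduced_word w -> reduced_word (word_cons x w).
Proof.
case: w => [|y w] //= rw; case: eqP => [_|/eqP xy].
  exact: (@reduced_word_behead y).
by rewrite /reduced_word /= xy.
Qed.

Lemma reduced_word_mul u v : reduced_word v -> reduced_word (word_mul u v).
Proof. by move=> rv; elim: u => //= x u; apply: reduced_word_cons. Qed.

Lemma reduced_word_inv w : reduced_word w -> reduced_word (word_inv w).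
Proof.
rewrite /reduced_word /word_inv rev_sorted sorted_map; apply: sub_sorted => x y /=.
by apply: contraNneq => ->; rewrite letter_invK.
Qed.

Lemma word_consK x w :
  reduced_word w -> word_cons (letter_inv x) (word_cons x w) = w.
Proof.
case: w => [|y w] /=; first by rewrite letter_invK eqxx.
have [->|yx] := eqVneq y (letter_inv x); last by rewrite /= letter_invK eqxx.
case: w => [|z w] //= /andP[/negbTE + _].
by move=> ->.
Qed.

Lemma word_mul_cons x u v :
  reduced_word v -> word_mul (word_cons x u) v = word_cons x (word_mul u v).
Proof.
move=> rv; case: u => [|y u] //=; case: eqP => [->|_] //=.
by rewrite -{1}[x]letter_invK word_consK ?reduced_word_mul.
Qed.

Lemma word_mulA u v w : reduced_word w ->
  word_mul u (word_mul v w) = word_mul (word_mul u v) w.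
Proof. by move=> rw; elim: u => //= x u ->; rewrite word_mul_cons. Qed.

Lemma word_mul1 w : reduced_word w -> word_mul w [::] = w.
Proof.
elim: w => //= x w IH rw; rewrite IH ?(reduced_word_behead rw) //.
by case: w rw {IH} => [|y w] //= /andP[/negbTE -> _].
Qed.

Lemma word_mulV w : word_mul (word_inv w) w = [::].
Proof.
elim: w => //= x w IH; rewrite /word_inv /= rev_cons /word_mul foldr_rcons /=.
by rewrite letter_invK eqxx.
Qed.

Lemma word_invK : involutive word_inv.
Proof.
move=> w; rewrite /word_inv map_rev revK -map_comp.
by rewrite (eq_map letter_invK) map_id.
Qed.

End ReducedWords.

Record free_group (k : nat) :=
  FreeElt { free_word :> seq (letter k); _ : reduced_word free_word }.

HB.instance Definition _ k := [isSub for @free_word k].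
HB.instance Definition _ k := [Choice of free_group k by <:].

Section FreeGroup.
Variable k : nat.
Implicit Types u v w : free_group k.

Definition free_one : free_group k := @FreeElt k [::] isT.
Definition free_inv u : free_group k := FreeElt (reduced_word_inv (valP u)).
Definition free_mul u v : free_group k := FreeElt (reduced_word_mul u (valP v)).

Lemma free_mulA : associative free_mul.
Proof. by move=> u v w; apply/val_inj/word_mulA/valP. Qed.

Lemma free_mul1g : left_id free_one free_mul.
Proof. by move=> u; apply/val_inj. Qed.

Lemma free_mulg1 : right_id free_one free_mul.
Proof. by move=> u; apply/val_inj/word_mul1/valP. Qed.

Lemma free_mulVg : left_inverse free_one free_inv free_mul.
Proof. by move=> u; apply/val_inj/word_mulV. Qed.

Lemma free_mulgV : right_inverse free_one free_inv free_mul.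
Proof.
by move=> u; apply/val_inj; rewrite /= -{1}[val u]word_invK word_mulV.
Qed.

HB.instance Definition _ := isGroup.Build (free_group k)
  free_mulA free_mul1g free_mulg1 free_mulVg free_mulgV.

Definition free_gen (i : 'I_k) : free_group k := @FreeElt k [:: (i, false)] isT.

End FreeGroup.

Section FreeHom.
Variables (k : nat) (G : groupType) (f : 'I_k -> G).

Definition letter_val (x : letter k) : G :=
  if x.2 then ((f x.1)^-1)%g else f x.1.

(* The homomorphism sending the i-th free generator to f i. *)
Definition free_hom (w : free_group k) : G := (\prod_(x <- w) letter_val x)%g.

Lemma free_hom_gen i : free_hom (free_gen i) = f i.
Proof. by rewrite /free_hom big_seq1. Qed.

Lemma letter_valV x : letter_val (letter_inv x) = ((letter_val x)^-1)%g.
Proof. by case: x => i [] //=; rewrite /letter_val /= invgK. Qed.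

Lemma free_homM : {morph free_hom : u v / (u * v)%g}.
Proof.
move=> u v; rewrite /free_hom /=; elim: (free_word u) => [|x w IH] /=.
  by rewrite big_nil mul1g.
rewrite big_cons -mulgA -IH; case: (word_mul w v) => [|y s] /=.
  by rewrite big_seq1 big_nil mulg1.
case: eqP => [->|_]; rewrite !big_cons // letter_valV mulgA mulgV mul1g //.
Qed.

HB.instance Definition _ :=
  isMultiplicative.Build (free_group k) G free_hom free_homM.

End FreeHom.

(* The least natural number satisfying P, and 0 if there is none. *)
Definition least (P : nat -> Prop) : nat :=
  if pselect (exists n, `[< P n >]) is left h then ex_minn h else 0%N.

Section Commutators.
Variable G : groupType.
Implicit Types (g : G) (s : seq G).

Definition expgz g (z : int) : G :=
  match z with Posz n => (g ^+ n)%g | Negz n => (g ^- n.+1)%g end.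

Definition commutator_product (n : nat) g : Prop :=
  exists a b : 'I_n -> G, g = (\prod_(i < n) [~ a i, b i])%g.

(* [G, G] *)
Definition derived : set G := [set g | exists n, commutator_product n g].

Definition cl g : nat := least (fun n => commutator_product n g).

(* cl (g_1 + ... + g_m), for s = [:: g_1; ...; g_m] with product in [G, G]. *)
Definition cl_sum s : nat :=
  least (fun n => exists h : 'I_(size s) -> G,
    n = cl (\prod_(i < size s) (h i * s`_i * (h i)^-1))%g).

End Commutators.

Section Chains.
Variables (R : realType) (G : groupType).
Local Notation chain := {freeg G / R}.
Implicit Types (g h : G) (c : chain) (S : set chain).

Definition chain_span S : set chain :=
  [set c | exists2 s : seq (R * chain),
     (forall p, p \in s -> S p.2) & c = \sum_(p <- s) p.1 *: p.2].

Lemma span_submod_closed S : submod_closed (fun c => `[< chain_span S c >]).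
Proof.
split=> [|a c d /asboolP[s sS ->] /asboolP[t tS ->]]; apply/asboolP.
  by exists [::] => //; rewrite big_nil.
exists ([seq (a * p.1, p.2) | p <- s] ++ t) => [p|].
  by rewrite mem_cat => /orP[/mapP[q /sS Sq ->]|/tS].
rewrite big_cat big_map scaler_sumr; congr (_ + _).
by apply: eq_bigr => p _; rewrite scalerA.
Qed.

(* Images of the basis of C_2(G; R) under the differential of the bar complex;
   as C_1 -> C_0 vanishes, their span is the kernel of C_1 -> H_1(G; R). *)
Definition bar_relator : set chain :=
  [set c | exists g h, c = << g >> + << h >> - << (g * h)%g >>].

Definition boundary : pred chain := fun c => `[< chain_span bar_relator c >].

HB.instance Definition _ := GRing.isSubmodClosed.Build R chain boundary
  (span_submod_closed bar_relator).

Record B1 := Boundary { chain_of :> chain; _ : boundary chain_of }.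

HB.instance Definition _ := [isSub for chain_of].
HB.instance Definition _ := [Choice of B1 by <:].
HB.instance Definition _ := [SubChoice_isSubLmodule of B1 by <:].

Definition homogeneity_relator : set chain :=
  [set c | (exists g (n : int), c = << (expgz g n) >> - n%:~R *: << g >>) \/
           (exists g h, c = << g >> - << (h * g * h^-1)%g >>)].

(* The subspace H; its generators are boundaries. *)
Definition homogeneous : pred B1 :=
  fun x => `[< chain_span homogeneity_relator (val x) >].

Lemma homogeneous_zmod_closed : zmod_closed homogeneous.
Proof.
have [H0 HD] := span_submod_closed homogeneity_relator.
split=> [|x y Hx Hy]; first exact: H0.
rewrite /homogeneous unfold_in /= addrC -scaleN1r.
exact: (HD (-1) (val y) (val x) Hy Hx).
Qed.

HB.instance Definition _ := GRing.isZmodClosed.Build B1 homogeneous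
  homogeneous_zmod_closed.

Definition B1H := Quotient.quot (GRing.ZmodClosed.clone B1 homogeneous _).

End Chains.

Section ChainMap.
Variables (R : realType) (G K : groupType) (phi : {multiplicative G -> K}).
Local Notation chain G := {freeg G / R}.

(* The linear extension of phi to chains, and the maps it induces on B_1 and
   on B_1^H. *)
Definition chain_map (c : chain G) : chain K :=
  fglift (fun g => << phi g >> : chain K) c.

Lemma chain_mapU (a : R) g : chain_map << a *g g >> = << a *g phi g >>.
Proof. by rewrite /chain_map liftU; apply/eqP/freeg_eqP => h; rewrite coeffZ !coeffU mul1r. Qed.

HB.instance Definition _ := GRing.isZmodMorphism.Build (chain G) (chain K)
  chain_map (lift_is_additive (fun g => << phi g >> : chain K)).

Lemma chain_mapZ a : {morph chain_map : c / a *: c}.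
Proof.
move=> c; rewrite -[c]freeg_sumE.
rewrite scaler_sumr (raddf_sum chain_map) (raddf_sum chain_map) scaler_sumr.
have ZU (L : choiceType) (b : R) (x : L) : a *: << b *g x >> = << a * b *g x >>.
  by apply/eqP/freeg_eqP => h; rewrite coeffZ !coeffU mulrA.
by apply: eq_bigr => g _ /=; rewrite ZU !chain_mapU ZU.
Qed.

Lemma chain_map_span (S : set (chain G)) (T : set (chain K)) c :
  (forall d, S d -> T (chain_map d)) -> chain_span S c -> chain_span T (chain_map c).
Proof.
move=> ST [s sS ->]; exists [seq (p.1, chain_map p.2) | p <- s] => [p|].
  by case/mapP=> q /sS /ST Tq ->.
rewrite raddf_sum big_map.
by apply: eq_bigr => p _ /=; rewrite chain_mapZ.
Qed.

Lemma chain_map_boundary c : boundary c -> boundary (chain_map c).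
Proof.
move=> /asboolP bc; apply/asboolP; apply: chain_map_span bc => d [g [h ->]].
exists (phi g), (phi h).
by rewrite raddfB raddfD /= !chain_mapU gmulfM.
Qed.

Definition B1_map (c : B1 R G) : B1 R K :=
  Boundary (chain_map_boundary (valP c)).

Definition B1H_map (c : B1H R G) : B1H R K :=
  \pi_(B1H R K)%qT (B1_map (repr c)).

Lemma morph1 : phi 1%g = 1%g.
Proof. by apply: (mulgI (phi 1%g)); rewrite -gmulfM !mulg1. Qed.

Lemma morphV g : phi (g^-1)%g = ((phi g)^-1)%g.
Proof. by apply: (mulgI (phi g)); rewrite -gmulfM !mulgV morph1. Qed.

Lemma morphX g n : phi (g ^+ n)%g = (phi g ^+ n)%g.
Proof. by elim: n => [|n IH]; rewrite ?expg0 ?morph1 // !expgS gmulfM IH. Qed.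

Lemma expgz_morph g (n : int) : phi (expgz g n) = expgz (phi g) n.
Proof. by case: n => n /=; rewrite ?morphV morphX. Qed.

Lemma chain_map_homogeneity (d : chain G) :
  homogeneity_relator d -> homogeneity_relator (chain_map d).
Proof.
case=> [[g [n ->]]|[g [h ->]]]; [left; exists (phi g), n|right; exists (phi g), (phi h)].
  by rewrite raddfB /= chain_mapZ !chain_mapU expgz_morph.
by rewrite raddfB /= !chain_mapU !gmulfM morphV.
Qed.

Lemma B1H_map_pi (c : B1 R G) :
  B1H_map (\pi_(B1H R G)%qT c) = \pi_(B1H R K)%qT (B1_map c).
Proof.
apply/eqP; rewrite /B1H_map -Quotient.idealrBE.
have /asboolP : homogeneous (repr (\pi_(B1H R G)%qT c) - c).
  by rewrite -[homogeneous _]/(_ \in @homogeneous R G) Quotient.idealrBE reprK.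
move=> Hc; apply/asboolP; rewrite /= -(raddfB chain_map).
exact: (chain_map_span chain_map_homogeneity Hc).
Qed.

End ChainMap.

Section Scl.
Variables (R : realType) (G : groupType).
Local Notation chain := {freeg G / R}.
Implicit Types (c d : chain) (N : nat).

Definition scl_sum (s : seq G) : R :=
  limn (fun n : nat => (cl_sum [seq (g ^+ n)%g | g <- s])%:R / n%:R : R).

(* If N clears the denominators of the rational boundary
   c = \sum_g c_g g, then N c is represented, modulo homogeneity, by the sum of
   the elements g^(N c_g).  The condition on the product is void when G^ab is
   torsion-free. *)
Definition cleared N c : seq G :=
  [seq expgz g (Num.floor (N%:R * coeff g c)) | g <- dom c].

Definition clears c N : Prop :=
  [/\ (0 < N)%N, forall g, N%:R * coeff g c \is a Num.int
    & derived (\prod_(g <- cleared N c) g)%g].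

Definition scl_rational c : R :=
  let N := least (clears c) in scl_sum (cleared N c) / N%:R.

(* The traces around c of the rational boundaries supported in the support of
   c: continuity of scl holds on finite-dimensional spaces of boundaries, and
   fails for the l^1 norm on B_1. *)
Definition rational_approx c : set_system chain :=
  filter_from [set e : R | 0 < e] (fun e =>
    [set d : chain | [/\ boundary d,
       forall g, exists q : rat, coeff g d = ratr q,
       {subset dom d <= dom c} &
       forall g, `|coeff g d - coeff g c| < e]]).

Definition scl_chain c : R := lim (scl_rational @ rational_approx c).

(* As scl is constant on the cosets of H, the choice of a representative is
   immaterial. *)
Definition scl (c : B1H R G) : R := scl_chain (val (repr c)).

End Scl.

Definition scl_isometry (R : realType) (G K : groupType)
    (phi : {multiplicative G -> K}) : Prop :=
  forall Gamma : B1H R G, scl Gamma = scl (B1H_map phi Gamma).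

(* F_l(<= n) *)
Definition short_words (l n : nat) : finType :=
  {w : n.-bseq (letter l) | reduced_word w}.

Definition free_of_short l n (w : short_words l n) : free_group l :=
  FreeElt (valP w).

(* The probability of the event E for the homomorphism F_k -> F_l sending the
   generators to independent uniform elements of F_l(<= n). *)
Definition random_hom_prob (R : realType) (k l n : nat)
    (E : {multiplicative free_group k -> free_group l} -> Prop) : R :=
  \sum_(f : {ffun 'I_k -> short_words l n}
          | `[< E (free_hom (fun i => free_of_short (f i))) >])
    \prod_(i < k) (#|short_words l n|%:R)^-1.

(* Main.v *)
(** A cyclic word in a free group is a product of [m] commutators exactly when
    its letters can be paired, each with an inverse letter, so that the surface
    obtained from a disk by gluing paired edges has genus at most [m]; the
    vertices of that surface are the cycles of a permutation.  Suppose that the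
    images of the generators are long and that no two distinct places in them
    share a subword of length [tau].  A pairing of the letters of [phi w] can be
    zipped, without losing vertices, until every aligned pair of letters belongs
    to two images of generators that are paired letter by letter.  An image that
    is not so paired meets many vertices of valence at least three, so pairing
    all of the remaining images arbitrarily does not increase the genus.  Hence
    [cl (phi w) = cl w] for every [w] in the commutator subgroup, and [scl] is
    preserved first on rational chains, where it is a limit of commutator
    lengths of products of powers, and then on all chains by approximation.
    A random homomorphism violates the condition with exponentially small
    probability, since a repeated subword of length [tau] in a random word is
    determined by the rest of the word. *)

Require Import Defs.
From HB Require Import structures.
From mathcomp Require Import all_boot all_order all_algebra all_fingroup.
From mathcomp Require Import all_classical all_reals all_analysis.
From mathcomp.multinomials Require Import freeg.
From mathcomp Require Import zify ring lra.

Set Implicit Arguments.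
Unset Strict Implicit.
Unset Printing Implicit Defensive.

Import Order.TTheory GRing.Theory Num.Theory.
Import numFieldNormedType.Exports.

(** * Cycles of permutations *)

(** The glued surface is never built. With [n] letters and [V] vertices its genus [g] satisfies
    [V - n / 2 + 1 = 2 - 2 g], so everything reduces to counting cycles of [cyc s * pi]. Every move
    on words or pairings multiplies this permutation by transpositions, each of which changes the
    count by one. The obstacle is the blocks that zipping leaves unmatched. In units where a vertex
    counts 6, such a block costs 6 at the corner behind it. It is repaid by six disjoint windows of
    length [tau], each of which must contain a corner where one unit is saved; this is the origin of
    the length bound [6 * tau]. A word that violates this bound must in addition be rarer than a
    typical one by a factor exponential in [tau], which leads to [tau = n %/ 7]. For real chains the
    difficulty is that the chosen representative of the image class differs from the image of the
    chosen representative by a real combination of relators, while [scl_chain] is a limit over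
    rational chains with prescribed support. All real coefficients involved are therefore moved by a
    single map that preserves linear relations over the rationals. *)

Section PermCycles.
Variable T : finType.
Implicit Types (x y z : T) (s u v : seq T) (p c pi : {perm T}).

Lemma porbit_next p x z : z \in porbit p x -> p z \in porbit p x.
Proof.
by case/porbitP=> i ->; apply/porbitP; exists i.+1; rewrite expgSr permM.
Qed.

Lemma porbit_ind p (A : pred T) x : A x ->
  (forall z, z \in porbit p x -> A z -> A (p z)) -> {in porbit p x, forall y, A y}.
Proof.
move=> Ax H _ /porbitP[i ->]; elim: i => [|i IH]; first by rewrite expg0 perm1.
by rewrite expgSr permM; apply: H => //; apply: mem_porbit.
Qed.

Lemma sum_porbits p (F : T -> nat) :
  \sum_(Z in porbits p) \sum_(x in Z) F x = \sum_x F x.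
Proof.
rewrite [RHS](partition_big (porbit p) (mem (porbits p))) /=; last first.
  by move=> x _; apply: imset_f.
apply: eq_bigr => _ /imsetP[x _ ->]; apply: eq_bigl => y.
by rewrite eq_porbit_mem porbit_sym.
Qed.

Definition ncycles p := #|porbits p|.

Lemma ncycles1 : ncycles 1%g = #|T|.
Proof.
rewrite /ncycles /porbits card_imset // => x y /setP/(_ y).
rewrite porbit_id => /porbitP[i]; rewrite expg1n perm1 => ->.
by [].
Qed.

Lemma ncycles_conj p (q : {perm T}) : ncycles (p ^ q)%g = ncycles p.
Proof.
have le (r t : {perm T}) : (ncycles (r ^ t)%g <= ncycles r)%N.
  rewrite /ncycles; have -> : porbits (r ^ t)%g = [set t @: (Z : {set T}) | Z in porbits r].
    apply/setP=> Z; apply/imsetP/imsetP => [[x _ ->]|[_ /imsetP[x _ ->] ->]].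
      exists (porbit r (t^-1 x)%g); first exact: imset_f.
      apply/setP=> y; apply/porbitP/imsetP.
        case=> i ->; exists ((r ^+ i)%g (t^-1 x)%g); first exact: mem_porbit.
        by rewrite -conjXg /conjg !permM.
      case=> _ /porbitP[i ->] ->; exists i.
      by rewrite -conjXg /conjg !permM.
    exists (t x) => //; apply/setP=> y; apply/imsetP/porbitP.
      case=> _ /porbitP[i ->] ->; exists i.
      by rewrite -conjXg /conjg !permM permK.
    case=> i ->; exists ((r ^+ i)%g x); first exact: mem_porbit.
    by rewrite -conjXg /conjg !permM permK.
  exact: leq_imset_card.
apply/eqP; rewrite eqn_leq le /= -{1}(conjgK q p); exact: le.
Qed.

Lemma ncyclesMC p (q : {perm T}) : ncycles (p * q)%g = ncycles (q * p)%g.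
Proof. by rewrite -(ncycles_conj (q * p)%g q) /conjg !mulgA mulVg mul1g. Qed.

Lemma ncycles_split p x y : x != y -> x \in porbit p y ->
  ncycles (tperm x y * p)%g = (ncycles p).+1.
Proof.
move=> xy xo; have := porbits_mul_tperm p x y.
by rewrite /= xo xy /= addn0 addn1.
Qed.

Lemma ncycles_merge p x y : x \notin porbit p y ->
  (ncycles (tperm x y * p)%g).+1 = ncycles p.
Proof.
move=> xo; have := porbits_mul_tperm p x y.
have xy : x != y by apply: contraNneq xo => ->; apply: porbit_id.
by rewrite /= xo xy /= -addnn addnA !addn1 => -[].
Qed.

Lemma ncycles_tperm_le p x y : (ncycles p <= (ncycles (tperm x y * p)%g).+1)%N.
Proof.
have [xo|xo] := boolP (x \in porbit p y); last by rewrite ncycles_merge.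
have [->|xy] := eqVneq x y; first by rewrite tperm1 mul1g leqnSn.
by rewrite (ncycles_split xy xo); lia.
Qed.

(** The singleton cycle of [x] is absorbed by the cycle of [y]. *)
Lemma ncycles_insert p x y : p x = x -> x != y ->
  (ncycles (tperm x y * p)%g).+1 = ncycles p.
Proof.
move=> px xy; apply: ncycles_merge; rewrite porbit_sym.
apply/negP => /porbitP[i]; elim: i => [|i IH] in xy *.
  by rewrite expg0 perm1 => e; rewrite e eqxx in xy.
by rewrite expgS permM px; apply: IH.
Qed.

(* Conjugating [pi] by a transposition multiplies [c * pi] by two
   transpositions, the first of which splits a cycle. *)
Lemma ncycles_flip c pi x z : z \in porbit (c * pi)%g x ->
  (ncycles (c * pi)%g <= ncycles (c * pi ^ tperm x z)%g)%N.
Proof.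
have [<-|xz zo] := eqVneq x z; first by rewrite tperm1 conjg1.
set t := tperm x z.
have -> : (c * pi ^ t = c * t * pi * t)%g.
  by rewrite /conjg tpermV !mulgA.
rewrite (ncyclesMC _ t) !mulgA.
have tc : (t * c * t = (tperm ((t * c)^-1 x) ((t * c)^-1 z)) * (t * c))%g.
  set d := (t * c)%g; rewrite -[X in (_ = X * _)%g]/(tperm _ _).
  have := tpermJ x z (d^-1)%g; rewrite /conjg invgK => <-.
  by rewrite -!mulgA mulVg mulg1.
rewrite tc -!mulgA.
have := ncycles_tperm_le (t * (c * pi))%g ((t * c)^-1 x)%g ((t * c)^-1 z)%g.
by rewrite (@ncycles_split (c * pi)%g x z) 1?porbit_sym // ltnS !mulgA.
Qed.

(* The permutation sending each element of [s] to its cyclic predecessor. *)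
Fixpoint cyc s : {perm T} :=
  if s is x :: s' then
    if s' is y :: _ then (tperm x y * cyc s')%g else 1%g
  else 1%g.

Lemma cyc_out s x : x \notin s -> cyc s x = x.
Proof.
elim: s => [|y [|z s] IH]; rewrite ?perm1 //.
rewrite inE negb_or => /andP[xy xs]; rewrite [cyc _]/= permM tpermD ?IH //.
  by rewrite eq_sym.
by apply: contraNneq xs => ->; rewrite inE eqxx.
Qed.

Lemma cyc_prev x y s : uniq [:: x, y & s] -> cyc [:: x, y & s] y = x.
Proof.
move=> /andP[xs _].
by rewrite [cyc _]/= permM tpermR (@cyc_out (y :: s)).
Qed.

Lemma cyc_rot_prev u v x y : uniq (u ++ [:: x, y & v]) ->
  cyc ([:: x, y & v] ++ u) y = x.
Proof. by rewrite uniq_catC; apply: cyc_prev. Qed.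

Lemma perm_disj_comm (A : pred T) p (q : {perm T}) :
  (forall x, A x -> q x = x) -> (forall x, ~~ A x -> p x = x) ->
  commute p q.
Proof.
move=> qA pA; apply/permP => x; rewrite !permM.
have pAA y : A y -> A (p y).
  move=> Ay; apply/negPn/negP => nA; have := pA _ nA => /perm_inj e.
  by rewrite e Ay in nA.
have [Ax|nAx] := boolP (A x); first by rewrite !qA ?pAA.
rewrite (pA x) // pA //; apply/negP => Aq.
by have := qA _ Aq => /perm_inj e; rewrite e (negbTE nAx) in Aq.
Qed.

Lemma cyc_comm u v : uniq (u ++ v) -> commute (cyc u) (cyc v).
Proof.
rewrite cat_uniq => /and3P[_ uv _]; apply: (@perm_disj_comm (mem u)) => x /= xu.
  by rewrite cyc_out //; apply: contra uv => xv; apply/hasP; exists x.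
by rewrite cyc_out.
Qed.

Lemma cyc_cat x u y v : uniq ((x :: u) ++ (y :: v)) ->
  cyc ((x :: u) ++ (y :: v)) = (tperm x y * cyc (x :: u) * cyc (y :: v))%g.
Proof.
elim: u x => [|z u IH] x; first by rewrite /= mulg1.
move=> U; have U' : uniq ((z :: u) ++ y :: v) by case/andP: U.
rewrite -[cyc ([:: x, z & u] ++ _)]/(tperm x z * cyc ((z :: u) ++ y :: v))%g IH //.
rewrite -[cyc [:: x, z & u]]/(tperm x z * cyc (z :: u))%g !mulgA; congr (_ * _ * _)%g.
have xz : x != z by apply: contraTneq U => ->; rewrite /= inE eqxx.
have xy : x != y.
  by apply: contraTneq U => ->; rewrite /= inE mem_cat inE eqxx !orbT.
have zy : z != y.
  by apply: contraTneq U' => ->; rewrite /= mem_cat inE eqxx !orbT.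
have := tpermJ z y (tperm x z); rewrite tpermR (tpermD xy zy) /conjg tpermV => <-.
by rewrite -!mulgA tperm2 mulg1.
Qed.

(** The product formula of [cyc_cat] is symmetric in its two pieces, because disjoint cycles
    commute. *)
Lemma cyc_rot u v : uniq (u ++ v) -> cyc (u ++ v) = cyc (v ++ u).
Proof.
case: u => [|x u]; first by rewrite cats0.
case: v => [|y v]; first by rewrite cats0.
move=> U; have U2 : uniq ((y :: v) ++ x :: u) by rewrite uniq_catC.
by rewrite !cyc_cat // tpermC -!mulgA (cyc_comm U).
Qed.

Lemma cyc_nth x0 s i : uniq s -> (i.+1 < size s)%N ->
  cyc s (nth x0 s i.+1) = nth x0 s i.
Proof.
move=> U si; have E : s = take i s ++ [:: nth x0 s i, nth x0 s i.+1 & drop i.+2 s].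
  by rewrite -!drop_nth ?cat_take_drop // ltnW.
by rewrite {1}E cyc_rot -?E // cyc_rot_prev -?E.
Qed.

Lemma cyc_nth0 x0 s : uniq s -> cyc s (nth x0 s 0) = nth x0 s (size s).-1.
Proof.
rewrite nth_last; case: s => [|x s] U; first by rewrite perm1.
case/lastP: s => [|s z] in U *; first by rewrite perm1.
rewrite [RHS]/= last_rcons -cats1 -cat_cons cyc_rot.
  by apply: cyc_prev; move: U; rewrite -rcons_cons rcons_uniq.
by rewrite cats1.
Qed.

(** Exchanging two of the three pieces affects only the two leading transpositions; cycle counts
    before and after such an exchange are compared in this form. *)
Lemma cyc_cat3 x u y v z w : uniq ((x :: u) ++ (y :: v) ++ (z :: w)) ->
  cyc ((x :: u) ++ (y :: v) ++ (z :: w)) =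
  (tperm x y * tperm y z * (cyc (x :: u) * cyc (y :: v) * cyc (z :: w)))%g.
Proof.
move=> U; have U2 : uniq ((y :: v) ++ (z :: w)).
  by move: U; rewrite cat_uniq => /and3P[].
rewrite [(y :: v) ++ _]/= cyc_cat // -cat_cons cyc_cat // !mulgA.
congr (_ * _ * _)%g; rewrite -!mulgA; congr (_ * _)%g.
apply: (@perm_disj_comm (mem (x :: u))) => a; last by move=> ?; rewrite cyc_out.
move=> au; move: U; rewrite cat_uniq => /and3P[_ /hasPn H _].
rewrite tpermD //; apply: contraTneq au => <-; apply: H.
  by rewrite inE eqxx.
by rewrite mem_cat [z \in z :: _]inE eqxx orbT.
Qed.

End PermCycles.

(** * Pairings of letters and commutator length *)

Section CommutatorProducts.
Variable G : groupType.
Implicit Types (g h : G) (m n : nat).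

Lemma commutator_productP n g : commutator_product n g <->
  exists2 s : seq (G * G), size s = n & g = (\prod_(p <- s) [~ p.1, p.2])%g.
Proof.
split=> [[a [b ->]]|[s <- ->]].
  exists [seq (a i, b i) | i <- enum 'I_n]; first by rewrite size_map size_enum_ord.
  by rewrite big_map enumT [index_enum _]unlock.
exists (fun i => (nth (1, 1)%g s i).1), (fun i => (nth (1, 1)%g s i).2).
by rewrite (big_nth (1, 1)%g) big_mkord.
Qed.

Lemma commutator_product0 g : commutator_product 0 g <-> g = 1%g.
Proof.
rewrite commutator_productP; split=> [[s /size0nil ->]|->]; first by rewrite big_nil.
by exists [::]; rewrite ?big_nil.
Qed.

Lemma commutator_productM m n g h :
  commutator_product m g -> commutator_product n h ->
  commutator_product (m + n) (g * h)%g.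
Proof.
move=> /commutator_productP[s <- ->] /commutator_productP[t <- ->].
apply/commutator_productP; exists (s ++ t); first by rewrite size_cat.
by rewrite big_cat.
Qed.

Lemma commutator_product1 a b : commutator_product 1 [~ a, b : G]%g.
Proof. by apply/commutator_productP; exists [:: (a, b)]; rewrite ?big_seq1. Qed.

Lemma commutator_productJ n g h :
  commutator_product n g -> commutator_product n (g ^ h)%g.
Proof.
move=> /commutator_productP[s <- ->]; apply/commutator_productP.
exists [seq (p.1 ^ h, p.2 ^ h)%g | p <- s]; first by rewrite size_map.
by rewrite big_map conjg_prod; apply: eq_bigr => p _; rewrite conjRg.
Qed.

Lemma commutator_productV n g :
  commutator_product n g -> commutator_product n (g^-1)%g.
Proof.
move=> /commutator_productP[s + ->]; elim: s n => [|p s IH] n <-.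
  by rewrite big_nil invg1; apply/commutator_product0.
rewrite big_cons invgM invgR /= -addn1.
by apply: commutator_productM; [exact: IH|exact: commutator_product1].
Qed.

Lemma commutator_product_leq m n g : (m <= n)%N ->
  commutator_product m g -> commutator_product n g.
Proof.
move=> mn cg; rewrite -(subnKC mn) -[g]mulg1; apply: commutator_productM => //.
apply/commutator_productP; exists (nseq (n - m) (1, 1)%g); rewrite ?size_nseq //.
by rewrite big1_seq // => p /andP[_ /nseqP[-> _]]; rewrite commgg.
Qed.

(** Exchanging two adjacent factors costs one commutator; this is the algebraic counterpart of
    removing a handle. *)
Lemma commutator_product_comm n a b g :
  commutator_product n (b * a * g)%g -> commutator_product n.+1 (a * b * g)%g.
Proof.
by move=> H; rewrite (commgCV a b) -mulgA -add1n; apply: commutator_productM;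
  first exact: commutator_product1.
Qed.

End CommutatorProducts.

Section Pairings.
Variables (T : finType) (A : Type) (inv : A -> A).
Implicit Types (lam : T -> A) (x y z : T) (s u v : seq T) (pi : {perm T}).

(** The fixed points of [pi] are exactly the points off [s], so [pi] glues all sides of a polygon
    labelled by [s]. The cycles of [cyc s * pi] are then the vertices of the glued surface, together
    with one singleton for each point off [s]. *)
Definition pairing lam s pi := [/\ involutive pi,
  forall x, (pi x == x) = (x \notin s) &
  forall x, x \in s -> lam (pi x) = inv (lam x)].

Lemma pairing_mem lam s pi x : pairing lam s pi -> (pi x \in s) = (x \in s).
Proof.
case=> piK fx _; apply: negb_inj.
by rewrite -!fx (inj_eq (@perm_inj _ pi)).
Qed.

Lemma eq_pairing lam s u pi : s =i u -> pairing lam s pi -> pairing lam u pi.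
Proof.
by move=> su [H1 H2 H3]; split=> // x; rewrite -su //; apply: H3.
Qed.

Lemma pairing_nil lam pi : pairing lam [::] pi -> pi = 1%g.
Proof. by case=> _ fx _; apply/permP => x; rewrite perm1; apply/eqP; rewrite fx. Qed.

(** Folding two adjacent paired sides destroys the vertex enclosed between them and releases two
    points as singletons, a net gain of one. For the word consisting of [x] and [y] alone, two
    vertices are traded for two singletons. *)
Lemma pairing_cancel lam x y s pi : uniq [:: x, y & s] ->
  pairing lam [:: x, y & s] pi -> pi x = y ->
  pairing lam s (tperm x y * pi)%g /\
  (ncycles (cyc [:: x, y & s] * pi)%g + (s != [::]) =
   ncycles (cyc s * (tperm x y * pi))%g)%N.
Proof.
move=> U [piK fx lx] pxy; have pyx : pi y = x by rewrite -pxy piK.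
move: (U) => /= /andP[]; rewrite inE negb_or => /andP[xy xs] /andP[ys us].
set pi' := (tperm x y * pi)%g.
have pi'x : pi' x = x by rewrite permM tpermL pyx.
have pi'y : pi' y = y by rewrite permM tpermR pxy.
have pi'D z : z != x -> z != y -> pi' z = pi z.
  by move=> zx zy; rewrite permM tpermD 1?eq_sym.
have comm : (pi' * tperm x y = pi)%g.
  have -> : (pi' * tperm x y = tperm x y * pi')%g.
    apply: (@perm_disj_comm _ (predC (pred2 x y))) => z /=.
      by rewrite negb_or => /andP[zx zy]; rewrite tpermD 1?eq_sym.
    by rewrite negbK => /orP[/eqP->|/eqP->].
  by rewrite /pi' mulgA tperm2 mul1g.
split.
  split=> [z|z|z zs].
  - have [->|zx] := eqVneq z x; first by rewrite pi'x.
    have [->|zy] := eqVneq z y; first by rewrite pi'y.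
    rewrite (pi'D z) // pi'D //; first by rewrite -pyx (inj_eq (@perm_inj _ pi)).
    by rewrite -pxy (inj_eq (@perm_inj _ pi)).
  - have [->|zx] := eqVneq z x; first by rewrite pi'x eqxx xs.
    have [->|zy] := eqVneq z y; first by rewrite pi'y eqxx ys.
    by rewrite pi'D // fx !inE !negb_or zx zy.
  - rewrite pi'D ?lx ?inE ?zs ?orbT //; first by apply: contraNneq xs => <-.
    by apply: contraNneq ys => <-.
case: s U ys {lx xs us} fx => [|z s] U ys fx.
  rewrite addn0 /= mulg1 mul1g; congr (ncycles _).
move: pi' comm pi'x pi'y pi'D => pi' comm _ pi'y _.
rewrite addn1 -comm -mulgA (ncyclesMC (tperm x y)) -!mulgA tperm2 mulg1.
rewrite ncycles_insert //.
  by rewrite permM (@cyc_out _ (z :: s)).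
by apply: contraNneq ys => ->; rewrite inE eqxx.
Qed.

End Pairings.

Lemma split_mem (T : eqType) (x : T) (s : seq T) : x \in s ->
  exists u v, s = u ++ x :: v.
Proof. by case/splitPr=> u v; exists u, v. Qed.

(** The linked pairs [x], [X] and [y], [Y] form a handle, and exchanging the two blocks removes it:
    the genus drops by one, which means two more vertices. If [z] is the first letter of
    [rcons d x], then [z], [y], [X] are consecutive on a cycle of [cyc s * pi], so that both
    transpositions brought in by the exchange split cycles. *)
Lemma ncycles_handle (T : finType) (x y X Y : T) b c d (pi : {perm T}) :
  let s := (y :: b) ++ (X :: rcons c Y) ++ rcons d x in
  let s' := (X :: rcons c Y) ++ (y :: b) ++ rcons d x in
  uniq s -> involutive pi -> pi x = X -> pi y = Y ->
  ncycles (cyc s' * pi)%g = (ncycles (cyc s * pi)%g).+2.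
Proof.
move=> s s' U piK pxX pyY.
have pYy : pi Y = y by rewrite -pyY piK.
have [z [w dE]] : exists z w, rcons d x = z :: w.
  by case: (d) => [|z w]; [exists x, [::]|exists z, (rcons w x)].
have U' : uniq s' by rewrite /s' uniq_catCA.
have cs_y : cyc s y = x.
  have e : s = ((y :: b) ++ (X :: rcons c Y) ++ d) ++ [:: x].
    by rewrite /s -!catA cats1.
  rewrite e cyc_rot -?e //; apply: cyc_prev.
  by have := U; rewrite e uniq_catC.
have cs_z : cyc s z = Y.
  have e : s = ((y :: b) ++ (X :: c)) ++ [:: Y, z & w].
    by rewrite /s dE -catA /= -cat_cons -cats1 -catA.
  rewrite e cyc_rot -?e //; apply: cyc_prev.
  by have := U; rewrite e uniq_catC.
have rho_y : (cyc s * pi)%g y = X by rewrite permM cs_y.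
have rho_z : (cyc s * pi)%g z = y by rewrite permM cs_z.
have Xs : X \in s by rewrite mem_cat inE mem_cat inE eqxx !orbT.
have yX : y != X.
  by apply: contraTneq U => e; rewrite /s e /= mem_cat inE eqxx !orbT.
have Xz : X != z.
  move: U; rewrite /s dE cat_uniq => /and3P[_ _].
  by apply: contraTneq => ->; rewrite /= mem_cat inE eqxx !orbT.
have yz : y != z.
  by apply: contraTneq U => e; rewrite /s dE e /= !(mem_cat, inE) eqxx !orbT.
move: cs_y cs_z rho_y rho_z; rewrite /s /s' dE => cs_y cs_z rho_y rho_z.
have Uz : uniq ((y :: b) ++ (X :: rcons c Y) ++ z :: w) by rewrite -dE.
have Uz' : uniq ((X :: rcons c Y) ++ (y :: b) ++ z :: w) by rewrite uniq_catCA.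
set rho := (cyc _ * pi)%g in rho_y rho_z *.
have -> : (cyc ((X :: rcons c Y) ++ (y :: b) ++ z :: w) * pi =
           tperm y X * (tperm X z * rho))%g.
  have C := @cyc_comm _ (y :: b) (X :: rcons c Y).
  rewrite /rho !cyc_cat3 // C; last by move: Uz; rewrite catA cat_uniq => /andP[].
  rewrite (tpermC X y) !mulgA; congr (_ * _ * _ * _ * _)%g.
  have := tpermJ y X (tperm X z); rewrite tpermL (tpermD _ _) 1?eq_sym //.
  by rewrite /conjg tpermV => <-; rewrite !mulgA.
clearbody rho.
have z1 : (tperm X z * rho)%g X = y by rewrite permM tpermL rho_z.
rewrite !ncycles_split //.
  by apply/porbitP; exists 2%N; rewrite expgS expg1 permM rho_z rho_y.
by rewrite -{1}z1; apply: (mem_porbit _ 1).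
Qed.

Section PairingGenus.
Variables (T : finType) (G : groupType) (g : T -> G).
Implicit Types (s u v : seq T) (pi : {perm T}).

Local Notation ev s := (\prod_(x <- s) g x)%g.

Let evcat u v : ev (u ++ v) = (ev u * ev v)%g.
Proof. by rewrite big_cat. Qed.

Lemma commutator_product_rot m (a b : G) :
  commutator_product m (a * b)%g -> commutator_product m (b * a)%g.
Proof.
have -> : (b * a = (a * b) ^ a)%g by rewrite /conjg -mulgA mulKg.
exact: commutator_productJ.
Qed.

(** The equation is Euler's formula [V - size s / 2 + 1 = 2 - 2 m] with [V = ncycles (cyc s * pi) -
    (#|T| - size s)], multiplied by 2. *)
Let genus_spec s pi := exists m, commutator_product m (ev s) /\
  (2 * ncycles (cyc s * pi)%g + 4 * m + size s = 2 * #|T| + 2)%N.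

Lemma pairing_genus_cancel x y v pi : uniq [:: x, y & v] ->
  pairing invg g [:: x, y & v] pi -> pi x = y ->
  (forall pi', v != [::] -> pairing invg g v pi' -> genus_spec v pi') ->
  genus_spec [:: x, y & v] pi.
Proof.
move=> U Pi pxy IH; have [Pi' V'] := pairing_cancel U Pi pxy.
have gxy : (g x * g y = 1)%g.
  by case: Pi => _ _ H; rewrite -pxy H ?inE ?eqxx // mulgV.
rewrite /genus_spec !big_cons mulgA gxy mul1g; case: v {U Pi} IH Pi' V' => [|z v] IH Pi' V'.
  exists 0%N; split; first by rewrite big_nil; apply/commutator_product0.
  move: V'; rewrite addn0 (pairing_nil Pi') mulg1 ncycles1 => ->; rewrite /=; lia.
have [//|m [cm e]] := IH _ _ Pi'; exists m; split=> //.
by rewrite /= in V' e *; rewrite -V' in e; lia.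
Qed.

(* Either two adjacent letters are paired and cancel, or [x y b X c Y d] is
   the product of a commutator and a conjugate of [X c Y y b d x], in which
   [x X] cancels. *)
Lemma pairing_genus s pi : uniq s -> s != [::] -> pairing invg g s pi ->
  exists m, commutator_product m (ev s) /\
  (2 * ncycles (cyc s * pi)%g + 4 * m + size s = 2 * #|T| + 2)%N.
Proof.
have [n] := ubnP (size s); elim: n s pi => // n IHn s pi.
case: s => // x s /ltnSE ss U _ Pi.
(* Inner induction on the distance from the first letter to its partner: if the partner of the next
   letter [y] lies before that of [x], the word rotated to start at [y] has a smaller distance. *)
have [k] := ubnP (index (pi x) s); elim: k x s ss U Pi => // k IHk x s ss U Pi /ltnSE ks.
have [piK fx lx] := Pi.
have pm z : (pi z \in x :: s) = (z \in x :: s) by apply: pairing_mem Pi.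
have /split_mem[u [v sE]] : pi x \in s.
  by have := pm x; rewrite !in_cons eqxx fx in_cons eqxx.
case: u => [|y b] in sE.
  rewrite sE /= in ss U Pi *; apply: (@pairing_genus_cancel) => // pi' v0.
  by apply: IHn => //=; [lia|case/and3P: U].
have Uu : uniq ((x :: y :: b) ++ pi x :: v) by rewrite cat_cons -sE.
have pyx : pi y != x.
  apply: contraTneq Uu => <-; rewrite piK /= !(mem_cat, in_cons) eqxx.
  by rewrite !orbT /= ?andbF.
have pypx : pi y != pi x.
  rewrite (inj_eq (@perm_inj _ pi)); apply: contraTneq Uu => ->.
  by rewrite /= inE eqxx.
have pyy : pi y != y by rewrite fx sE !inE eqxx orbT.
have : (pi y \in b) || (pi y \in v).
  have : pi y \in x :: s by rewrite pm sE !inE eqxx orbT.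
  by rewrite sE in_cons (negPf pyx) mem_cat in_cons (negPf pyy) in_cons (negPf pypx).
case/orP.
  case/split_mem=> b1 [b2 bE].
  pose s1 := (b1 ++ pi y :: b2 ++ pi x :: v) ++ [:: x].
  have xs : x :: s = [:: x] ++ (y :: b1 ++ pi y :: b2 ++ pi x :: v).
    by rewrite sE bE /= -!catA.
  have ys1 : y :: s1 = (y :: b1 ++ pi y :: b2 ++ pi x :: v) ++ [:: x] by [].
  have U1 : uniq (y :: s1) by rewrite ys1 uniq_catC -xs.
  have sz : size (y :: s1) = size (x :: s).
    by rewrite ys1 xs !size_cat addnC.
  have Pi1 : pairing invg g (y :: s1) pi.
    by apply: eq_pairing Pi => z; rewrite xs ys1 !mem_cat orbC.
  have [||m [cm e]] := IHk y s1 _ U1 Pi1.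
  - by move: sz => /= -[->].
  - move: U1; rewrite /s1 -catA => /= /andP[_]; rewrite cat_uniq => /and3P[_ /hasPn H _].
    have b1n : pi y \notin b1 by apply: H; rewrite inE eqxx.
    rewrite index_cat (negPf b1n) /= eqxx addn0.
    apply: leq_trans ks; rewrite sE bE /= -catA index_cat.
    have pxb1 : pi x \notin b1.
      by apply: H; rewrite !(mem_cat, in_cons) eqxx !orbT.
    have -> : (y == pi x) = false.
      by apply/negP => /eqP e; move: Uu; rewrite /= e !(mem_cat, in_cons) eqxx !orbT andbF.
    by rewrite (negPf pxb1) /=; lia.
  have cE : cyc (x :: s) = cyc (y :: s1) by rewrite ys1 -cyc_rot -?xs.
  exists m; split; last by rewrite cE -sz.
  by rewrite xs evcat; apply: commutator_product_rot; rewrite -evcat.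
(* Now the two pairs are linked. [s2] arises from the rotation [s1] by exchanging the two blocks,
   and [s4] is what remains once [x] and [X], cyclically adjacent in [s2], are cancelled. *)
case/split_mem=> c [d vE]; rewrite {}vE in sE.
set X := pi x in sE *; set Y := pi y in sE *.
pose s1 := (y :: b) ++ (X :: rcons c Y) ++ rcons d x.
pose s2 := (X :: rcons c Y) ++ (y :: b) ++ rcons d x.
pose s4 := rcons c Y ++ (y :: b) ++ d.
have xs : x :: s = [:: x] ++ ((y :: b) ++ (X :: rcons c Y) ++ d).
  by rewrite sE /= cat_rcons.
have s1E : s1 = ((y :: b) ++ (X :: rcons c Y) ++ d) ++ [:: x].
  by rewrite /s1 -[rcons d x]cats1 !catA.
have s2E : s2 = (X :: s4) ++ [:: x] by rewrite /s2 /s4 -[rcons d x]cats1 !catA.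
have U1 : uniq s1 by rewrite s1E uniq_catC -xs.
have U2 : uniq s2 by rewrite uniq_catCA.
have U3 : uniq [:: x, X & s4] by have := U2; rewrite s2E uniq_catC.
have P3 : pairing invg g [:: x, X & s4] pi.
  apply: eq_pairing Pi => z; rewrite xs /s4 !(mem_cat, in_cons, mem_rcons) in_nil.
  by case: (z == x); case: (z == y); case: (z == X); case: (z == Y);
    case: (z \in b); case: (z \in c); case: (z \in d).
have sz : size s = (size s4).+1.
  have : size (x :: s) = size [:: x, X & s4].
    rewrite xs /s4 /= !(size_cat, size_rcons) /= ?(size_cat, size_rcons); lia.
  by case.
have s40 : s4 != [::] by rewrite /s4; case: (c).
have [Pi' V'] := pairing_cancel U3 P3 erefl.
have U4 : uniq s4 by case/and3P: U3.
have [|m [cm e]] := IHn s4 _ _ U4 s40 Pi'; first by move: ss; rewrite /= sz => /ltnW.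
have V2 := ncycles_handle U1 piK erefl erefl.
rewrite -/s1 -/s2 in V2.
exists m.+1; split.
  rewrite xs evcat; apply: commutator_product_rot; rewrite -evcat -s1E.
  rewrite /s1 !evcat mulgA; apply: commutator_product_comm; rewrite -mulgA.
  rewrite -!evcat -/s2 s2E evcat; apply: commutator_product_rot.
  rewrite big_seq1 big_cons mulgA lx ?inE ?eqxx // mulgV mul1g; exact: cm.
have cE : cyc (x :: s) = cyc s1 by rewrite s1E -cyc_rot -?xs.
rewrite cE [size (x :: s)]/= sz.
move: V2; rewrite s2E cyc_rot -?s2E // -[[:: x] ++ X :: s4]/[:: x, X & s4] => V2.
move: e; rewrite -V' V2 s40 addn1 => e; clear -e.
by move: e; move: (ncycles _) (size s4) #|T| => a n1 n2; lia.
Qed.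

End PairingGenus.

(** Two equally labelled letters may trade partners. Together with [ncycles_flip] this is the basic
    move that modifies a pairing without losing vertices. *)
Lemma pairing_flip (T : finType) (A : Type) (inv : A -> A) (lam : T -> A) s
    (pi : {perm T}) x z : pairing inv lam s pi -> x \in s -> z \in s ->
  lam x = lam z -> pairing inv lam s (pi ^ tperm x z)%g.
Proof.
move=> Pi xs zs lxz; have [piK fx lx] := Pi; set t := tperm x z.
have JE y : (pi ^ t)%g y = t (pi (t y)) by rewrite /conjg tpermV !permM.
have ts y : (t y \in s) = (y \in s).
  by rewrite /t; case: tpermP => [->|->|//]; rewrite ?xs ?zs.
have lt y : lam (t y) = lam y by rewrite /t; case: tpermP => [->|->|].
split=> y; rewrite !JE.
- by rewrite tpermK piK tpermK.
- by rewrite (can2_eq (@tpermK _ x z) (@tpermK _ x z)) fx ts.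
- by move=> ys; rewrite lt lx ?ts // lt.
Qed.

(** By [cyc_cat3] both permutations are one transposition away from a common permutation [q]. *)
Lemma ncycles_swap (T : finType) (u v w : seq T) (pi : {perm T}) :
  uniq (u ++ v ++ w) ->
  (ncycles (cyc (u ++ v ++ w) * pi)%g <= (ncycles (cyc (v ++ u ++ w) * pi)%g).+2)%N.
Proof.
case: u => [|x u] U; first by rewrite leqW // leqW.
case: v => [|y v] in U *; first by rewrite leqW // leqW.
case: w => [|z w] in U *.
  by rewrite !cats0 in U *; rewrite cyc_rot // leqW // leqW.
have C : commute (cyc (x :: u)) (cyc (y :: v)).
  by apply: cyc_comm; move: U; rewrite catA cat_uniq => /andP[].
have U' : uniq ((y :: v) ++ (x :: u) ++ (z :: w)) by rewrite uniq_catCA.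
rewrite !cyc_cat3 // -C.
have xy : x != y.
  by apply: contraTneq U => ->; rewrite /= mem_cat inE eqxx !orbT.
have xz : x != z.
  apply: contraTneq U => ->.
  by rewrite cat_cons cons_uniq !mem_cat [z \in z :: w]inE eqxx !orbT.
have yz : y != z.
  by apply: contraTneq U' => ->; rewrite cat_cons cons_uniq !mem_cat [z \in z :: w]inE eqxx !orbT.
have -> : (tperm x y * tperm y z = tperm x z * tperm x y)%g.
  have := tpermJ y z (tperm x y); rewrite tpermR tpermD // => <-.
  by rewrite /conjg tpermV -!mulgA tperm2 mulg1.
have -> : (tperm y x * tperm x z = tperm y z * tperm x y)%g.
  have := tpermJ x z (tperm x y); rewrite tpermL tpermD // => <-.
  by rewrite /conjg tpermV -!mulgA tperm2 mulg1 tpermC.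
rewrite -!mulgA; set q := (tperm x y * _)%g.
apply: (leq_trans (n := (ncycles q).+1)); last by rewrite ltnS ncycles_tperm_le.
have := ncycles_tperm_le (tperm x z * q)%g x z.
by rewrite (mulgA (tperm x z) (tperm x z)) tperm2 mul1g.
Qed.

Lemma map_eq_cat (A B : Type) (f : A -> B) s (u v : seq B) : map f s = u ++ v ->
  exists s1 s2, [/\ s = s1 ++ s2, map f s1 = u & map f s2 = v].
Proof.
move=> e; exists (take (size u) s), (drop (size u) s); split.
- by rewrite cat_take_drop.
- by rewrite map_take e take_size_cat.
- by rewrite map_drop e drop_size_cat.
Qed.

(** * Words in a free group and pairings of their letters *)

Section FreeWords.
Variable l : nat.
Implicit Types (a b : letter l) (u v w : seq (letter l)).

Definition weval w : free_group l := (\prod_(x <- w) letter_val (@free_gen l) x)%g.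

Lemma free_word_weval w : free_word (weval w) = word_mul w [::].
Proof.
elim: w => [|x w IH]; first by rewrite /weval big_nil.
rewrite /weval big_cons /=; rewrite -[X in _ = word_cons x X]IH.
by case: x => i [].
Qed.

Lemma weval_cat u v : weval (u ++ v) = (weval u * weval v)%g.
Proof. by rewrite /weval big_cat. Qed.

Lemma weval_inv w : weval (word_inv w) = ((weval w)^-1)%g.
Proof.
elim: w => [|x w IH]; first by rewrite /weval big_nil invg1.
rewrite /word_inv /= rev_cons -cats1 weval_cat -/(word_inv w) IH.
by rewrite /weval big_seq1 big_cons invgM letter_valV.
Qed.

Lemma free_wordK (g : free_group l) : weval g = g.
Proof. by apply/val_inj; rewrite /= free_word_weval word_mul1 ?(valP g). Qed.

Variable a0 : letter l.

(* The points of ['I_N] outside [s] are fixed and count as cycles; they leave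
   room for the insertion of letters. *)
Definition paired_word w m := exists N0, forall N, (N0 <= N)%N ->
  exists (lam : 'I_N -> letter l) (s : seq 'I_N) (pi : {perm 'I_N}),
  [/\ uniq s, map lam s = w, pairing (@letter_inv l) lam s pi &
    (2 * N <= 2 * ncycles (cyc s * pi)%g + 4 * m + size s)%N].

(** The bound in [paired_word] omits the [+ 2] of Euler's formula. This lets the empty word qualify
    with [m = 0]; for nonempty words a slack of 2 is harmless, since one handle counts 4. *)
Lemma paired_word_nil : paired_word [::] 0.
Proof.
exists 0%N => N _; exists (fun=> a0), [::], 1%g; split=> //.
  by split=> [x|x|//]; rewrite ?perm1 ?eqxx.
by rewrite /= mulg1 ncycles1 card_ord !addn0.
Qed.

Lemma paired_word_rot u v m : paired_word (u ++ v) m -> paired_word (v ++ u) m.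
Proof.
case=> N0 H; exists N0 => N /H[lam [s [pi [U e P c]]]].
have [s1 [s2 [sE e1 e2]]] := map_eq_cat e; exists lam, (s2 ++ s1), pi.
rewrite sE in U P c; split; first by rewrite uniq_catC.
- by rewrite map_cat e1 e2.
- by apply: eq_pairing P => z; rewrite !mem_cat orbC.
- by rewrite -cyc_rot // size_cat (addnC (size s2)) -size_cat.
Qed.

Lemma paired_word_swap u v w m :
  paired_word (u ++ v ++ w) m -> paired_word (v ++ u ++ w) m.+1.
Proof.
case=> N0 H; exists N0 => N /H[lam [s [pi [U e P c]]]].
have [s1 [s23 [sE e1 /map_eq_cat[s2 [s3 [s23E e2 e3]]]]]] := map_eq_cat e.
rewrite {}s23E in sE; rewrite sE in U P c.
exists lam, (s2 ++ s1 ++ s3), pi; split; first by rewrite uniq_catCA.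
- by rewrite !map_cat e1 e2 e3.
- by apply: eq_pairing P => z; rewrite !mem_cat orbCA.
- move: c (ncycles_swap pi U); rewrite !size_cat.
  move: (ncycles _) (ncycles _) (size s1) (size s2) (size s3) => n1 n2 a b c.
  lia.
Qed.

Lemma paired_word_insert a u v m :
  paired_word (u ++ v) m -> paired_word (u ++ a :: letter_inv a :: v) m.
Proof.
move=> /paired_word_rot H; apply: (@paired_word_rot (a :: letter_inv a :: v)).
rewrite /= ; move: (v ++ u) H => {u}v [N0 H].
(* Two spare points off [s] are needed to carry the inserted letters. *)
exists (maxn N0 (size v).+2) => N; rewrite geq_max => /andP[/H{H} + vN].
move=> [lam [s [pi [U e P c]]]].
have sv : size s = size v by rewrite -e size_map.
have [x [y [xs ys xy]]] : exists x y, [/\ x \notin s, y \notin s & x != y].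
  have : (1 < size [seq z <- enum 'I_N | z \notin s])%N.
    rewrite size_filter; have := count_predC (mem s) (enum 'I_N).
    have -> : count (mem s) (enum 'I_N) = size s.
      rewrite -size_filter; apply/perm_size/uniq_perm => //.
        by rewrite filter_uniq // enum_uniq.
      by move=> z; rewrite mem_filter mem_enum andbT.
    by rewrite size_enum_ord (eq_count (a2 := fun z => z \notin s)) //; lia.
  have := filter_uniq (fun z => z \notin s) (enum_uniq 'I_N).
  have : {subset [seq z <- enum 'I_N | z \notin s] <= [pred z | z \notin s]}.
    by move=> z; rewrite mem_filter => /andP[].
  case: [seq z <- _ | _] => [|x [|y t]] // H /= /andP[+ _] _.
  rewrite inE negb_or => /andP[xy _]; exists x, y.
  by split=> //; apply: H; rewrite !inE eqxx ?orbT.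
have [piK fx lx] := P.
have px : pi x = x by apply/eqP; rewrite fx.
have py : pi y = y by apply/eqP; rewrite fx.
pose lam' z := if z == x then a else if z == y then letter_inv a else lam z.
have lamS z : z \in s -> lam' z = lam z.
  move=> zs; rewrite /lam'; case: eqP => [e1|_]; first by rewrite -e1 zs in xs.
  by case: eqP => [e1|//]; rewrite -e1 zs in ys.
have lamx : lam' x = a by rewrite /lam' eqxx.
have lamy : lam' y = letter_inv a by rewrite /lam' eq_sym (negPf xy) eqxx.
have U' : uniq [:: x, y & s] by rewrite /= inE negb_or xy xs ys.
have pi'D z : z != x -> z != y -> (tperm x y * pi)%g z = pi z.
  by move=> zx zy; rewrite permM tpermD 1?eq_sym.
have pi'x : (tperm x y * pi)%g x = y by rewrite permM tpermL.
have pi'y : (tperm x y * pi)%g y = x by rewrite permM tpermR.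
have sx z : z \in s -> z != x by apply: contraTneq => ->.
have sy z : z \in s -> z != y by apply: contraTneq => ->.
have P' : pairing (@letter_inv l) lam' [:: x, y & s] (tperm x y * pi)%g.
  split=> z.
  - have [->|zx] := eqVneq z x; first by rewrite pi'x pi'y.
    have [->|zy] := eqVneq z y; first by rewrite pi'y pi'x.
    rewrite (pi'D z) // pi'D //; first by rewrite -px (inj_eq (@perm_inj _ pi)).
    by rewrite -py (inj_eq (@perm_inj _ pi)).
  - have [->|zx] := eqVneq z x; first by rewrite pi'x eq_sym (negPf xy) inE eqxx.
    have [->|zy] := eqVneq z y.
      by rewrite pi'y (negPf xy) !inE eqxx orbT.
    by rewrite pi'D // fx !inE (negPf zx) (negPf zy).
  - rewrite !inE => /or3P[/eqP->|/eqP->|zs].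
    + by rewrite pi'x lamx lamy.
    + by rewrite pi'y lamx lamy letter_invK.
    + by rewrite pi'D ?sx ?sy // !lamS ?(pairing_mem _ P) // lx.
exists lam', [:: x, y & s], (tperm x y * pi)%g; split=> //.
  by rewrite /= lamx lamy -e; congr [:: _, _ & _]; apply/eq_in_map.
have [_ V'] := pairing_cancel U' P' pi'x.
rewrite (mulgA (tperm x y) (tperm x y)) tperm2 mul1g in V'.
have -> : size [:: x, y & s] = (size s).+2 by [].
move: c V'; case: (boolP (s == [::])) => [/eqP s0|_]; last first.
  by move: (ncycles _) (ncycles _) (size s) => n1 n2 a1 c /=; lia.
rewrite s0 in P *; rewrite [X in X = _ -> _]addn0 => c V'; rewrite V'.
by rewrite /= mul1g (pairing_nil P) ncycles1 card_ord -addnA leq_addr.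
Qed.

(** The two adjacent letters [x] and [y] need not be partners. But [pi x] has the label of [y] and
    follows [y] on its cycle of [cyc s * pi], so a flip makes [x] and [y] partners without losing
    vertices, and then they cancel. *)
Lemma paired_word_delete a u v m :
  paired_word (u ++ a :: letter_inv a :: v) m -> paired_word (u ++ v) m.
Proof.
move=> /paired_word_rot H; apply: paired_word_rot; rewrite /= in H.
move: (v ++ u) H => {u}v [N0 H]; exists N0 => N /H{H}[lam [s [pi [U e P c]]]].
case: s => [|x [|y s]] // in U e P c *; case: e => lx ly e.
have [piK fx lpi] := P; pose t := tperm y (pi x).
have xxs : x \in [:: x, y & s] by rewrite inE eqxx.
have pxs : pi x \in [:: x, y & s] by rewrite (pairing_mem _ P).
have P1 : pairing (@letter_inv l) lam [:: x, y & s] (pi ^ t)%g.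
  apply: pairing_flip => //; first by rewrite !inE eqxx orbT.
  by rewrite ly lpi // lx.
have xy : x != y by move: U; rewrite /= inE negb_or -andbA => /andP[].
have p1x : (pi ^ t)%g x = y.
  rewrite /conjg tpermV !permM (@tpermD _ y (pi x) x) 1?eq_sym ?tpermR //.
  by rewrite eq_sym fx xxs.
have [P2 V2] := pairing_cancel U P1 p1x.
exists lam, s, (tperm x y * pi ^ t)%g; split=> //; first by case/and3P: U.
have : (ncycles (cyc [:: x, y & s] * pi)%g <=
        ncycles (cyc [:: x, y & s] * pi ^ t)%g)%N.
  apply: ncycles_flip; have -> : pi x = (cyc [:: x, y & s] * pi)%g y.
    by rewrite permM cyc_prev.
  exact: (mem_porbit _ 1).
move: V2 c; have -> : size [:: x, y & s] = (size s).+2 by [].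
case: (boolP (s == [::])) => [/eqP s0|_]; last first.
  by move: (ncycles _) (ncycles _) (ncycles _) (size s) => n1 n2 n3 n4; rewrite addn1; lia.
rewrite s0 in P2 *; rewrite addn0 => _ _ _.
by rewrite /= mul1g (pairing_nil P2) ncycles1 card_ord -addnA leq_addr.
Qed.

Lemma paired_word_insert_inv u v w m :
  paired_word (u ++ v) m -> paired_word (u ++ word_inv w ++ w ++ v) m.
Proof.
elim: w u v => [|a w IH] u v H //.
rewrite /word_inv /= rev_cons -cats1 -/(word_inv w) -catA.
rewrite (catA u) -[[:: letter_inv a] ++ _]/(letter_inv a :: a :: w ++ v).
rewrite -{2}[a]letter_invK; apply: paired_word_insert.
by rewrite -catA; apply: IH.
Qed.

Lemma paired_word_reduce w u m :
  paired_word (u ++ w) m <-> paired_word (u ++ word_mul w [::]) m.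
Proof.
elim: w u => [|a w IH] u //=.
rewrite -cat_rcons IH cat_rcons.
case: (word_mul w [::]) => [|b v] //=; case: eqP => [->|_] //.
by split=> [/paired_word_delete|/(paired_word_insert a)].
Qed.

(** This is the converse of [pairing_genus]. A commutator spelled out without cancellation is
    obtained by inserting the inverse pairs [g^-1 g] and [h^-1 h], which costs nothing, and one
    exchange of blocks, which costs one handle. The pairing is then carried to [w] through the
    common reduced form. *)
Lemma commutator_product_paired w m :
  commutator_product m (weval w) -> paired_word w m.
Proof.
move=> /commutator_productP[t + wE].
have [v vE v_paired] : exists2 v, weval v = (\prod_(p <- t) [~ p.1, p.2])%g &
  paired_word v (size t).
  elim: t {wE} => [|[g h] t [v vE IH]].
    by exists [::]; [rewrite /weval !big_nil | exact: paired_word_nil].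
  exists (word_inv g ++ word_inv h ++ (g : seq _) ++ (h : seq _) ++ v).
    rewrite big_cons -vE !weval_cat !weval_inv !free_wordK /=.
    by rewrite commgEl /conjg !mulgA.
  have := @paired_word_insert_inv [::] v h _ IH; rewrite /= => /(@paired_word_insert_inv [::] _ g).
  rewrite /= => /paired_word_rot; rewrite -!catA.
  move=> /paired_word_swap H.
  by apply: paired_word_rot; rewrite -!catA.
move=> <-.
apply/(paired_word_reduce w [::]).
by rewrite /= -free_word_weval wE -vE free_word_weval -(paired_word_reduce v [::]).
Qed.

End FreeWords.

(** * Small cancellation *)

(** Greedy completion. If an unmatched [x] had no unmatched point of inverse label, then [mu] would
    inject all points of the inverse label into those labelled like [x] while missing [x], against
    the balance of labels. *)
Lemma extend_matching (P : finType) (A : eqType) (inv : A -> A) (lab : P -> A)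
    (mu : {perm P}) :
  involutive inv -> (forall a, inv a != a) -> involutive mu ->
  (forall x, mu x != x -> lab (mu x) = inv (lab x)) ->
  (forall a, #|[pred x | lab x == a]| = #|[pred x | lab x == inv a]|) ->
  exists nu : {perm P}, [/\ involutive nu, forall x, nu x != x,
    forall x, lab (nu x) = inv (lab x) & forall x, mu x != x -> nu x = mu x].
Proof.
move=> invK invF muK mul bal.
have [n] := ubnP #|[pred x | mu x == x]|; elim: n mu muK mul => // n IH mu muK mul /ltnSE le_n.
have [x /eqP mx|nf] := pickP [pred x | mu x == x]; last first.
  exists mu; split=> //; first by move=> x; move: (nf x) => /= ->.
  by move=> x; apply: mul; move: (nf x) => /= ->.
have [y /andP[/eqP my /eqP ly]|ny] := pickP [pred y | (mu y == y) && (lab y == inv (lab x))].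
  have xy : x != y by apply/eqP => xy; have := invF (lab x); rewrite -ly xy eqxx.
  pose mu' := (tperm x y * mu)%g.
  have m'x : mu' x = y by rewrite permM tpermL my.
  have m'y : mu' y = x by rewrite permM tpermR mx.
  have m'D z : z != x -> z != y -> mu' z = mu z.
    by move=> zx zy; rewrite permM tpermD 1?eq_sym.
  have mD z : z != x -> z != y -> (mu z != x) && (mu z != y).
    by move=> zx zy; rewrite -{1}mx -{1}my !(inj_eq (@perm_inj _ mu)) zx.
  have [|||nu [nuK nuF nul num]] := IH mu'.
  - move=> z; have [->|zx] := eqVneq z x; first by rewrite m'x.
    have [->|zy] := eqVneq z y; first by rewrite m'y.
    by have /andP[? ?] := mD z zx zy; rewrite (m'D z) // m'D.
  - move=> z; have [->|zx] := eqVneq z x; first by rewrite m'x ly.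
    have [->|zy] := eqVneq z y; first by rewrite m'y ly invK.
    by rewrite m'D //; apply: mul.
  - apply: leq_trans le_n; apply/proper_card/properP; split.
      apply/fintype.subsetP => z; rewrite !inE.
      have [->|zx] := eqVneq z x; first by rewrite mx.
      have [->|zy] := eqVneq z y; first by rewrite my.
      by rewrite m'D.
    by exists x; rewrite !inE ?mx // m'x eq_sym.
  exists nu; split=> // z mz; rewrite num.
    rewrite m'D //; first by apply: contraNneq mz => ->; rewrite mx.
    by apply: contraNneq mz => ->; rewrite my.
  rewrite m'D //; first by apply: contraNneq mz => ->; rewrite mx.
  by apply: contraNneq mz => ->; rewrite my.
suff : (#|[pred z | lab z == lab x]| < #|[pred z | lab z == lab x]|)%N by rewrite ltnn.
rewrite [X in (X < _)%N]bal -(card_imset _ (@perm_inj _ mu)).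
apply/proper_card/properP; split.
  apply/fintype.subsetP => _ /imsetP[z + ->]; rewrite !inE => /eqP lz.
  rewrite mul ?lz ?invK //; apply/negP => /eqP mz.
  by have := ny z; rewrite /= mz lz !eqxx.
exists x; rewrite ?inE //; apply/negP => /imsetP[z + xz]; rewrite inE => /eqP lz.
have zx : z = x by apply: (@perm_inj _ mu); rewrite mx -xz.
by have := invF (lab x); rewrite -lz zx eqxx.
Qed.

Lemma rev_lt n i : (i < n)%N -> (n - i.+1 < n)%N.
Proof. by case: n => // n _; rewrite subSS ltnS leq_subr. Qed.

(** * Zipping a pairing of the letters of an image word *)

Section Zipping.
Variables (k l : nat) (T P : finType) (lab : P -> letter k).
Variables (Phi : letter k -> seq (letter l)) (a0 : letter l).
Hypothesis PhiV : forall a, Phi (letter_inv a) = word_inv (Phi a).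

Let L p := size (Phi (lab p)).

Variables (lam : T -> letter l) (s : seq T) (e : P -> nat -> T).
Hypothesis e_mem : forall p i, (i < L p)%N -> e p i \in s.
Hypothesis e_onto : forall x, x \in s -> exists p i, (i < L p)%N /\ x = e p i.
Hypothesis e_inj : forall p i q j, (i < L p)%N -> (j < L q)%N ->
  e p i = e q j -> p = q /\ i = j.
Hypothesis e_lam : forall p i, (i < L p)%N -> lam (e p i) = nth a0 (Phi (lab p)) i.

Variable c : {perm T}.
Hypothesis c_succ : forall p i, (i.+1 < L p)%N -> c (e p i.+1) = e p i.

Implicit Types (pi : {perm T}) (p q r : P) (i j : nat).

Local Notation paired := (pairing (@letter_inv l) lam s).

Definition opposite p q := lab q = letter_inv (lab p).

(** [e p i] is the [i]-th letter of the block [p], the image of one letter of the source word.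
    Inverse blocks are glued in opposite directions, so place [i] of one faces place [L p - i.+1] of
    the other. *)
Definition aligned pi p q i := pi (e p i) = e q (L p - i.+1).

Definition matched pi p q :=
  opposite p q /\ forall i, (i < L p)%N -> aligned pi p q i.

Lemma letter_inv_neq n (a : letter n) : letter_inv a != a.
Proof. by case: a => i []; apply/eqP. Qed.

Lemma opposite_sym p q : opposite p q -> opposite q p.
Proof. by rewrite /opposite => ->; rewrite letter_invK. Qed.

Lemma opposite_neq p q : opposite p q -> p != q.
Proof.
by move=> o; apply/eqP => pq; have := letter_inv_neq (lab p); rewrite -o pq eqxx.
Qed.

Lemma opposite_size p q : opposite p q -> L q = L p.
Proof. by rewrite /L => ->; rewrite PhiV size_rev size_map. Qed.

Lemma opposite_nth p q i : opposite p q -> (i < L p)%N ->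
  letter_inv (lam (e q (L p - i.+1))) = lam (e p i).
Proof.
move=> o ip; have Lq := opposite_size o.
rewrite !e_lam ?Lq //; last by rewrite -subSn // leq_subLR addnC -addn1 leq_add2l.
rewrite o PhiV /word_inv nth_rev ?size_map -/(L p); last first.
  by rewrite -subSn // leq_subLR addnC -addn1 leq_add2l.
have -> : (L p - (L p - i.+1).+1 = i)%N by move: (L p) ip => n; lia.
by rewrite (nth_map a0) // letter_invK.
Qed.

Lemma aligned_sym pi p q i : paired pi -> opposite p q -> (i < L p)%N ->
  aligned pi p q i -> aligned pi q p (L p - i.+1).
Proof.
move=> [piK _ _] o ip; rewrite /aligned (opposite_size o) => <-; rewrite piK.
by congr (e p _); move: (L p) ip => n; lia.
Qed.

Lemma matched_sym pi p q : paired pi -> matched pi p q -> matched pi q p.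
Proof.
move=> Pi [ o H]; split; first exact: opposite_sym.
move=> i; rewrite (opposite_size o) => ip.
have -> : i = (L p - (L p - i.+1).+1)%N by move: (L p) ip => n; lia.
by apply: aligned_sym => //; last apply: H; move: (L p) ip => n; lia.
Qed.

Lemma matched_aligned pi p q r i : paired pi -> matched pi p r ->
  opposite p q -> (i < L p)%N -> aligned pi p q i -> r = q.
Proof.
move=> Pi [ o H] oq ip; rewrite /aligned H // => /e_inj[] //.
  by rewrite (opposite_size o); move: (L p) ip => n; lia.
by rewrite (opposite_size oq); move: (L p) ip => n; lia.
Qed.

(** The letter [x] at place [i.+1] of [p] trades partners with [z], the present partner of the place
    of [q] that should face it. Alignment at [i] makes [z] the second iterate of [x] under [c * pi],
    so [ncycles_flip] applies. Neither [p] nor [q] is matched, and matched blocks are closed under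
    [pi], so the flip does not touch them. *)
Lemma zip_step pi p q i : paired pi -> opposite p q -> (i.+1 < L p)%N ->
  aligned pi p q i -> ~ aligned pi p q i.+1 ->
  exists pi', [/\ paired pi', (ncycles (c * pi)%g <= ncycles (c * pi')%g)%N,
    aligned pi' p q i.+1,
    forall j, (j < L p)%N -> aligned pi p q j -> aligned pi' p q j &
    forall r r', matched pi r r' -> matched pi' r r'].
Proof.
move=> Pi o ip ai nai; have [piK fx lx] := Pi; have Lq := opposite_size o.
have qi : (L p - i.+2 < L q)%N by rewrite Lq; move: (L p) ip => n; lia.
have ip' : (i < L p)%N by apply: ltnW.
pose x := e p i.+1; pose y := e q (L p - i.+2); pose z := pi y.
have xs : x \in s by apply: e_mem.
have ys : y \in s by apply: e_mem.
have zs : z \in s by rewrite (pairing_mem _ Pi).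
have pq := opposite_neq o.
have xy : x != y by apply/eqP => /e_inj[] // pq'; rewrite pq' eqxx in pq.
have yz : y != z by rewrite eq_sym fx ys.
have xz : x != z by apply/eqP => xz; apply: nai; rewrite /aligned -/x -/y xz /z piK.
have lxz : lam x = lam z.
  by rewrite /z lx // -(opposite_nth o ip).
pose t := tperm x z.
have JE w : (pi ^ t)%g w = t (pi (t w)) by rewrite /conjg tpermV !permM.
have unmatched r r' : matched pi r r' -> r != p /\ r != q.
  move=> m; split; apply/eqP => E; rewrite {}E in m.
    have E := matched_aligned Pi m o ip' ai; apply: nai.
    by rewrite E in m; apply: (proj2 m).
  have o' := opposite_sym o; have ai' := aligned_sym Pi o ip' ai.
  have E := matched_aligned Pi m o' _ ai'; apply: nai.
  rewrite E in m; first by apply: (proj2 (matched_sym Pi m)).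
  by rewrite Lq; move: (L p) ip => n; lia.
exists (pi ^ t)%g; split.
- exact: pairing_flip.
- apply: ncycles_flip; apply/porbitP; exists 2%N.
  rewrite expgS expg1 !permM /x c_succ // ai.
  have -> : (L p - i.+1 = (L p - i.+2).+1)%N by move: (L p) ip => n; lia.
  by rewrite c_succ // Lq; move: (L p) ip => n; lia.
- by rewrite /aligned JE tpermL /z piK tpermD // eq_sym.
- move=> j jp aj; rewrite /aligned JE.
  have yj : (L p - j.+1 < L q)%N by rewrite Lq; move: (L p) jp => n; lia.
  have zj : z != e p j.
    apply/eqP => E; apply: nai; have := aj; rewrite /aligned -E /z piK.
    move=> /e_inj[] // _ ij; rewrite /aligned -/y.
    have -> : i.+1 = j by move: (L p) ip jp ij => n; lia.
    by rewrite -E /z piK.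
  have [xj|xj] := eqVneq x (e p j).
    have [_ ij] := e_inj ip jp xj.
    by rewrite -ij -/x -/y tpermL /z piK tpermD // eq_sym.
  rewrite [t (e p j)]tpermD // aj tpermD //.
    by apply/eqP => /e_inj[] // E; rewrite E eqxx in pq.
  apply/eqP => E; have := aj; rewrite /aligned -E => /perm_inj/e_inj[] // E'.
  by rewrite E' eqxx in pq.
- move=> r r' m; have [rp rq] := unmatched _ _ m.
  have m' := matched_sym Pi m; have [r'p r'q] := unmatched _ _ m'.
  split; first exact: (proj1 m).
  move=> j jr; rewrite /aligned JE.
  have r'j : (L r - j.+1 < L r')%N.
    by rewrite (opposite_size (proj1 m)) rev_lt.
  rewrite [t (e r j)]tpermD ?(proj2 m) // ?tpermD //.
  + by apply/eqP => /e_inj[] // E; rewrite E eqxx in r'p.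
  + apply/eqP => E; have := (proj2 m) _ jr; rewrite /aligned -E => /perm_inj/e_inj[] // E'.
    by rewrite E' eqxx in rq.
  + by apply/eqP => /e_inj[] // E; rewrite E eqxx in rp.
  + apply/eqP => E; have := (proj2 m) _ jr; rewrite /aligned -E /z piK => /e_inj[] // E'.
    by rewrite E' eqxx in r'q.
Qed.

Lemma bool_step_const (f : nat -> bool) n :
  (forall i, (i.+1 < n)%N -> f i = f i.+1) -> forall i, (i < n)%N -> f i = f 0%N.
Proof.
by move=> H; elim=> // i IH ip; rewrite -H // IH // ltnW.
Qed.

(** Induction on the number of unaligned places: as long as some remain, alignment changes between
    two neighbouring places, and [zip_step] applies there. *)
Lemma zip_block pi p q i : paired pi -> opposite p q -> (i < L p)%N ->
  aligned pi p q i ->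
  exists pi', [/\ paired pi', (ncycles (c * pi)%g <= ncycles (c * pi')%g)%N,
    matched pi' p q & forall r r', matched pi r r' -> matched pi' r r'].
Proof.
move=> Pi o ip ai.
pose al pi := [set j : 'I_(L p) | pi (e p j) == e q (L p - j.+1)].
have [n] := ubnP (L p - #|al pi|)%N.
elim: n pi Pi i ip ai => // n IH pi Pi i ip ai /ltnSE le_n.
have [H|] := pselect (forall j, (j.+1 < L p)%N ->
   (pi (e p j) == e q (L p - j.+1)) = (pi (e p j.+1) == e q (L p - j.+2))).
  have C := @bool_step_const (fun j => pi (e p j) == e q (L p - j.+1)) (L p) H.
  exists pi; split=> //; split=> // j jp; apply/eqP.
  by rewrite (C j) // -(C i) //; apply/eqP.
move=> /existsNP[j /not_implyP[jp /eqP]].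
have step pi' j' : (j' < L p)%N -> ~ aligned pi p q j' -> paired pi' ->
    (ncycles (c * pi)%g <= ncycles (c * pi')%g)%N -> aligned pi' p q j' ->
    (forall j, (j < L p)%N -> aligned pi p q j -> aligned pi' p q j) ->
    (forall r r', matched pi r r' -> matched pi' r r') ->
    exists pi', [/\ paired pi', (ncycles (c * pi)%g <= ncycles (c * pi')%g)%N,
      matched pi' p q & forall r r', matched pi r r' -> matched pi' r r'].
  move=> j'p naj' Pi' V' aj' mono mm.
  have lt : (#|al pi| < #|al pi'|)%N.
    apply/proper_card/properP; split.
      apply/fintype.subsetP => a; rewrite !inE => /eqP H; apply/eqP.
      exact: (mono a (ltn_ord a) H).
    exists (Ordinal j'p); rewrite inE; first by apply/eqP.
    by apply/negP => /eqP.
  have [|pi'' [Pi'' V'' m'' mm'']] := IH pi' Pi' j' j'p aj'.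
    have := max_card (al pi'); rewrite card_ord.
    by move: (L p) #|_| #|_| le_n lt => a b d; lia.
  exists pi''; split=> //; first exact: leq_trans V''.
  by move=> r r' /mm/mm''.
case aj: (pi (e p j) == _); case aj': (pi (e p j.+1) == _) => // _.
  have [||pi' [Pi' V' a' mono mm]] := zip_step Pi o jp.
  - exact/eqP.
  - by move/eqP; rewrite aj'.
  by apply: (step pi' j.+1) => //; move/eqP; rewrite aj'.
(* Alignment here begins at [j.+1] and must be extended backwards. Exchanging [p] and [q] reverses
   the places and reduces this to a forward step. *)
have o' := opposite_sym o; have Lq := opposite_size o.
have E1 : (L q - (L p - j.+2).+1 = j.+1)%N by rewrite Lq; move: (L p) jp => a; lia.
have E2 : (L q - (L p - j.+1).+1 = j)%N by rewrite Lq; move: (L p) jp => a; lia.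
have E3 : ((L p - j.+2).+1 = L p - j.+1)%N by move: (L p) jp => a; lia.
have jp' : (j < L p)%N by apply: ltnW.
have qj : (L p - j.+1 < L q)%N by rewrite Lq; move: (L p) jp => a; lia.
have back pi' j' : paired pi' -> (j' < L p)%N -> aligned pi' q p (L p - j'.+1) ->
    aligned pi' p q j'.
  move=> Pi' j'p /(aligned_sym Pi' o').
  rewrite Lq => H; have {H} := H _.
  have -> : (L p - (L p - j'.+1).+1 = j')%N by move: (L p) j'p => a; lia.
  by apply; move: (L p) j'p => a; lia.
have [|||pi' [Pi' V' a' mono mm]] := @zip_step pi q p (L p - j.+2) Pi o'.
- by rewrite E3.
- by apply: aligned_sym => //; apply/eqP.
- rewrite E3 => /back H; have := H Pi jp'; move/eqP; by rewrite aj.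
apply: (step pi' j) => //; first by move/eqP; rewrite aj.
  by apply: back => //; rewrite -E3.
move=> j' j'p aj''; apply: back => //; apply: mono.
  by rewrite Lq; move: (L p) j'p => a; lia.
exact: aligned_sym.
Qed.

(** Each use of [zip_block] matches a new block and keeps the old matches, so the number of matched
    blocks bounds the iteration. *)
Lemma zip pi : paired pi ->
  exists pi', [/\ paired pi', (ncycles (c * pi)%g <= ncycles (c * pi')%g)%N &
    forall p q i, opposite p q -> (i < L p)%N -> aligned pi' p q i ->
      matched pi' p q].
Proof.
move=> Pi; pose M pi := [set p | `[< exists q, matched pi p q >]].
have [n] := ubnP (#|P| - #|M pi|)%N.
elim: n pi Pi => // n IH pi Pi /ltnSE le_n.
have [H|] := pselect (forall p q i, opposite p q -> (i < L p)%N ->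
    aligned pi p q i -> matched pi p q); first by exists pi.
move=> /existsNP[p /existsNP[q /existsNP[i /not_implyP[ o /not_implyP[ip]]]]].
move=> /not_implyP[ai nm].
have [pi1 [Pi1 V1 m1 mm1]] := zip_block Pi o ip ai.
have lt : (#|M pi| < #|M pi1|)%N.
  apply/proper_card/properP; split.
    apply/fintype.subsetP => r; rewrite !finset.in_set => /asboolP[r' m]; apply/asboolP.
    by exists r'; apply: mm1.
  exists p; rewrite finset.in_set; first by apply/asboolP; exists q.
  apply/negP => /asboolP[r m]; apply: nm.
  by rewrite -(matched_aligned Pi m o ip ai).
have [|pi2 [Pi2 V2 m2]] := IH pi1 Pi1.
  have := max_card (M pi1).
  by move: #|_| #|_| #|_| le_n lt => a b d; lia.
by exists pi2; split=> //; exact: leq_trans V2.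
Qed.

Variable c0 : {perm P}.
Hypothesis c_zero : forall p, c (e p 0) = e (c0 p) (L (c0 p)).-1.
Hypothesis Phi_reduced : forall a, reduced_word (Phi a).
Variable tau : nat.
Hypothesis tau_gt0 : (0 < tau)%N.
Hypothesis Phi_long : forall a, (6 * tau < size (Phi a))%N.
Hypothesis Phi_overlap : forall a b i j,
  (i + tau <= size (Phi a))%N -> (j + tau <= size (Phi b))%N ->
  (forall t, (t < tau)%N -> nth a0 (Phi a) (i + t) = nth a0 (Phi b) (j + t)) ->
  a = b /\ i = j.
Hypothesis s_uniq : uniq s.
Hypothesis balanced : forall a,
  #|[pred p | lab p == a]| = #|[pred p | lab p == letter_inv a]|.

(** * Counting the vertices of a zipped pairing *)

Section Zipped.
Variable pi : {perm T}.
Hypothesis Pi : paired pi.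
Hypothesis zipped : forall p q i, opposite p q -> (i < L p)%N ->
  aligned pi p q i -> matched pi p q.

Let L_gt0 p : (0 < L p)%N.
Proof. exact: leq_ltn_trans (Phi_long _). Qed.

Variables (blk : T -> P) (idx : T -> nat).
Hypothesis blk_e : forall p i, (i < L p)%N -> blk (e p i) = p.
Hypothesis idx_e : forall p i, (i < L p)%N -> idx (e p i) = i.
Variables mu nu : {perm P}.
Hypothesis mu_matched : forall p, mu p != p -> matched pi p (mu p).
Hypothesis mu_fixed : forall p q, matched pi p q -> mu p = q.
Hypothesis nu_mu : forall p, mu p != p -> nu p = mu p.

Let rho := (c * pi)%g.
Let rho0 := (c0 * nu)%g.

Let rho_succ p i : (i.+1 < L p)%N -> rho (e p i.+1) = pi (e p i).
Proof. by move=> ip; rewrite permM c_succ. Qed.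

Let eK x : x \in s -> x = e (blk x) (idx x) /\ (idx x < L (blk x))%N.
Proof. by move=> /e_onto[p [i [ip ->]]]; rewrite blk_e ?idx_e. Qed.

(* Corners are indexed by the letter following them. *)
Let outer x := (x \in s) && (idx x == 0%N) && (mu (c0 (blk x)) == c0 (blk x)).
Let closed x := (x \in s) && (idx x == 0%N) && (mu (c0 (blk x)) != c0 (blk x)).
Let inner_matched x := (x \in s) && (0 < idx x)%N && (mu (blk x) != blk x).
Let inner x := (x \in s) && (0 < idx x)%N && (mu (blk x) == blk x).
(** An inner corner that is not thick lies on a vertex with exactly two corners, both inner: the two
    glued strands run on side by side across it. *)
Let thick x := inner x && ~~ (inner (rho x) && (rho (rho x) == x)).

(* A cycle not made of closed corners has weight at least 6, with one unit to
   spare for each of its thick corners. *)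
Let weight x := (6 * (x \notin s) + 3 * inner_matched x + 3 * inner x + 6 * outer x)%N.

Let corner_cases x :
  (x \notin s) || outer x || [|| closed x, inner_matched x | inner x].
Proof.
rewrite /outer /closed /inner_matched /inner; case: (x \in s) => //=.
by case: (idx x) => [|i] /=; case: (_ == _).
Qed.

Let matched_of p q i j : mu p != p -> (i < L p)%N -> pi (e p i) = e q j ->
  (j < L q)%N -> mu q != q.
Proof.
move=> mp ip pe jq; have [ o /(_ i ip)] := mu_matched mp; rewrite /aligned pe.
have Lq := opposite_size o.
move=> /e_inj[] //; first by rewrite Lq; move: (L p) ip => n; lia.
move=> -> _; have := matched_sym Pi (mu_matched mp) => /mu_fixed ->.
by rewrite eq_sym.
Qed.

(** The last letter of a matched block is glued to the first letter of its partner, so at these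
    corners [rho] imitates [rho0]. *)
Let closed_next x : closed x -> rho x \in s /\ idx (rho x) = 0%N /\
  rho x = e (rho0 (blk x)) 0.
Proof.
case/andP=> /andP[xs /eqP i0] m; have [xE _] := eK xs; rewrite i0 in xE.
have [ o /(_ (L (c0 (blk x))).-1)] := mu_matched m; rewrite /aligned => H.
have rE : rho x = e (mu (c0 (blk x))) 0.
  rewrite permM xE c_zero -xE H ?prednK // ?subnn //.
have r0 : (0 < L (mu (c0 (blk x))))%N by [].
by rewrite rE e_mem // idx_e // permM nu_mu.
Qed.

Let inner_matched_next x : inner_matched x -> inner_matched (rho x) /\ rho x != x.
Proof.
case/andP=> /andP[xs]; have [xE ix] := eK xs.
move iE : (idx x) ix xE => [|i] // ix xE _ m.
have [ o /(_ i (ltnW ix))] := mu_matched m; rewrite /aligned -rho_succ // -xE.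
have Lq := opposite_size o => H.
have jq : (L (blk x) - i.+1 < L (mu (blk x)))%N by rewrite Lq; move: (L _) ix => n; lia.
split.
  rewrite /inner_matched H e_mem // idx_e // blk_e // subn_gt0 ix /=.
  by rewrite (inj_eq (@perm_inj _ mu)).
by apply: contraNneq m => E; rewrite -{2}E H blk_e.
Qed.

Let inner_next x : inner x -> rho x \in s /\ mu (blk (rho x)) == blk (rho x).
Proof.
case/andP=> /andP[xs]; have [xE ix] := eK xs.
move iE : (idx x) ix xE => [|i] // ix xE _ m.
have ys : rho x \in s.
  by rewrite xE rho_succ // (pairing_mem _ Pi) e_mem // ltnW.
split=> //; apply/negPn/negP => m'.
have [yE jy] := eK ys.
have H : pi (e (blk (rho x)) (idx (rho x))) = e (blk x) i.
  by rewrite -yE {1}xE rho_succ //; case: Pi => ->.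
by have := matched_of m' jy H (ltnW ix); rewrite m.
Qed.

(** A vertex with a single corner would pair two adjacent letters of one image, and these are not
    inverse since the image is reduced. *)
Let inner_neq x : inner x -> rho x != x.
Proof.
case/andP=> /andP[xs]; have [xE ix] := eK xs.
move iE : (idx x) ix xE => [|i] // ix xE _ m.
rewrite xE rho_succ //; apply/eqP => H.
have [_ _ lp] := Pi.
have es := e_mem (ltnW ix); have := lp _ es; rewrite H (e_lam ix) (e_lam (ltnW ix)).
have := Phi_reduced (lab (blk x)); rewrite /reduced_word => /(sortedP a0)/(_ _ ix).
by move=> /eqP.
Qed.

(** Without outer corners, a cycle can leave the inner corners only through a closed one. From there
    on all its corners are closed, including [x] itself, which is absurd. *)
Let inner_inner x : inner x -> {in porbit rho x, forall y, ~~ outer y} ->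
  {in porbit rho x, forall y, inner y}.
Proof.
move=> ix no; apply: (porbit_ind ix) => z zo iz.
have [rs rm] := inner_next iz.
have ro : rho z \in porbit rho x by apply: porbit_next.
rewrite /inner rs rm andbT; case: posnP => // i0.
have cz : closed (rho z).
  have := no _ ro; rewrite /outer /closed rs i0 eqxx /=; by case: (_ == _).
have /eqP e1 : porbit rho (rho z) == porbit rho x by rewrite eq_porbit_mem.
have : closed x.
  apply: (@porbit_ind _ rho closed (rho z)) => //; last by rewrite e1 porbit_id.
  move=> t to /closed_next[ts [t0 _]].
  have to' : rho t \in porbit rho x by apply: porbit_next; rewrite -e1.
  have := no _ to'; rewrite /outer /closed ts t0 eqxx /=; by case: (_ == _).
by move: ix; rewrite /inner /closed; case: (idx x) => [|n] /=; rewrite ?andbF.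
Qed.

Let weight_thick x : (thick x <= weight x)%N.
Proof.
rewrite /thick /weight; move: (inner (rho x) && _) (inner x) (x \notin s) (inner_matched x) (outer x).
by do 5!case.
Qed.

(** The surplus of [g] over [f] on a whole cycle is bounded below by its value on a few explicit
    corners. *)
Let sum_witness (A : pred T) (f g : T -> nat) (t : seq T) : uniq t ->
  {subset t <= A} -> (forall x, (f x <= g x)%N) ->
  (\sum_(y in A) f y + \sum_(y <- t) (g y - f y) <= \sum_(y in A) g y)%N.
Proof.
move=> Ut tA fg.
have -> : (\sum_(y in A) g y = \sum_(y in A) f y + \sum_(y in A) (g y - f y))%N.
  by rewrite -big_split; apply: eq_bigr => y _ /=; rewrite subnKC.
rewrite leq_add2l big_uniq //= [leqRHS](bigID (mem t)) /=.
apply: leq_trans (leq_addr _ _); rewrite leq_eqVlt; apply/orP; left; apply/eqP.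
apply: eq_bigl => y; apply/idP/andP => [yt|[]//]; by split=> //; apply: tA.
Qed.

(** One point off [s] or one outer corner already weighs 6 and is not thick. Matched inner corners
    come at least in twos, each with surplus 3. Otherwise all corners are inner or all are closed.
    In the inner case, either there are two thin corners with surplus 3 each, or at least three
    corners with surplus at least [3 - 1]. *)
Lemma cycle_weight x :
  (6 + \sum_(y in porbit rho x) thick y <=
   \sum_(y in porbit rho x) weight y +
     6 * (porbit rho x \subset [pred y | closed y]))%N.
Proof.
have W t n : uniq t -> {subset t <= porbit rho x} -> 
    (6 <= \sum_(y <- t) (weight y - thick y))%N ->
    (6 + \sum_(y in porbit rho x) thick y <= \sum_(y in porbit rho x) weight y + n)%N.
  move=> Ut tA H; rewrite addnC; apply: leq_trans (leq_addr _ _).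
  apply: leq_trans (sum_witness Ut tA weight_thick).
  by rewrite leq_add2l.
have [/existsP[y /andP[yo H]]|N1] :=
    boolP [exists y, (y \in porbit rho x) && ((y \notin s) || outer y)].
  apply: (W [:: y]) => //; first by move=> z; rewrite inE => /eqP->.
  rewrite big_seq1 /weight; case/orP: H => [ys|oy].
    by rewrite ys /thick /inner (negPf ys) /= subn0 muln1 -!addnA leq_addr.
  have -> : thick y = false.
    by move: oy; rewrite /thick /inner /outer => /andP[/andP[_ /eqP ->] _]; rewrite andbF.
  by rewrite oy subn0 leq_addl.
have no : {in porbit rho x, forall y, ~~ outer y}.
  move=> y yo; apply: contra N1 => oy; apply/existsP; exists y.
  by rewrite yo oy orbT.
have [/existsP[y /andP[yo iy]]|N2] :=
    boolP [exists y, (y \in porbit rho x) && inner_matched y].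
  have [iy' ny] := inner_matched_next iy.
  apply: (W [:: y; rho y]).
  - by rewrite /= inE eq_sym ny.
  - by move=> z; rewrite !inE => /orP[/eqP->|/eqP->] //; apply: porbit_next.
  have F z : inner_matched z -> (3 <= weight z - thick z)%N.
    move=> iz; rewrite /weight /thick iz.
    have -> : inner z = false.
      by move: iz; rewrite /inner_matched /inner => /andP[-> /negPf->].
    by rewrite /= subn0 muln1; move: (z \notin s) (outer z); do 2!case.
  by rewrite !big_cons big_nil addn0; exact: (leq_add (F _ iy) (F _ iy')).
have [/existsP[y /andP[yo iy]]|N3] :=
    boolP [exists y, (y \in porbit rho x) && inner y].
  have /eqP oE : porbit rho y == porbit rho x by rewrite eq_porbit_mem.
  rewrite -oE in no.
  have I := inner_inner iy no.
  have y1 : rho y \in porbit rho y by apply/porbit_next/porbit_id.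
  have y2 : rho (rho y) \in porbit rho y by apply/porbit_next.
  have [E|NE] := eqVneq (rho (rho y)) y.
    apply: (W [:: y; rho y]).
    - by rewrite /= inE eq_sym inner_neq.
    - by move=> z; rewrite -oE !inE => /orP[/eqP->|/eqP->] //; apply: porbit_id.
    have F z : inner z -> inner (rho z) -> rho (rho z) = z -> (3 <= weight z - thick z)%N.
      move=> iz irz ez; rewrite /weight /thick iz irz ez eqxx /= subn0 muln1.
      by move: (z \notin s) (inner_matched z) (outer z); do 3!case.
    rewrite !big_cons big_nil addn0; apply: (leq_add (F _ iy (I _ y1) E) (F _ (I _ y1) (I _ y2) _)).
    by rewrite E.
  apply: (W [:: y; rho y; rho (rho y)]).
  - by rewrite /= !inE !negb_or eq_sym inner_neq //= eq_sym NE eq_sym inner_neq // I.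
  - move=> z; rewrite -oE !inE => /or3P[/eqP->|/eqP->|/eqP->] //; exact: porbit_id.
  have F z : inner z -> (2 <= weight z - thick z)%N.
    move=> iz; rewrite /weight iz.
    by move: (z \notin s) (inner_matched z) (outer z) (thick z); do 4!case.
  rewrite !big_cons big_nil addn0.
  exact: (leq_add (F _ iy) (leq_add (F _ (I _ y1)) (F _ (I _ y2)))).
have -> : porbit rho x \subset [pred y | closed y].
  apply/fintype.subsetP => y yo; rewrite inE.
  move/existsPn: N1 => /(_ y); rewrite yo /= => N1.
  move/existsPn: N2 => /(_ y); rewrite yo /= => N2.
  move/existsPn: N3 => /(_ y); rewrite yo /= => N3.
  by have := corner_cases y; rewrite (negPf N1) (negPf N2) (negPf N3) !orbF.
by rewrite addnC leq_add2r; apply: leq_sum => y _; apply: weight_thick.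
Qed.

(** By [closed_next], a cycle of closed corners consists of the initial letters of the blocks on one
    cycle of [rho0], which determines it. *)
Lemma closed_cycles :
  (\sum_(Z in porbits rho) (Z \subset [pred y | closed y]) <= ncycles rho0)%N.
Proof.
rewrite -big_mkcondr /= sum1dep_card.
apply: leq_trans (leq_imset_card (fun O : {set P} => [set e p 0 | p in O]) (porbits rho0)).
apply/subset_leq_card/fintype.subsetP => Z; rewrite finset.in_set => /andP[/imsetP[x _ ->]].
move=> /fintype.subsetP cx.
have /andP[/andP[xs /eqP i0] _] := cx x (porbit_id _ _); have [xE _] := eK xs.
rewrite i0 in xE; set p := blk x in xE.
have E n : ((rho ^+ n)%g x = e ((rho0 ^+ n)%g p) 0).
  elim: n => [|n IH]; first by rewrite !expg0 !perm1.
  have [_ [_]] := closed_next (cx _ (mem_porbit rho n x)).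
  by rewrite IH blk_e // !expgSr !permM IH.
apply/imsetP; exists (porbit rho0 p); first exact: imset_f.
apply/setP => y; apply/porbitP/imsetP => [[n ->]|[_ /porbitP[n ->] ->]].
  by exists ((rho0 ^+ n)%g p); [exact: mem_porbit|exact: E].
by exists n.
Qed.

Let sum_zero (f : P -> nat) :
  \sum_(x | (x \in s) && (idx x == 0%N)) f (blk x) = \sum_p f p.
Proof.
rewrite (reindex_onto (fun p => e p 0) blk) /=; last first.
  by move=> x /andP[xs /eqP i0]; have [xE _] := eK xs; rewrite i0 in xE.
by apply: eq_big => [p|p _]; rewrite ?e_mem ?idx_e ?blk_e ?eqxx.
Qed.

(* A run of [tau] consecutive thin corners of an unmatched block would be an
   overlap of length [tau], aligned by the small cancellation condition. *)
Lemma thick_window p j : mu p == p -> (j < 6)%N ->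
  exists x, [/\ thick x, blk x = p & ((idx x).-1 %/ tau = j)%N].
Proof.
move=> mp j6; apply: contrapT => N.
have jL t : (t < tau)%N -> ((j * tau + t).+1 < L p)%N.
  move=> tt; apply: leq_ltn_trans (Phi_long (lab p)).
  rewrite -addnS; apply: (@leq_trans (j.+1 * tau)%N); last by rewrite leq_pmul2r.
  by rewrite mulSnr leq_add2l.
have thin t : (t < tau)%N -> let x := e p (j * tau + t).+1 in
    inner (rho x) && (rho (rho x) == x).
  move=> tt /=; set x := e p _; apply/negPn/negP => H; apply: N; exists x; split.
  - by rewrite /thick H andbT /inner e_mem ?idx_e ?blk_e ?jL.
  - by rewrite blk_e ?jL.
  - by rewrite idx_e ?jL // divnMDl // divn_small // addn0.
have [q [B [BL HB B0]]] : exists q B, [/\ (B < L q)%N,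
    pi (e p (j * tau)) = e q B & (0 < B)%N].
  have := thin 0%N tau_gt0; rewrite /= addn0 rho_succ; last first.
    by have := jL 0%N tau_gt0; rewrite addn0.
  set y := pi _ => /andP[/andP[/andP[ys y0] _] _]; have [yE yi] := eK ys.
  by exists (blk y), (idx y).
(* Across each thin corner the place in [p] moves up by one and the place in [q] moves down by
   one. *)
have run t : (t < tau)%N -> (t < B)%N /\ pi (e p (j * tau + t)) = e q (B - t).
  elim: t => [|t IH] tt; first by rewrite addn0 subn0.
  have {IH} [tB IH] := IH (ltnW tt).
  have /andP[_ /eqP H] := thin t (ltnW tt).
  have Bt : (B - t = (B - t.+1).+1)%N by rewrite subnSK.
  have BtL : ((B - t.+1).+1 < L q)%N by rewrite -Bt; apply: leq_ltn_trans BL; exact: leq_subr.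
  rewrite (rho_succ (jL t (ltnW tt))) IH Bt (rho_succ BtL) in H.
  have piH : pi (e p (j * tau + t.+1)) = e q (B - t.+1).
    by rewrite addnS -H; case: Pi => ->.
  split=> //; have := thin t.+1 tt; rewrite /= rho_succ ?jL // piH => /andP[].
  rewrite /inner idx_e ?(ltnW BtL) // => /andP[/andP[_]].
  by rewrite subn_gt0.
have tB : (tau <= B)%N.
  by have := run tau.-1; rewrite ltn_predL => /(_ tau_gt0)[]; rewrite prednK.
have [lpq jE] : lab p = letter_inv (lab q) /\ (j * tau = L q - B.+1)%N.
  apply: Phi_overlap.
  - apply: leq_trans (ltnW (Phi_long _)).
    by rewrite -mulSnr leq_pmul2r.
  - rewrite PhiV size_rev size_map -/(L q).
    by move: (L q) BL => n; lia.
  - move=> t tt; have [tB' H] := run t tt.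
    rewrite PhiV /word_inv nth_rev ?size_map -/(L q); last first.
      by move: (L q) BL => n; lia.
    have -> : (L q - (L q - B.+1 + t).+1 = B - t)%N by move: (L q) BL => n; lia.
    have qB : (B - t < L q)%N by apply: leq_ltn_trans BL; exact: leq_subr.
    have pj : (j * tau + t < L p)%N by apply: ltnW; exact: jL.
    rewrite (nth_map a0) // -!e_lam // -H; case: Pi => _ _ ->; last exact: e_mem.
    by rewrite letter_invK.
have o : opposite p q by rewrite /opposite lpq letter_invK.
have Lq := opposite_size o.
have pj : (j * tau < L p)%N by have := jL 0%N tau_gt0; rewrite addn0 => /ltnW.
have /mu_fixed E : matched pi p q.
  apply: (zipped o pj); rewrite /aligned HB; congr (e q _).
  by rewrite jE -Lq; move: (L q) BL => n; lia.
by have := opposite_neq o; rewrite -E (eqP mp) eqxx.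
Qed.

(** The six windows of a block are disjoint, being told apart by the quotient by [tau]. *)
Lemma thick_many : (6 * #|[pred p | mu p == p]| <= \sum_x thick x)%N.
Proof.
have /choice[f fP] : forall pj : P * 'I_6, exists x, mu pj.1 == pj.1 ->
    [/\ thick x, blk x = pj.1 & ((idx x).-1 %/ tau = pj.2)%N].
  move=> [p j] /=; have [mp|] := boolP (mu p == p); last by exists (e p 0).
  by have [x H] := thick_window mp (ltn_ord j); exists x.
rewrite -big_mkcond sum1dep_card mulnC.
pose A := [set pj : P * 'I_6 | mu pj.1 == pj.1].
have -> : (#|[pred p | mu p == p]| * 6 = #|A|)%N.
  rewrite -[X in (_ * X)%N]card_ord -cardX; apply: eq_card => -[p j].
  by rewrite !inE /= andbT.
have inj : {in A &, injective f}.
  move=> [p i] [q j]; rewrite /A !finset.in_set => H1 H2 E.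
  have [_ /= b1 i1] := fP (p, i) H1; have [_ /= b2 i2] := fP (q, j) H2.
  by congr (_, _); [rewrite -b1 -b2 E|apply/val_inj; rewrite /= -i1 -i2 E].
rewrite -(card_in_imset inj); apply/subset_leq_card/fintype.subsetP => _ /imsetP[pj + ->].
by rewrite /A !finset.in_set => /(fP pj)[].
Qed.

(** Sum of [cycle_weight] over all cycles. In the total weight each unmatched block contributes 6
    through the outer corner behind it, and its six thick corners repay exactly this amount. *)
Lemma zipped_count :
  (2 * ncycles rho + #|P| + size s <= 2 * ncycles rho0 + 2 * #|T|)%N.
Proof.
have H1 : (6 * ncycles rho + \sum_x thick x <= \sum_x weight x + 6 * ncycles rho0)%N.
  rewrite -(sum_porbits rho) -(sum_porbits rho weight).
  have -> : (6 * ncycles rho = \sum_(Z in porbits rho) 6)%N.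
    by rewrite sum_nat_const mulnC.
  rewrite -big_split; apply: (@leq_trans (\sum_(Z in porbits rho)
     (\sum_(x in Z) weight x + 6 * (Z \subset [pred y | closed y])))).
    by apply: leq_sum => _ /imsetP[x _ ->]; apply: cycle_weight.
  by rewrite big_split /= -big_distrr /= leq_add2l leq_mul2l closed_cycles.
have H2 : (\sum_x weight x + 3 * #|P| =
    6 * (#|T| - size s) + 3 * size s + 6 * #|[pred p | mu p == p]|)%N.
  have -> : #|P| = \sum_x ((x \in s) && (idx x == 0%N)).
    by rewrite -big_mkcond /= (sum_zero (fun=> 1%N)) sum1_card.
  have -> : (#|T| - size s = \sum_x (x \notin s))%N.
    rewrite -big_mkcond sum1dep_card -(card_uniqP s_uniq) -(cardC (mem s)).
    by rewrite addKn cardsE.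
  have -> : size s = \sum_x (x \in s).
    by rewrite -big_mkcond sum1_card (card_uniqP s_uniq).
  have -> : #|[pred p | mu p == p]| = \sum_x outer x.
    rewrite /outer -big_mkcond big_mkcondr /=.
    rewrite (sum_zero (fun p => mu (c0 p) == c0 p : nat)) -big_mkcond sum1dep_card.
    rewrite -(card_imset _ (@perm_inj _ c0)); apply: eq_card => p.
    rewrite !inE; apply/idP/imsetP => [mp|[q]].
      by exists (c0^-1 p)%g; rewrite ?finset.in_set permKV.
    by rewrite finset.in_set => mq ->.
  rewrite !big_distrr -!big_split; apply: eq_bigr => x _ /=.
  rewrite /weight /outer /inner /inner_matched.
  move: (x \in s) (mu (blk x) == blk x) (mu (c0 (blk x)) == _) (idx x) => a b d [|n] /=;
    by case: a; case: b; case: d.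
have := thick_many; have := max_card (mem s); rewrite (card_uniqP s_uniq).
move: H1 H2; move: (\sum_x thick x) (\sum_x weight x) #|T| #|P| (size s).
move: #|_| (ncycles rho) (ncycles rho0) => n1 n2 n3 n4 n5 n6 n7 n8; clear.
lia.
Qed.

End Zipped.
(** Inserting Euler's formula for [pi] and for [nu] turns the inequality into: the genus of [nu] is
    at most that of [pi]. *)
Lemma block_pairing (p0 : P) pi : paired pi ->
  exists nu : {perm P}, [/\ involutive nu, forall p, nu p != p,
    forall p, lab (nu p) = letter_inv (lab p) &
    (2 * ncycles (c * pi)%g + #|P| + size s <=
     2 * ncycles (c0 * nu)%g + 2 * #|T|)%N].
Proof.
move=> /zip[pi' [Pi' V' z]].
have L_gt0 p : (0 < L p)%N by exact: leq_ltn_trans (Phi_long _).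
have uniq_match p q r : matched pi' p q -> matched pi' p r -> q = r.
  move=> m1 [ o m2]; exact: (matched_aligned Pi' m1 o (L_gt0 p) (m2 _ _)).
pose f p := if pselect (exists q, matched pi' p q) is left h then sval (cid h) else p.
have fE p q : matched pi' p q -> f p = q.
  move=> m; rewrite /f; case: pselect => [h|[]]; last by exists q.
  by apply: uniq_match m; apply: svalP (cid h).
have f_id p : ~ (exists q, matched pi' p q) -> f p = p.
  by rewrite /f; case: pselect.
have fK : involutive f.
  move=> p; have [[q m]|n] := pselect (exists q, matched pi' p q).
    by rewrite (fE _ _ m); apply/fE/matched_sym.
  by rewrite !f_id // f_id.
pose mu := perm (inv_inj fK).
have muE p : mu p = f p by rewrite permE.
have mu_matched p : mu p != p -> matched pi' p (mu p).
  rewrite muE => m; have [[q m']|n] := pselect (exists q, matched pi' p q).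
    by rewrite (fE _ _ m').
  by rewrite f_id ?eqxx in m.
have mu_fixed p q : matched pi' p q -> mu p = q by rewrite muE; apply: fE.
have [||nu [nuK nuF nul num]] := @extend_matching P _ (@letter_inv k) lab mu
    (@letter_invK k) (@letter_inv_neq k) _ _ balanced.
- by move=> p; rewrite !muE fK.
- by move=> p /mu_matched[].
(* Coordinates of the letters in their blocks; points off [s] receive the dummy coordinates
   [(p0, 0)]. *)
have /choice[bi bi_e] : forall x, exists bi : P * nat, forall p i,
    (i < L p)%N -> x = e p i -> bi = (p, i).
  move=> x; have [/e_onto[p [i [ip xE]]]|n] := boolP (x \in s).
    by exists (p, i) => q j jq; rewrite xE => /e_inj[] // -> ->.
  by exists (p0, 0%N) => p i ip xE; rewrite xE e_mem in n.
exists nu; split=> //.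
have := @zipped_count pi' Pi' z (fun x => (bi x).1) (fun x => (bi x).2) _ _ mu nu
  mu_matched mu_fixed num.
move=> H; apply: leq_trans (H _ _).
- by rewrite !leq_add2r leq_mul2l.
- by move=> p i ip; rewrite (bi_e _ _ _ ip erefl).
- by move=> p i ip; rewrite (bi_e _ _ _ ip erefl).
Qed.

End Zipping.

Lemma least_spec (P : nat -> Prop) n : P n -> P (least P) /\ (least P <= n)%N.
Proof.
move=> Pn; rewrite /least; case: pselect => [h|[]]; last by exists n; apply/asboolP.
case: ex_minnP => m /asboolP Pm mP; split=> //; apply: mP; exact/asboolP.
Qed.

Section CommutatorLength.
Variable G : groupType.
Implicit Types g : G.

Lemma cl_leq n g : commutator_product n g -> (cl g <= n)%N.
Proof. by move=> /(@least_spec (fun n => commutator_product n g)) []. Qed.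

Lemma cl_spec g : derived g -> commutator_product (cl g) g.
Proof. by case=> n /(@least_spec (fun n => commutator_product n g)) []. Qed.

End CommutatorLength.

Lemma commutator_product_morph (G K : groupType) (phi : {multiplicative G -> K}) n g :
  commutator_product n g -> commutator_product n (phi g).
Proof.
move=> /commutator_productP[s ss ->]; apply/commutator_productP.
exists [seq (phi p.1, phi p.2) | p <- s]; first by rewrite size_map.
rewrite big_map.
elim: s {ss} => [|p s IH]; first by rewrite !big_nil Defs.morph1.
by rewrite !big_cons gmulfM -IH /commg /conjg !gmulfM !Defs.morphV.
Qed.

Lemma paired_word_balanced l (w : seq (letter l)) m a : paired_word w m ->
  count_mem a w = count_mem (letter_inv a) w.
Proof.
case=> N /(_ N (leqnn N))[lam [s [pi [U <- P _]]]]; have [piK _ lx] := P.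
have /seq.permP E : perm_eq (map pi s) s.
  apply: uniq_perm => //; first by rewrite map_inj_uniq //; apply: perm_inj.
  by move=> x; rewrite -{1}(piK x) mem_map ?(pairing_mem _ P) //; apply: perm_inj.
rewrite !count_map -E count_map; apply: eq_in_count => x xs /=.
by rewrite lx // (can2_eq (@letter_invK l) (@letter_invK l)).
Qed.

Section WordPositions.
Variables (k : nat) (w : seq (letter k)).

Definition letter_at (p : 'I_(size w)) : letter k := tnth (in_tuple w) p.

Lemma map_letter_at : map letter_at (enum 'I_(size w)) = w.
Proof. exact: map_tnth_enum (in_tuple w). Qed.

Lemma card_letter_at a : #|[pred p | letter_at p == a]| = count_mem a w.
Proof.
transitivity (count_mem a (map letter_at (enum 'I_(size w)))).
  by rewrite count_map cardE size_filter -enumT; apply: eq_count.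
by rewrite map_letter_at.
Qed.

Lemma cyc_enum_succ (p q : 'I_(size w)) : p = q.+1 :> nat ->
  cyc (enum 'I_(size w)) p = q.
Proof.
move=> pq; have U := enum_uniq 'I_(size w).
have -> : p = nth p (enum 'I_(size w)) q.+1 by rewrite -pq nth_ord_enum.
by rewrite cyc_nth ?size_enum_ord -?pq // nth_ord_enum.
Qed.

Lemma cyc_enum_zero (p : 'I_(size w)) : p = 0%N :> nat ->
  cyc (enum 'I_(size w)) p = (size w).-1 :> nat.
Proof.
move=> p0; have U := enum_uniq 'I_(size w).
have pE : p = nth p (enum 'I_(size w)) 0.
  by rewrite -[X in nth _ _ X]p0 nth_ord_enum.
rewrite [X in cyc _ X]pE cyc_nth0 // size_enum_ord nth_enum_ord // prednK //.
exact: leq_ltn_trans (ltn_ord p).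
Qed.

End WordPositions.

(** * From commutator products in the image back to the source *)

Section SmallCancellation.
Variables k l : nat.

(* The images of the letters are long, and no two distinct places in them carry
   the same subword of length [tau]. *)
Definition small_cancellation tau (Phi : letter k -> seq (letter l)) :=
  [/\ (0 < tau)%N, forall a, (6 * tau < size (Phi a))%N &
    forall a b i j, (i + tau <= size (Phi a))%N -> (j + tau <= size (Phi b))%N ->
      take tau (drop i (Phi a)) = take tau (drop j (Phi b)) -> a = b /\ i = j].

(** A pairing of the image word exists by [commutator_product_paired]; [block_pairing] turns it into
    a pairing of the source word, and [pairing_genus] reads a product of commutators off the
    latter. *)
Lemma small_cancellation_commutator_product tau Phi w m :
  small_cancellation tau Phi ->
  (forall a, Phi (letter_inv a) = word_inv (Phi a)) ->
  (forall a, reduced_word (Phi a)) ->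
  (forall a, count_mem a w = count_mem (letter_inv a) w) ->
  commutator_product m (weval (flatten (map Phi w))) ->
  commutator_product m (weval w).
Proof.
move=> [tau_gt0 Phi_long Phi_ov] PhiV Phi_red bal.
have [->|w0] := eqVneq w [::].
  move=> _; apply: (@commutator_product_leq _ 0) => //.
  by apply/commutator_product0; rewrite /weval big_nil.
have x0 : letter k by case: (w) w0.
have a0 : letter l by have := Phi_long x0; case: (Phi x0).
move=> /(commutator_product_paired a0)[N /(_ N (leqnn N))[lam [s [pi [U sE P c]]]]].
set lab := @letter_at k w; set P0 := 'I_(size w).
have wpos : (0 < size w)%N by case: (w) w0.
have p0 : P0 := Ordinal wpos.
pose sh := map (fun a => size (Phi a)) w.
have shE : sh = shape (map Phi w) by rewrite /shape -map_comp.
have ss : size s = sumn sh by rewrite -(size_map lam) sE size_flatten shE.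
have labE (p : P0) : lab p = nth x0 w p by rewrite /lab /letter_at (tnth_nth x0).
have shp (p : P0) : nth 0%N sh p = size (Phi (lab p)).
  by rewrite /sh (nth_map x0) // labE.
have ssh : size sh = size w by rewrite size_map.
have L_gt0 (p : P0) : (0 < size (Phi (lab p)))%N by exact: leq_ltn_trans (Phi_long _).
have ss0 : (0 < size s)%N.
  rewrite ss -[sh](cat_take_drop p0) sumn_cat (drop_nth 0%N) ?ssh //= shp.
  by rewrite addnCA ltn_addr.
have [t0 t0s] : exists t0, t0 \in s.
  by case: (s) ss0 => // t t1 _; exists t; rewrite inE eqxx.
pose fi (p : P0) i := flatten_index sh p i.
have fi_lt p i : (i < size (Phi (lab p)))%N -> (fi p i < size s)%N.
  by move=> ip; rewrite ss flatten_indexP // shp.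
pose e (p : P0) i := nth t0 s (fi p i).
pose cs := cyc s; pose c0 := cyc (enum P0).
have e_lam p i : (i < size (Phi (lab p)))%N -> lam (e p i) = nth a0 (Phi (lab p)) i.
  move=> ip; rewrite /e -(nth_map t0 a0) ?fi_lt // sE nth_flatten -shE.
  rewrite /fi flatten_indexKl ?flatten_indexKr ?shp //.
  by rewrite (nth_map x0) // labE.
have e_inj p i q j : (i < size (Phi (lab p)))%N -> (j < size (Phi (lab q)))%N ->
    e p i = e q j -> p = q /\ i = j.
  move=> ip jq /eqP; rewrite nth_uniq ?fi_lt // => /eqP E; split.
    apply/val_inj; rewrite /= -(@flatten_indexKl sh p i) ?shp //.
    by rewrite -/(fi p i) E /fi flatten_indexKl ?shp.
  rewrite -(@flatten_indexKr sh p i) ?shp //.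
  by rewrite -/(fi p i) E /fi flatten_indexKr ?shp.
have e_onto x : x \in s -> exists p i, (i < size (Phi (lab p)))%N /\ x = e p i.
  move=> xs; have xi : (index x s < sumn sh)%N by rewrite -ss index_mem.
  have pw := reshape_indexP xi; rewrite ssh in pw.
  exists (Ordinal pw), (reshape_offset sh (index x s)); split.
    by rewrite -shp /= reshape_offsetP.
  by rewrite /e /fi /= reshape_indexK nth_index.
have c_succ p i : (i.+1 < size (Phi (lab p)))%N -> cs (e p i.+1) = e p i.
  move=> ip; rewrite /e; have E : fi p i.+1 = (fi p i).+1 by rewrite /fi /flatten_index addnS.
  by rewrite E /cs cyc_nth // -E fi_lt.
have c_zero p : cs (e p 0%N) = e (c0 p) (size (Phi (lab (c0 p)))).-1.
  have [pz|pS] := posnP (p : nat).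
    have cp := cyc_enum_zero pz.
    have -> : e p 0%N = nth t0 s 0 by rewrite /e /fi pz /flatten_index take0.
    have -> : e (c0 p) (size (Phi (lab (c0 p)))).-1 = nth t0 s (size s).-1.
      have T : take (c0 p).+1 sh = sh by rewrite take_oversize // ssh cp prednK.
      congr (nth t0 s _); rewrite /fi ss /flatten_index -[in RHS]T.
      rewrite (take_nth 0%N) ?ssh // sumn_rcons shp.
      by rewrite -[in RHS](prednK (L_gt0 _)) addnS.
    by rewrite /cs cyc_nth0.
  have cp : p = (c0 p).+1 :> nat.
    have pw : (p.-1 < size w)%N by rewrite prednK // ltnW // ltn_ord.
    by rewrite /c0 (@cyc_enum_succ _ w p (Ordinal pw)) //= prednK.
  have E : fi p 0%N = (fi (c0 p) (size (Phi (lab (c0 p)))).-1).+1.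
    rewrite /fi /flatten_index cp (take_nth 0%N) ?ssh // sumn_rcons shp addn0.
    by rewrite -addnS prednK.
  by rewrite /e E /cs cyc_nth // -E fi_lt.
have s_card := card_uniqP U.
have [|||nu [nuK nuF nul count]] := @block_pairing k l _ P0 lab Phi a0 PhiV lam s e
    _ e_onto e_inj e_lam cs c_succ c0 c_zero Phi_red tau tau_gt0 Phi_long _ U _ p0 pi P.
- by move=> p i ip; rewrite mem_nth // fi_lt.
- move=> a b i j ia jb H; apply: Phi_ov => //.
  have sz c' i' : (i' + tau <= size (Phi c'))%N ->
      size (take tau (drop i' (Phi c'))) = tau.
    move=> H'; rewrite size_takel // size_drop leq_subRL //.
    exact: leq_trans (leq_addr _ _) H'.
  apply: (@eq_from_nth _ a0); rewrite !sz // => t tt.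
  by rewrite !nth_take // !nth_drop H.
- by move=> a; rewrite !card_letter_at.
have [m' [cm' e']] : exists m', commutator_product m' (weval w) /\ (2 * ncycles (c0 * nu)%g + 4 * m' + size w = 2 * size w + 2)%N.
  have [||m' [cm' e']] := @pairing_genus P0 (free_group k)
      (fun p => letter_val (@free_gen k) (lab p)) (enum P0) nu (enum_uniq _).
  - by rewrite -size_eq0 size_enum_ord -lt0n.
  - split=> // p; first by rewrite mem_enum (negPf (nuF p)).
    by move=> _; rewrite nul letter_valV.
  rewrite size_enum_ord card_ord in e'; exists m'; split=> //.
  by rewrite /weval -{1}(map_letter_at w) big_map.
apply: commutator_product_leq cm'.
(* The three relations add up to [4 * n7 <= 4 * n6 + 2]; the slack of 2 from [paired_word]
   disappears by integrality. *)
have arith (n1 n2 n3 n4 n5 n6 n7 : nat) :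
    (2 * n1 + n2 + n3 <= 2 * n4 + 2 * n5)%N ->
    (2 * n5 <= 2 * n1 + 4 * n6 + n3)%N ->
    (2 * n4 + 4 * n7 + n2 = 2 * n2 + 2)%N -> (n7 <= n6)%N by clear; lia.
by rewrite !card_ord in count; exact: arith count c e'.
Qed.

End SmallCancellation.

(** * The commutator subgroup of a free group *)

Section FreeDerived.
Variable k : nat.
Implicit Types (g h : free_group k) (w : seq (letter k)).

Lemma derived_balanced g (a : letter k) : derived g ->
  count_mem a g = count_mem (letter_inv a) g.
Proof.
by case=> m; rewrite -{1}(free_wordK g) => /(commutator_product_paired a)
  /paired_word_balanced; apply.
Qed.

(** Balance provides some pairing of the letters, and by [pairing_genus] a pairing of any genus
    exhibits a product of commutators. *)
Lemma balanced_derived g :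
  (forall a : letter k, count_mem a g = count_mem (letter_inv a) g) -> derived g.
Proof.
move=> bal; set w := free_word g; set n := size w.
have [w0|w0] := eqVneq w [::].
  by exists 0%N; apply/commutator_product0/val_inj.
have [|||nu [nuK nuF nul _]] := @extend_matching 'I_n _ (@letter_inv k)
    (@letter_at k w) 1%g (@letter_invK k) (@letter_inv_neq k).
- by move=> p; rewrite !perm1.
- by move=> p; rewrite perm1 eqxx.
- by move=> a; rewrite !card_letter_at.
have [||m [cm _]] := @pairing_genus 'I_n (free_group k)
    (fun p => letter_val (@free_gen k) (letter_at p)) (enum 'I_n) nu (enum_uniq _).
- by rewrite -size_eq0 size_enum_ord size_eq0.
- split=> // p; first by rewrite mem_enum (negPf (nuF p)).
  by move=> _; rewrite nul letter_valV.
by exists m; rewrite -(free_wordK g) /weval -/w -(map_letter_at w) big_map.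
Qed.

(** A coordinate of the class of [g] in the abelianization, a free abelian group of rank [k]. *)
Definition expsum (i : 'I_k) g : int :=
  \sum_(x <- (g : seq (letter k)) | x.1 == i) (if x.2 then -1 else 1)%R.

Lemma expsumM i : {morph expsum i : g h / (g * h)%g >-> (g + h)%R}.
Proof.
move=> g h; rewrite /expsum /=; elim: (free_word g) => [|x w IH] /=.
  by rewrite big_nil add0r.
have -> : (\sum_(y <- word_cons x (word_mul w h) | y.1 == i) (if y.2 then -1 else 1) =
    (if x.1 == i then if x.2 then -1 else 1 else 0) +
    \sum_(y <- word_mul w h | y.1 == i) (if y.2 then -1 else 1) :> int)%R.
  case: (word_mul w h) => [|y s]; first by rewrite /= big_mkcond big_seq1 big_nil addr0.
  rewrite /=; case: eqP => [->|_]; last by rewrite big_cons; case: ifP => // _; rewrite add0r.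
  rewrite big_cons /=; case: x => j b /=; case: eqP => // _; last by rewrite add0r.
  by case: b => /=; rewrite addrA ?subrr ?addNr ?add0r.
rewrite IH big_cons; case: eqP => _; rewrite ?add0r // addrA //.
Qed.

Lemma expsum_count i g :
  (expsum i g = (count_mem (i, false) g)%:Z - (count_mem (i, true) g)%:Z)%R.
Proof.
rewrite /expsum; elim: (free_word g) => [|[j b] w IH]; first by rewrite big_nil.
rewrite big_cons IH /= !xpair_eqE; case: eqP => //= _.
by case: b => /=; rewrite !PoszD; move: (Posz _) (Posz _) => x y; ring.
Qed.

Lemma derived_expsum g : (forall i, expsum i g = 0%R) <-> derived g.
Proof.
split=> [H|dg i].
  apply: balanced_derived => -[i b].
  have := H i; rewrite expsum_count => /eqP; rewrite subr_eq0 => /eqP[].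
  by case: b.
by rewrite expsum_count (@derived_balanced g (i, false)) // subrr.
Qed.

End FreeDerived.

Section FreeHomCl.
Variables (k l tau : nat) (f : 'I_k -> free_group l).
Hypothesis sc : small_cancellation tau (fun a => letter_val f a : seq (letter l)).

Lemma derived_morph (G K : groupType) (phi : {multiplicative G -> K}) g :
  derived g -> derived (phi g).
Proof. by case=> m /(commutator_product_morph phi); exists m. Qed.

Theorem cl_free_hom g : derived g -> cl (free_hom f g) = cl g.
Proof.
move=> dg; apply/eqP; rewrite eqn_leq; apply/andP; split.
  exact/cl_leq/commutator_product_morph/cl_spec.
apply: cl_leq; rewrite -{2}(free_wordK g).
apply: (small_cancellation_commutator_product sc).
- by move=> a; rewrite letter_valV.
- by move=> a; apply: valP.
- by move=> a; apply: derived_balanced.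
have -> : weval (flatten [seq (letter_val f a : seq _) | a <- (g : seq (letter k))]) =
    free_hom f g.
  rewrite /free_hom; elim: (free_word g) => [|x w IH].
    by rewrite /weval !big_nil.
  by rewrite big_cons /= weval_cat IH free_wordK.
exact/cl_spec/derived_morph.
Qed.

End FreeHomCl.

(** * Counting words without small cancellation *)

Section Segments.
Variables (l tau : nat).
Implicit Types (u v w : seq (letter l)) (i j : nat).

Definition segment w i := take tau (drop i w).

Lemma segment_split w j : w = take j w ++ segment w j ++ drop (j + tau) w.
Proof. by rewrite /segment addnC -drop_drop !cat_take_drop. Qed.

Lemma nth_segment x0 w i t : (t < tau)%N -> nth x0 (segment w i) t = nth x0 w (i + t).
Proof. by move=> tt; rewrite nth_take // nth_drop. Qed.

Lemma size_segment w i : (i + tau <= size w)%N -> size (segment w i) = tau.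
Proof.
move=> H; rewrite size_takel // size_drop leq_subRL //.
exact: leq_trans (leq_addr _ _) H.
Qed.

Lemma segment_inv w i : (i + tau <= size w)%N ->
  segment (word_inv w) i = word_inv (segment w (size w - (i + tau))).
Proof.
move=> H; rewrite {1}(segment_split w (size w - (i + tau))).
set w1 := take _ w; set w2 := segment w _; set w3 := drop _ w.
have s2 : size w2 = tau.
  by apply: size_segment; move: (size w) H => a H; lia.
have s3 : size w3 = i by rewrite size_drop; move: (size w) H => a H; lia.
rewrite /word_inv !map_cat !rev_cat /segment -catA drop_size_cat ?size_rev ?size_map //.
by rewrite take_size_cat // size_rev size_map.
Qed.

Lemma nth_word_inv x0 w t : (t < size w)%N ->
  nth x0 (word_inv w) t = letter_inv (nth x0 w (size w - t.+1)).
Proof.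
move=> tw; rewrite /word_inv nth_rev ?size_map // (nth_map x0) //.
exact: rev_lt.
Qed.

(* The letter in the middle of the overlap would be its own inverse, or
   inverse to its neighbour. *)
Lemma reduced_inverse_disjoint w i j : reduced_word w -> (0 < tau)%N ->
  (i <= j)%N -> (j + tau <= size w)%N -> segment w i = word_inv (segment w j) ->
  (i + tau <= j)%N.
Proof.
move=> rw t0 ij jw E; rewrite leqNgt; apply/negP => lt.
have [x0 _] : exists x0 : letter l, True.
  by case: (w) jw t0 => [|x ?]; [rewrite leqn0 addn_eq0 => /andP[_ /eqP->]|exists x].
have H p : (i <= p)%N -> (p < i + tau)%N -> nth x0 w p = letter_inv (nth x0 w (i + j + tau - p.+1)).
  move=> ip pi; have pt : (p - i < tau)%N by lia.
  have := congr1 (fun s => nth x0 s (p - i)) E; rewrite /= nth_segment // subnKC // => ->.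
  have sj := size_segment jw.
  rewrite nth_word_inv ?sj // nth_segment ?rev_lt //; congr (letter_inv (nth _ _ _)).
  by lia.
have [e|o] := boolP (odd (i + j + tau)).
  pose p := (i + j + tau)./2.
  have pE : (i + j + tau = p.*2.+1)%N by rewrite -[LHS]odd_double_half e.
  have E2 : (i + j + tau - p.+1 = p)%N by rewrite pE -addnn; lia.
  have := H p; rewrite E2 => F.
  have {}F : nth x0 w p = letter_inv (nth x0 w p).
    by apply: F; rewrite -addnn in pE; lia.
  by have := letter_inv_neq (nth x0 w p); rewrite -F eqxx.
pose p := ((i + j + tau)./2).-1.
have pE : (i + j + tau = p.+1 + p.+1)%N.
  rewrite -[LHS]odd_double_half (negPf o) add0n addnn /p prednK // half_gt0; lia.
have E2 : (i + j + tau - p.+1 = p.+1)%N by rewrite pE; lia.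
have := H p; rewrite E2 => F.
have pw : (p.+1 < size w)%N by move: (size w) jw => a jw; lia.
have {}F : nth x0 w p = letter_inv (nth x0 w p.+1) by apply: F; lia.
by have /(sortedP x0)/(_ _ pw) := rw; rewrite F letter_invK eqxx.
Qed.

End Segments.

Lemma size_flatten_map_const (A B : eqType) (F : A -> seq B) (s : seq A) c :
  {in s, forall x, size (F x) = c} -> size (flatten (map F s)) = (size s * c)%N.
Proof.
elim: s => //= x s IH H; rewrite size_cat H ?inE ?eqxx // IH ?mulSn // => y ys.
by apply: H; rewrite inE ys orbT.
Qed.

(** * The number of reduced words *)

Section CountingWords.
Variable l : nat.
Hypothesis l_gt1 : (1 < l)%N.
Implicit Types (w : seq (letter l)) (m n : nat).

(** The number of letters that can be put in front of a nonempty reduced word, hence the growth rate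
    of the free group. *)
Let q := (2 * l - 1)%N.

Definition extensions w :=
  [seq x :: w | x <- [seq x <- enum (letter l) | reduced_word (x :: w)]].

Fixpoint reduced_words m : seq (seq (letter l)) :=
  if m is m'.+1 then flatten (map extensions (reduced_words m')) else [:: [::]].

Lemma mem_reduced_words m w :
  (w \in reduced_words m) = (size w == m) && reduced_word w.
Proof.
elim: m w => [|m IH] w; first by case: w => //= x w; rewrite inE.
apply/flatten_mapP/andP => [[v]|].
  rewrite IH => /andP[/eqP <- rv] /mapP[x]; rewrite mem_filter => /andP[rx _] ->.
  by split.
case: w => [|x w] [] //= /eqP[sw] rw; exists w.
  by rewrite IH sw eqxx; apply: reduced_word_behead rw.
by apply: map_f; rewrite mem_filter mem_enum andbT.
Qed.

Lemma uniq_reduced_words m : uniq (reduced_words m).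
Proof.
elim: m => //= m IH; elim: (reduced_words m) IH => //= w r IHr /andP[wr ur].
rewrite cat_uniq; apply/and3P; split; last exact: IHr.
  by rewrite map_inj_uniq ?filter_uniq -?enumT ?enum_uniq // => x y [].
apply/hasPn => v /flatten_mapP[u ur' /mapP[x _ ->]]; apply/negP => /mapP[y _ [_ E]].
by rewrite -E ur' in wr.
Qed.

Lemma card_letter : #|{: letter l}| = (2 * l)%N.
Proof. by rewrite card_prod card_ord card_bool mulnC. Qed.

Lemma size_reduced_words m : size (reduced_words m.+1) = (2 * l * q ^ m)%N.
Proof.
have ext w : size (extensions w) =
    count (fun x => reduced_word (x :: w)) (enum (letter l)).
  by rewrite size_map size_filter.
have next y w : reduced_word (y :: w) ->
    count (fun x => reduced_word (x :: y :: w)) (enum (letter l)) = q.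
  move=> ry; have := count_predC (pred1 (letter_inv y)) (enum (letter l)).
  rewrite count_uniq_mem; last exact: enum_uniq.
  rewrite mem_enum -cardE card_letter => H.
  rewrite /q -H addKn; apply: eq_count => x.
  have rp : path (fun a b => b != letter_inv a) y w := ry.
  rewrite /reduced_word /= rp andbT.
  by rewrite eq_sym (inv_eq (@letter_invK l)).
elim: m => [|m IH].
  rewrite -[reduced_words 1]/(extensions [::] ++ [::]) cats0 ext expn0 muln1.
  by rewrite -card_letter cardE -count_predT; exact: eq_count.
rewrite expnSr mulnA -IH -[reduced_words m.+2]/(flatten (map extensions (reduced_words m.+1))).
apply: size_flatten_map_const => -[|y w]; rewrite mem_reduced_words // => /andP[_ rw].
by rewrite ext next.
Qed.

Lemma size_reduced_words_leq m : (size (reduced_words m) <= 2 * q ^ m)%N.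
Proof.
case: m => // m; rewrite size_reduced_words expnS mulnA leq_mul2r; apply/orP; right.
by rewrite /q; lia.
Qed.

Lemma size_reduced_words_geq m : (q ^ m <= size (reduced_words m))%N.
Proof.
case: m => // m; rewrite size_reduced_words expnS leq_mul2r; apply/orP; right.
by rewrite /q; lia.
Qed.

Lemma card_short_words_leq n : (#|short_words l n| <= 2 * n.+1 * q ^ n)%N.
Proof.
pose s := [seq val (val w) | w : short_words l n] : seq (seq (letter l)).
have us : uniq s.
  rewrite map_inj_uniq ?enum_uniq // => u v E; exact/val_inj/val_inj.
have sub : {subset s <= flatten [seq reduced_words m | m <- iota 0 n.+1]}.
  move=> _ /mapP[w _ ->]; apply/flatten_mapP; exists (size (val w)).
    by rewrite mem_iota /= add0n ltnS size_bseq.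
  by rewrite mem_reduced_words eqxx (valP w).
have := uniq_leq_size us sub; rewrite size_map -cardE => /leq_trans; apply.
rewrite size_flatten /shape -map_comp.
have H : {in iota 0 n.+1, forall m, (size (reduced_words m) <= 2 * q ^ n)%N}.
  move=> m; rewrite mem_iota add0n /= ltnS => mn.
  apply: leq_trans (size_reduced_words_leq m) _.
  by rewrite leq_mul2l /= leq_pexp2l // /q; lia.
rewrite mulnAC mulnC -{2}(size_iota 0 n.+1).
elim: (iota 0 n.+1) H => //= m r IHr H; rewrite mulSn leq_add //.
  by apply: H; rewrite inE eqxx.
by apply: IHr => p pr; apply: H; rewrite inE pr orbT.
Qed.

Lemma card_short_words_geq n : (q ^ n <= #|short_words l n|)%N.
Proof.
apply: leq_trans (size_reduced_words_geq n) _.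
have sub : {subset reduced_words n <= [seq val (val w) | w : short_words l n]}.
  move=> w; rewrite mem_reduced_words => /andP[/eqP sw rw].
  have bw : (size w <= n)%N by rewrite sw.
  apply/mapP; exists (exist _ (Bseq bw) rw : short_words l n) => //.
  by rewrite mem_enum.
have := uniq_leq_size (uniq_reduced_words n) sub.
by rewrite size_map -cardE.
Qed.

(** The word is encoded by what precedes and what follows the window, two reduced words of total
    length at most [n - tau]. The factor [4 * n.+1 ^ 2] is the product of the two polynomial factors
    in [card_short_words_leq]. *)
Lemma card_determined n tau (j : nat) (A : {pred short_words l n}) :
  (forall w : short_words l n, w \in A -> (j + tau <= size (val w))%N) ->
  (forall v w : short_words l n, v \in A -> w \in A -> take j (val v) = take j (val w) ->
     drop (j + tau) (val v) = drop (j + tau) (val w) -> v = w) ->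
  (#|A| <= 4 * n.+1 ^ 2 * q ^ (n - tau))%N.
Proof.
move=> Aj Adet.
have [w0 w0A|A0] := pickP A; last first.
  by rewrite eq_card0.
have jn : (j + tau <= n)%N by apply: leq_trans (Aj _ w0A) (size_bseq _).
have pre (w : short_words l n) : reduced_word (take j (val w : seq (letter l))) /\ (size (take j (val w)) <= j)%N.
  by split; [apply: take_sorted; apply: valP w|rewrite size_take_min geq_minl].
have suf (w : short_words l n) : reduced_word (drop (j + tau) (val w : seq (letter l))) /\
    (size (drop (j + tau) (val w)) <= n - tau - j)%N.
  split; first by apply: drop_sorted; apply: valP w.
  by rewrite size_drop -subnDA (addnC tau) leq_sub2r // size_bseq.
pose F (w : short_words l n) : short_words l j * short_words l (n - tau - j) :=
  (exist _ (Bseq (proj2 (pre w))) (proj1 (pre w)),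
   exist _ (Bseq (proj2 (suf w))) (proj1 (suf w))).
have Finj : {in A &, injective F}.
  move=> v w vA wA [E1 E2]; exact: Adet.
have : (#|A| <= #|short_words l j| * #|short_words l (n - tau - j)|)%N.
  rewrite -card_prod -(card_in_image Finj); exact: max_card.
move/leq_trans; apply.
apply: leq_trans (leq_mul (card_short_words_leq _) (card_short_words_leq _)) _.
rewrite mulnACA -expnD; apply: leq_mul.
  rewrite mulnACA leq_mul //= -mulnn leq_mul //; lia.
by rewrite leq_pexp2l //; rewrite /q; lia.
Qed.

End CountingWords.

(** * Conditioning on all coordinates but one *)

Section CoordinateUpdate.
Variables (I S : finType).
Implicit Types (f : {ffun I -> S}) (x : I) (w : S).

Definition update f x w := [ffun y => if y == x then w else f y].

Lemma update_same f x w : update f x w x = w.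
Proof. by rewrite ffunE eqxx. Qed.

Lemma update_other f x w y : y != x -> update f x w y = f y.
Proof. by rewrite ffunE => /negPf ->. Qed.

(** Coordinate [x] is resampled: the involution [sw] exchanges it with an independent copy, so
    counting [P] on the original is counting it on the updated function, fibre by fibre. *)
Lemma coordinate_bound (P : pred {ffun I -> S}) x B :
  (forall f, (#|[pred w | P (update f x w)]| <= B)%N) ->
  (#|P| * #|S| <= B * #|{ffun I -> S}|)%N.
Proof.
move=> H; pose sw (p : {ffun I -> S} * S) := (update p.1 x p.2, p.1 x).
have swK : involutive sw.
  move=> [f w]; rewrite /sw /= update_same; congr (_, _).
  by apply/ffunP => y; rewrite !ffunE; case: eqP => [->|].
have -> : (#|P| * #|S| = \sum_(p : {ffun I -> S} * S) P p.1)%N.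
  rewrite -(pair_bigA _ (fun f w => P f : nat)) /=.
  under eq_bigr do rewrite sum_nat_const.
  by rewrite -big_distrr /= -big_mkcond sum1_card mulnC.
rewrite (reindex_inj (inv_inj swK)) /= -(pair_bigA _ (fun f w => P (update f x w) : nat)) /=.
rewrite mulnC -sum_nat_const; apply: leq_sum => f _.
rewrite -big_mkcond sum1_card; exact: H.
Qed.

End CoordinateUpdate.

(** * The exceptional events *)

Section Events.
Variables (k l n tau : nat).
Hypothesis l_gt1 : (1 < l)%N.
Hypothesis tau_gt0 : (0 < tau)%N.
Implicit Types (f : {ffun 'I_k -> short_words l n}).

Let q := (2 * l - 1)%N.

Local Notation word w := (val (val w) : seq (letter l)).

Definition short_event x f := (size (word (f x)) <= 6 * tau)%N.

(** The flag [s] asks for an occurrence of the inverse subword. Inside a single word the places are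
    ordered, so that the segment at [j] can be recovered from earlier letters: a direct repetition
    may overlap itself, while for an inverse one disjointness can be demanded thanks to
    [reduced_inverse_disjoint]. *)
Definition overlap_event (e : 'I_k * 'I_k * 'I_n.+1 * 'I_n.+1 * bool) f :=
  let: (x, y, i, j, s) := e in
  [&& (x == y) ==> (if s then i + tau <= j else i < j)%N,
      (i + tau <= size (word (f x)))%N, (j + tau <= size (word (f y)))%N &
      segment tau (word (f y)) j ==
      (if s then word_inv (segment tau (word (f x)) i) else segment tau (word (f x)) i)].

(** The number of words of length at most [6 * tau] is at most a polynomial factor times
    [q ^ (6 * tau)], and [7 * tau <= n] makes this power at most [q ^ (n - tau)]. *)
Lemma short_event_bound x : (7 * tau <= n)%N ->
  (#|[pred f | short_event x f]| * #|short_words l n| <=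
   4 * n.+1 ^ 2 * q ^ (n - tau) * #|{ffun 'I_k -> short_words l n}|)%N.
Proof.
move=> tn; apply: (@coordinate_bound _ _ _ x) => f.
(* The same word, viewed in a smaller type; the default value, the empty word, is not reached on the
   event. *)
pose F (w : short_words l n) : short_words l (6 * tau) :=
  if insub (word w) is Some u then if insub u is Some v then v else
    exist _ (Bseq (leq0n _ : size [::] <= 6 * tau)%N) isT else
    exist _ (Bseq (leq0n _ : size [::] <= 6 * tau)%N) isT.
have FE w : (size (word w) <= 6 * tau)%N -> word (F w) = word w.
  move=> sw; rewrite /F; case: insubP => [u _ uE|]; last by rewrite sw.
  case: insubP => [v _ vE|]; first by rewrite vE uE.
  by rewrite uE (valP w).
have Finj : {in [pred w | [pred f | short_event x f] (update f x w)] &, injective F}.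
  move=> u v; rewrite !inE /short_event !update_same => /FE uE /FE vE E.
  by apply/val_inj/val_inj; rewrite /= -uE -vE E.
set A := [pred w | _] in Finj.
apply: (@leq_trans #|[seq F x | x in A]|); first by rewrite (card_in_image Finj).
apply: leq_trans (max_card _) _.
apply: leq_trans (card_short_words_leq l_gt1 _) _.
apply: leq_mul; last by rewrite leq_pexp2l //; move: tn; rewrite /q; lia.
rewrite -mulnn mulnA leq_mul //; last by lia.
by lia.
Qed.

(** With all coordinates but [y] fixed, the segment at [j] is a function of the rest: of the image
    of [x] if [x != y], and of the letters before [j] otherwise. *)
Lemma overlap_event_bound e :
  (#|[pred f | overlap_event e f]| * #|short_words l n| <=
   4 * n.+1 ^ 2 * q ^ (n - tau) * #|{ffun 'I_k -> short_words l n}|)%N.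
Proof.
case: e => [[[[x y] i] j] s]; apply: (@coordinate_bound _ _ _ y) => f.
apply: (card_determined l_gt1 (tau := tau) (j := j)) => [w|v w].
  by rewrite inE /= update_same => /and4P[].
rewrite !inE /= !update_same => /and4P[ij iv jv /eqP Ev] /and4P[_ iw jw /eqP Ew] Et Ed.
suff E : segment tau (word v) j = segment tau (word w) j.
  apply/val_inj/val_inj.
  by rewrite /= (segment_split tau (word v) j) (segment_split tau (word w) j) Et Ed E.
have [xy|xy] := eqVneq x y; last first.
  by rewrite Ev Ew !update_other.
rewrite {}xy in ij iv iw Ev Ew; rewrite eqxx /= in ij; rewrite !update_same in iv iw Ev Ew.
case: s ij Ev Ew => ij Ev Ew.
  rewrite Ev Ew; congr word_inv.
  rewrite /segment; have E (u : seq (letter l)) : take tau (drop i u) = take tau (drop i (take j u)).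
    by rewrite !take_drop take_takel // addnC.
  by rewrite (E (word v)) (E (word w)) Et.
have [x0 _] : exists x0 : letter l, True.
  by exists (Ordinal (ltnW l_gt1), false).
apply: (@eq_from_nth _ x0); first by rewrite !size_segment.
(* In a self-overlapping repetition the letter at [j + t] equals the one at [i + t], which lies
   before [j] or was recovered at an earlier stage. *)
rewrite size_segment // => t; elim/ltn_ind: t => t IH tt.
have nthE (u : seq (letter l)) : segment tau u j = segment tau u i ->
    nth x0 (segment tau u j) t = nth x0 u (i + t).
  by move=> ->; rewrite nth_segment.
rewrite nthE // nthE //.
have [lt|ge] := ltnP (i + t) j.
  have T (u : seq (letter l)) : nth x0 u (i + t) = nth x0 (take j u) (i + t) by rewrite nth_take.
  by rewrite T Et -T.
have st : (i + t - j < t)%N by lia.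
have := IH _ st (ltn_trans st tt).
by rewrite !nth_segment ?(ltn_trans st) // subnKC.
Qed.

(** [pos] mirrors a place in the image of an inverse letter to the place in the image of the
    generator, so that each coincidence of subwords becomes a direct or an inverse repetition
    between images of generators. Only the coincidence of a place with itself survives. *)
Lemma no_event_small_cancellation f :
  (forall x, ~~ short_event x f) -> (forall e, ~~ overlap_event e f) ->
  small_cancellation tau
    (fun a => letter_val (fun i => free_of_short (f i)) a : seq (letter l)).
Proof.
move=> ns no; pose W (a : letter k) : seq (letter l) :=
  if a.2 then word_inv (word (f a.1)) else word (f a.1).
have WE a : (letter_val (fun i => free_of_short (f i)) a : seq (letter l)) = W a.
  by case: a => i [].
have sW a : size (W a) = size (word (f a.1)).
  by rewrite /W; case: ifP => // _; rewrite size_rev size_map.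
split=> // [a|a b i j].
  by rewrite WE sW ltnNge; exact: ns.
rewrite !WE !sW => ia jb.
pose pos (a : letter k) i := if a.2 then (size (word (f a.1)) - (i + tau))%N else i.
have segE c p : (p + tau <= size (word (f c.1)))%N -> take tau (drop p (W c)) =
    if c.2 then word_inv (segment tau (word (f c.1)) (pos c p)) else segment tau (word (f c.1)) (pos c p).
  rewrite /W /pos => H; case: (c.2) => //.
  exact: segment_inv.
have posP c p : (p + tau <= size (word (f c.1)))%N ->
    (pos c p + tau <= size (word (f c.1)))%N.
  by rewrite /pos; case: (c.2) => //; move: (size _) => m H; lia.
have pos_inj c p r : (p + tau <= size (word (f c.1)))%N ->
    (r + tau <= size (word (f c.1)))%N -> pos c p = pos c r -> p = r.
  by rewrite /pos; case: (c.2) => //; move: (size _) => m H H' ?; lia.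
rewrite !segE //; have ia' := posP _ _ ia; have jb' := posP _ _ jb.
have lt_n c p : (p + tau <= size (word (f c)))%N -> (p < n.+1)%N.
  move=> H; rewrite ltnS; apply: leq_trans (leq_addr tau _) _.
  exact: leq_trans H (size_bseq _).
have ov x y p r s : (p + tau <= size (word (f x)))%N -> (r + tau <= size (word (f y)))%N ->
    ((x == y) ==> (if s then p + tau <= r else p < r)%N) ->
    segment tau (word (f y)) r =
      (if s then word_inv (segment tau (word (f x)) p) else segment tau (word (f x)) p) -> False.
  move=> px ry c E; have /negP := no (x, y, Ordinal (lt_n _ _ px), Ordinal (lt_n _ _ ry), s).
  by apply; rewrite /overlap_event /= c px ry E eqxx.
case: a b ia jb ia' jb' => [x sa] [y sb] /=.
set p := pos (x, sa) i; set r := pos (y, sb) j => ia jb ia' jb' E.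
have rE : r = pos (y, sb) j by [].
clearbody r.
have aux (U V : seq (letter l)) (s t : bool) :
    (if s then word_inv U else U) = (if t then word_inv V else V) ->
    V = if s (+) t then word_inv U else U.
  by case: s t => [] [] /=; [move/(can_inj (@word_invK l))|move=> <-|
    move=> ->; rewrite word_invK|move=> ->].
have {}E := aux _ _ _ _ E.
have [xy|xy] := eqVneq x y; last first.
  by case: (ov x y p r (sa (+) sb)) => //; rewrite (negPf xy).
case: _ / xy rE jb jb' E => rE jb jb' E.
have rf : reduced_word (word (f x)) := valP (f x).
case s : (sa (+) sb) E => E.
  have [pr|rp] := leqP p r.
    case: (ov x x p r true) => //; rewrite eqxx /=.
    by apply: (reduced_inverse_disjoint rf) => //; rewrite E word_invK.
  case: (ov x x r p true) => //; last by rewrite E word_invK.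
  by rewrite eqxx /=; apply: (reduced_inverse_disjoint rf) => //; exact: ltnW.
have sab : sa = sb by move: s; clear; case: sa; case: sb.
have [pr|rp|pr] := ltngtP p r.
- by case: (ov x x p r false) => //; rewrite eqxx.
- by case: (ov x x r p false) => //; rewrite eqxx.
rewrite /p rE -sab in pr; rewrite -sab; split=> //.
exact: (pos_inj (x, sa)).
Qed.

End Events.

(** * Stable commutator length of chains *)

Section BoundedEquivalence.
Variable G : groupType.
Implicit Types (g h : G) (x y z : nat -> G).

Lemma derivedM g h : derived g -> derived h -> derived (g * h)%g.
Proof. by case=> m cg [n ch]; exists (m + n)%N; apply: commutator_productM. Qed.

Lemma derivedV g : derived g -> derived (g^-1)%g.
Proof. by case=> m /commutator_productV cg; exists m. Qed.

(** Under this relation the growth rate of [cl] is invariant and products may be reordered, so a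
    chain determines one class of sequences however its terms are listed. *)
Definition bounded_eq x y := exists K, forall n, commutator_product K (x n * (y n)^-1)%g.

Lemma bounded_eq_refl x : bounded_eq x x.
Proof. by exists 0%N => n; rewrite mulgV; apply/commutator_product0. Qed.

Lemma eq_bounded_eq x y : x =1 y -> bounded_eq x y.
Proof. by move=> xy; exists 0%N => n; rewrite xy mulgV; apply/commutator_product0. Qed.

Lemma bounded_eq_sym x y : bounded_eq x y -> bounded_eq y x.
Proof.
case=> K H; exists K => n; rewrite -[(y n * _)%g]invgK.
by apply: commutator_productV; rewrite invgM invgK.
Qed.

Lemma bounded_eq_trans y x z : bounded_eq x y -> bounded_eq y z -> bounded_eq x z.
Proof.
move=> [K H] [K' H']; exists (K + K')%N => n.
have -> : (x n * (z n)^-1 = (x n * (y n)^-1) * (y n * (z n)^-1))%g.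
  by rewrite mulgA mulgVK.
exact: commutator_productM.
Qed.

Lemma bounded_eqM x x' y y' : bounded_eq x x' -> bounded_eq y y' ->
  bounded_eq (fun n => x n * y n)%g (fun n => x' n * y' n)%g.
Proof.
move=> [K H] [K' H']; exists (K' + K)%N => n.
have -> : (x n * y n * (x' n * y' n)^-1 =
    (y n * (y' n)^-1) ^ (x n)^-1 * (x n * (x' n)^-1))%g.
  by rewrite /conjg invgK invgM !mulgA mulgVK.
by apply: commutator_productM => //; apply: commutator_productJ.
Qed.

Lemma bounded_eqC x y : bounded_eq (fun n => x n * y n)%g (fun n => y n * x n)%g.
Proof.
exists 1%N => n; have -> : (x n * y n * (y n * x n)^-1 = [~ (x n)^-1, (y n)^-1])%g.
  by rewrite (commgCV (x n)) mulgK.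
exact: commutator_product1.
Qed.

Lemma bounded_eqJ x h : bounded_eq (fun n => h * x n * h^-1)%g x.
Proof.
apply: (bounded_eq_trans (y := fun n => (x n * h^-1) * h)%g).
  apply: (bounded_eq_trans (y := fun n => h * (x n * h^-1))%g).
    by apply: eq_bounded_eq => n; rewrite mulgA.
  exact: bounded_eqC.
by apply: eq_bounded_eq => n; rewrite mulgVK.
Qed.

Lemma bounded_eq_prod (I : eqType) (r : seq I) (x y : I -> nat -> G) :
  (forall i, i \in r -> bounded_eq (x i) (y i)) ->
  bounded_eq (fun n => \prod_(i <- r) x i n)%g (fun n => \prod_(i <- r) y i n)%g.
Proof.
elim: r => [|i r IH] H.
  by apply: eq_bounded_eq => n; rewrite !big_nil.
apply: (bounded_eq_trans (y := fun n => x i n * \prod_(j <- r) x j n)%g).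
  by apply: eq_bounded_eq => n; rewrite big_cons.
apply: (bounded_eq_trans (y := fun n => y i n * \prod_(j <- r) y j n)%g); last first.
  by apply: eq_bounded_eq => n; rewrite big_cons.
apply: bounded_eqM; first by apply: H; rewrite inE eqxx.
by apply: IH => j jr; apply: H; rewrite inE jr orbT.
Qed.

Lemma bounded_eq_prodM (I : eqType) (r : seq I) (x y : I -> nat -> G) :
  bounded_eq (fun n => \prod_(i <- r) (x i n * y i n))%g
    (fun n => (\prod_(i <- r) x i n) * (\prod_(i <- r) y i n))%g.
Proof.
elim: r => [|i r IH].
  by apply: eq_bounded_eq => n; rewrite !big_nil mulg1.
apply: (bounded_eq_trans (y := fun n => x i n * y i n *
    ((\prod_(j <- r) x j n) * (\prod_(j <- r) y j n)))%g).
  have -> : (fun n => \prod_(j <- i :: r) (x j n * y j n))%g =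
      (fun n => (x i n * y i n) * \prod_(j <- r) (x j n * y j n))%g.
    by apply/funext => n; rewrite big_cons.
  by apply: bounded_eqM => //; exact: bounded_eq_refl.
apply: (bounded_eq_trans (y := fun n => x i n * ((\prod_(j <- r) x j n) * y i n) *
    \prod_(j <- r) y j n)%g); last first.
  by apply: eq_bounded_eq => n; rewrite !big_cons !mulgA.
apply: (bounded_eq_trans (y := fun n => x i n * (y i n * (\prod_(j <- r) x j n)) *
    \prod_(j <- r) y j n)%g); first by apply: eq_bounded_eq => n; rewrite !mulgA.
apply: bounded_eqM; last exact: bounded_eq_refl.
by apply: bounded_eqM; [exact: bounded_eq_refl|exact: bounded_eqC].
Qed.

Lemma bounded_eq_perm (I : eqType) (r s : seq I) (x : I -> nat -> G) : perm_eq r s ->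
  bounded_eq (fun n => \prod_(i <- r) x i n)%g (fun n => \prod_(i <- s) x i n)%g.
Proof.
elim: r s => [|i r IH] s rs.
  have /eqP/size0nil -> : size s == 0%N by rewrite -(perm_size rs).
  exact: bounded_eq_refl.
have /split_mem[u [v sE]] : i \in s by rewrite -(perm_mem rs) inE eqxx.
have {IH} IH : bounded_eq (fun n => \prod_(j <- r) x j n)%g
    (fun n => \prod_(j <- u ++ v) x j n)%g.
  apply: IH; rewrite -(perm_cons i); apply: perm_trans rs _.
  by rewrite sE perm_catC /= perm_cons perm_catC.
apply: (bounded_eq_trans (y := fun n => x i n * \prod_(j <- u ++ v) x j n)%g).
  have -> : (fun n => \prod_(j <- i :: r) x j n)%g =
      (fun n => x i n * \prod_(j <- r) x j n)%g.
    by apply/funext => n; rewrite big_cons.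
  by apply: bounded_eqM => //; exact: bounded_eq_refl.
have -> : (fun n => x i n * \prod_(j <- u ++ v) x j n)%g =
    (fun n => (x i n * \prod_(j <- u) x j n) * \prod_(j <- v) x j n)%g.
  by apply/funext => n; rewrite big_cat /= mulgA.
have -> : (fun n => \prod_(j <- s) x j n)%g =
    (fun n => (\prod_(j <- u) x j n * x i n) * \prod_(j <- v) x j n)%g.
  by apply/funext => n; rewrite sE big_cat big_cons /= mulgA.
by apply: bounded_eqM; [exact: bounded_eqC|exact: bounded_eq_refl].
Qed.

Lemma bounded_eq_derived x y : bounded_eq x y -> (forall n, derived (x n)) ->
  forall n, derived (y n).
Proof.
move=> [K H] dx n; rewrite -[y n](mulgVK (x n)).
apply: derivedM => //; rewrite -[(y n * _)%g]invgK; apply: derivedV.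
by exists K; rewrite invgM invgK.
Qed.

Lemma bounded_eq_cl x y : bounded_eq x y -> (forall n, derived (x n)) ->
  exists K, forall n, (cl (x n) <= cl (y n) + K)%N /\ (cl (y n) <= cl (x n) + K)%N.
Proof.
move=> xy dx; have dy := bounded_eq_derived xy dx; have yx := bounded_eq_sym xy.
case: xy yx => K H [K' H']; exists (maxn K K') => n; split; apply: cl_leq.
  rewrite -[x n](mulgVK (y n)) addnC; apply: commutator_productM; last exact: cl_spec.
  by apply: commutator_product_leq (H n); apply: leq_maxl.
rewrite -[y n](mulgVK (x n)) addnC; apply: commutator_productM; last exact: cl_spec.
by apply: commutator_product_leq (H' n); apply: leq_maxr.
Qed.

(** Powers up to a bounded number of commutators; [cl] of such a sequence is subadditive up to a
    constant. *)
Definition quasi_power x := exists K, forall n m,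
  commutator_product K (x (n + m)%N * (x n * x m)^-1)%g.

Lemma quasi_power_expg g : quasi_power (fun n => g ^+ n)%g.
Proof.
exists 0%N => n m; rewrite expgnDr mulgV; exact/commutator_product0.
Qed.

Lemma quasi_powerM x y : quasi_power x -> quasi_power y ->
  quasi_power (fun n => x n * y n)%g.
Proof.
move=> [K H] [K' H']; exists (K' + K + 1)%N => n m.
have -> : (x (n + m)%N * y (n + m)%N * (x n * y n * (x m * y m))^-1 =
    (y (n + m)%N * (y n * y m)^-1) ^ (x (n + m)%N)^-1 *
    (x (n + m)%N * (x n * x m)^-1) *
    ((x m * y n * (y n * x m)^-1) ^ (x n)^-1))%g.
  by rewrite /conjg !invgK !invgM -!mulgA !(mulKg, mulVKg).
apply: commutator_productM; first apply: commutator_productM => //.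
  exact: commutator_productJ.
apply: commutator_productJ; have -> : (x m * y n * (y n * x m)^-1 = [~ (x m)^-1, (y n)^-1])%g.
  by rewrite (commgCV (x m)) mulgK.
exact: commutator_product1.
Qed.

Lemma quasi_power_prod (I : Type) (r : seq I) (x : I -> nat -> G) :
  (forall i, quasi_power (x i)) -> quasi_power (fun n => \prod_(i <- r) x i n)%g.
Proof.
move=> H; elim: r => [|i r IH].
  exists 0%N => n m; rewrite !big_nil mulg1 mulgV; exact/commutator_product0.
have -> : (fun n => \prod_(j <- i :: r) x j n)%g =
      (fun n => x i n * \prod_(j <- r) x j n)%g.
  by apply/funext => n; rewrite big_cons.
exact: quasi_powerM.
Qed.

Lemma quasi_power_derived x : quasi_power x -> x 0%N = 1%g -> derived (x 1%N) ->
  forall n, derived (x n).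
Proof.
move=> [K H] x0 d1; elim=> [|n IH].
  by rewrite x0; exists 0%N; apply/commutator_product0.
rewrite -addn1 -[x _](mulgVK (x n * x 1%N)%g); apply: derivedM.
  by exists K.
exact: derivedM.
Qed.

End BoundedEquivalence.

Local Open Scope classical_set_scope.
Local Open Scope ring_scope.

(** * Fekete's lemma with a bounded error *)

Section Fekete.
Variable R : realType.

Lemma invn_lt_near (M e : R) : 0 < e -> \forall n \near \oo, M / n%:R < e.
Proof.
move=> e0; have [M0|M0] := ltP 0 M; last first.
  near=> n; have n0 : 0 < n%:R :> R by rewrite ltr0n; near: n; exists 1%N.
  by apply: le_lt_trans e0; rewrite mulr_le0_ge0 // invr_ge0 ltW.
have := @near_infty_natSinv_lt R (PosNum (divr_gt0 e0 M0)) => -[N _ H].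
exists N.+1 => // -[//|n] /= Nn; have := H n Nn; rewrite /= => lt.
by rewrite -ltr_pdivlMl // mulrC.
Unshelve. all: by end_near.
Qed.

(** Adding [K] makes the sequence subadditive. The limit is the infimum [L] of [b n / n]: division
    of [n] by a nearly optimal index bounds [b n] from above, all remainders being covered by the
    constant [M]. *)
Lemma fekete (a : nat -> nat) (K : nat) :
  (forall n m, (a (n + m) <= a n + a m + K)%N) ->
  cvgn (fun n => (a n)%:R / n%:R : R).
Proof.
move=> sub; pose b n : R := (a n)%:R + K%:R.
have b0 n : 0 <= b n by rewrite addr_ge0 ?ler0n.
have bD n m : b (n + m)%N <= b n + b m.
  rewrite /b -!natrD ler_nat; move: (sub n m).
  by move: (a (n + m)%N) (a n) (a m) => a1 a2 a3; clear; lia.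
have bM q m r : b (q * m + r)%N <= q%:R * b m + b r.
  elim: q => [|q IH]; first by rewrite mul0r add0r mul0n add0n.
  rewrite mulSn -addnA (le_trans (bD _ _)) // -natr1 mulrDl mul1r; lra.
pose S : set R := [set b n.+1 / n.+1%:R | n in setT].
have S0 : S !=set0 by exists (b 1%N / 1%:R), 0%N.
have Slb : has_lbound S.
  by exists 0 => _ [n _ <-]; rewrite divr_ge0.
pose L := inf S.
apply: (@cvgP _ _ L); apply/cvgrPdist_lt => e e0.
have e3 : 0 < e / 3 by rewrite divr_gt0.
have [_ [m _ <-] ltm] := inf_adherent e3 (conj S0 Slb).
pose M := \sum_(r < m.+1) b r.
have bn n : b n <= n%:R * (b m.+1 / m.+1%:R) + M.
  rewrite {1}(divn_eq n m.+1); apply: le_trans (bM _ _ _) _; apply: lerD.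
    rewrite mulrA ler_pdivlMr ?ltr0n // mulrAC ler_wpM2r // -natrM ler_nat.
    exact: leq_divM.
  rewrite /M (bigD1 (Ordinal (ltn_pmod n (ltn0Sn m)))) //= lerDl.
  by apply: sumr_ge0 => i _.
near=> n.
have n0 : (0 < n)%N by near: n; exists 1%N.
have nR : 0 < n%:R :> R by rewrite ltr0n.
have KE : (a n)%:R / n%:R = b n / n%:R - K%:R / n%:R :> R.
  by rewrite /b mulrDl addrK.
have lo : L <= b n / n%:R.
  by apply: ge_inf => //; exists n.-1; rewrite ?prednK.
have hi : b n / n%:R <= b m.+1 / m.+1%:R + M / n%:R.
  by rewrite ler_pdivrMr // mulrDl divfK ?gt_eqF // mulrC.
have Me : M / n%:R < e / 3 by near: n; apply: invn_lt_near.
have Ke : K%:R / n%:R < e / 3 :> R by near: n; apply: invn_lt_near.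
have K0 : 0 <= K%:R / n%:R :> R by rewrite divr_ge0.
rewrite KE ltr_norml; apply/andP; split; move: lo hi Me Ke K0 ltm;
  rewrite -/L; move: (b n / _) (b m.+1 / _) (M / _) (K%:R / _) => u v w z; lra.
Unshelve. all: by end_near.
Qed.

End Fekete.

Section IntegerPowers.
Variable G : groupType.
Implicit Types (g h : G) (z t : int).

Lemma expgz0 g : expgz g 0 = 1%g. Proof. by []. Qed.

Lemma expgzS g z : expgz g (z + 1) = (expgz g z * g)%g.
Proof.
case: z => [n|[|n]]; first by rewrite -PoszD addn1 /= expgSr.
  by rewrite /= expg1 mulVg.
have -> : Negz n.+1 + 1 = Negz n by rewrite !NegzE; lia.
by rewrite /= [(g ^+ n.+2)%g]expgS invgM -mulgA mulVg mulg1.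
Qed.

Lemma expgzD g z t : expgz g (z + t) = (expgz g z * expgz g t)%g.
Proof.
elim/int_ind: t => [|n IH|n IH]; first by rewrite addr0 expgz0 mulg1.
  by rewrite -addn1 PoszD addrA !expgzS mulgA IH.
apply: (mulIg g); rewrite -mulgA -!expgzS.
have -> : - n.+1%:Z + 1 = - n%:Z by lia.
by rewrite -IH; congr (expgz g _); lia.
Qed.

Lemma expgzN g z : expgz g (- z) = ((expgz g z)^-1)%g.
Proof. by apply: (mulIg (expgz g z)); rewrite mulVg -expgzD addNr. Qed.

Lemma expgzMn g z n : expgz g (z * n%:Z) = (expgz g z ^+ n)%g.
Proof.
elim: n => [|n IH]; first by rewrite mulr0 expg0.
by rewrite -addn1 PoszD mulrDr mulr1 expgzD IH expgnDr expg1.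
Qed.

Lemma expgzM g z t : expgz g (z * t) = expgz (expgz g z) t.
Proof.
case: t => n; first by rewrite expgzMn.
by rewrite NegzE mulrN !expgzN expgzMn.
Qed.

Lemma expgz_conj g h z : expgz (h * g * h^-1)%g z = (h * expgz g z * h^-1)%g.
Proof.
have JX n : ((h * g * h^-1) ^+ n = h * g ^+ n * h^-1)%g.
  elim: n => [|n IH]; first by rewrite !expg0 mulg1 mulgV.
  by rewrite !expgS IH !mulgA mulgVK.
by case: z => n; rewrite /= JX // !invgM invgK mulgA.
Qed.

End IntegerPowers.

(** * Sequences of powers attached to chains *)

Section ChainPowers.
Variables (R : realType) (G : groupType).
Local Notation chain := {freeg G / R}.
Implicit Types (g h : G) (c d : chain) (N M n : nat).

Definition cleared_power c N n : G := (\prod_(g <- cleared N c) g ^+ n)%g.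

Definition clears_int N c := forall g, N%:R * coeff g c \is a Num.int.

Lemma cleared_powerE c N : cleared_power c N =
  (fun n => \prod_(g <- dom c) expgz g (Num.floor (N%:R * coeff g c)) ^+ n)%g.
Proof. by apply/funext => n; rewrite /cleared_power /cleared big_map. Qed.

(** Enlarging the index set adds trivial factors only, so chains with different supports can be
    compared over a common one. *)
Lemma cleared_power_sup c N (X : seq G) : uniq X -> {subset dom c <= X} ->
  bounded_eq (cleared_power c N)
    (fun n => \prod_(g <- X) expgz g (Num.floor (N%:R * coeff g c)) ^+ n)%g.
Proof.
move=> UX cX; rewrite cleared_powerE.
pose F g n := (expgz g (Num.floor (N%:R * coeff g c)) ^+ n)%g.
have -> : (fun n => \prod_(g <- dom c) expgz g (Num.floor (N%:R * coeff g c)) ^+ n)%g =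
    (fun n => \prod_(g <- dom c ++ [seq g <- X | g \notin dom c]) F g n)%g.
  apply/funext => n; rewrite big_cat /= [X in (_ * X)%g]big1_seq ?mulg1 //.
  move=> g /=; rewrite mem_filter => /andP[/coeff_outdom gc _].
  by rewrite /F gc mulr0 floor0 expg1n.
apply: (@bounded_eq_perm _ _ _ X F); apply: uniq_perm => //.
  rewrite cat_uniq uniq_dom filter_uniq // andbT.
  by apply/hasPn => g; rewrite mem_filter => /andP[].
move=> g; rewrite mem_cat mem_filter.
by have [/cX ->|] := boolP (g \in dom c); rewrite ?orbT.
Qed.

Lemma quasi_cleared_power c N : quasi_power (cleared_power c N).
Proof. by rewrite cleared_powerE; apply: quasi_power_prod => g; exact: quasi_power_expg. Qed.

Lemma cleared_power0 c N : cleared_power c N 0 = 1%g.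
Proof. by rewrite cleared_powerE big1. Qed.

Lemma floorD_int (x y : R) : x \is a Num.int -> y \is a Num.int ->
  Num.floor (x + y) = Num.floor x + Num.floor y.
Proof.
by move=> /floorK xE /floorK yE; rewrite -{1}xE -{1}yE -intrD intrKfloor.
Qed.

Lemma cleared_powerD c d N : clears_int N c -> clears_int N d ->
  bounded_eq (cleared_power (c + d) N)
    (fun n => cleared_power c N n * cleared_power d N n)%g.
Proof.
move=> Ic Id; pose X := undup (dom c ++ dom d ++ dom (c + d)).
have UX : uniq X by apply: undup_uniq.
have cX : {subset dom c <= X} by move=> g gc; rewrite mem_undup mem_cat gc.
have dX : {subset dom d <= X} by move=> g gd; rewrite mem_undup !mem_cat gd orbT.
have eX : {subset dom (c + d) <= X}.
  by move=> g ge; rewrite mem_undup !mem_cat ge !orbT.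
apply: bounded_eq_trans (cleared_power_sup N UX eX) _.
apply: (bounded_eq_trans _ (bounded_eq_sym
  (bounded_eqM (cleared_power_sup N UX cX) (cleared_power_sup N UX dX)))).
apply: (bounded_eq_trans _ (@bounded_eq_prodM _ _ X
  (fun g n => expgz g (Num.floor (N%:R * coeff g c)) ^+ n)%g
  (fun g n => expgz g (Num.floor (N%:R * coeff g d)) ^+ n)%g)).
apply: bounded_eq_prod => g _; apply: eq_bounded_eq => n.
by rewrite coeffD mulrDr floorD_int // -!expgzMn mulrDl expgzD.
Qed.

Lemma cleared_powerU (a : R) g N :
  bounded_eq (cleared_power << a *g g >> N)
    (fun n => expgz g (Num.floor (N%:R * a)) ^+ n)%g.
Proof.
apply: (bounded_eq_trans (@cleared_power_sup _ N [:: g] _ _)) => //.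
  by move=> h; rewrite mem_dom coeffU inE (eq_sym h); have [//|_] := eqVneq g h; rewrite mulr0 eqxx.
by apply: eq_bounded_eq => n; rewrite big_seq1 coeffU eqxx mulr1.
Qed.

Lemma clears_intM N M c : clears_int N c -> clears_int (M * N) c.
Proof. by move=> I g; rewrite natrM -mulrA rpredM // natr_int. Qed.

Lemma cleared_powerM c N M n : clears_int N c ->
  cleared_power c (M * N) n = cleared_power c N (M * n)%N.
Proof.
move=> I; rewrite !cleared_powerE; apply: eq_bigr => g _.
have -> : Num.floor ((M * N)%:R * coeff g c) = Num.floor (N%:R * coeff g c) * M%:Z.
  by rewrite natrM -mulrA -{1}(floorK (I g)) mulrC -(intrM _ _ M%:Z) intrKfloor.
by rewrite expgzMn expgnA.
Qed.

Lemma clears_intD N c d : clears_int N c -> clears_int N d -> clears_int N (c + d).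
Proof. by move=> Ic Id g; rewrite coeffD mulrDr rpredD. Qed.

Lemma clears_intN N c : clears_int N c -> clears_int N (- c).
Proof. by move=> Ic g; rewrite coeffN mulrN rpredN. Qed.

Lemma clears_int0 N : clears_int N 0.
Proof. by move=> g; rewrite coeff0 mulr0 rpred0. Qed.

Lemma cleared_power_zero N n : cleared_power 0 N n = 1%g.
Proof. by rewrite cleared_powerE dom0 big_nil. Qed.

Lemma cleared_powerN c N : clears_int N c ->
  bounded_eq (cleared_power (- c) N) (fun n => (cleared_power c N n)^-1)%g.
Proof.
move=> I; have := cleared_powerD (clears_intN I) I; rewrite addNr => H.
have {H} H := bounded_eqM (bounded_eq_sym H)
  (bounded_eq_refl (fun n => (cleared_power c N n)^-1)%g).
apply: (bounded_eq_trans (bounded_eq_trans _ H)).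
  by apply: eq_bounded_eq => n; rewrite mulgK.
by apply: eq_bounded_eq => n; rewrite cleared_power_zero mul1g.
Qed.

End ChainPowers.

(** * Growth rates of commutator length *)

Section StableLimits.
Variables (R : realType) (G : groupType).
Implicit Types (x y : nat -> G) (v u : R).

Definition cl_limit x v := (fun n => (cl (x n))%:R / n%:R : R) @ \oo --> v.

Lemma cl_limit_unique x u v : cl_limit x u -> cl_limit x v -> u = v.
Proof. exact: cvg_unique. Qed.

Lemma cl_limit_ex x : quasi_power x -> (forall n, derived (x n)) ->
  exists v, cl_limit x v.
Proof.
move=> [K H] dx; pose a n := cl (x n).
exists (lim ((fun n => (a n)%:R / n%:R : R) @ \oo)).
apply: (@fekete R a K) => n m; apply: cl_leq.
rewrite -[x (n + m)%N](mulgVK (x n * x m)%g) addnC.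
by apply: commutator_productM => //; apply: commutator_productM; apply: cl_spec.
Qed.

Lemma cvg_div_bounded (a b : nat -> nat) K v :
  (forall n, (a n <= b n + K)%N /\ (b n <= a n + K)%N) ->
  (fun n => (a n)%:R / n%:R : R) @ \oo --> v ->
  (fun n => (b n)%:R / n%:R : R) @ \oo --> v.
Proof.
move=> H /cvgrPdist_lt av; apply/cvgrPdist_lt => e e0.
have e2 : 0 < e / 2 by rewrite divr_gt0.
near=> n.
have n0 : 0 < n%:R :> R by rewrite ltr0n; near: n; exists 1%N.
have Ke : K%:R / n%:R < e / 2 :> R by near: n; apply: invn_lt_near.
have ave : `|v - (a n)%:R / n%:R| < e / 2 by near: n; apply: av.
have ab : `|(a n)%:R / n%:R - (b n)%:R / n%:R| <= K%:R / n%:R :> R.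
  rewrite -mulrBl normrM (ger0_norm (x := n%:R^-1)) ?invr_ge0 ?ler0n //.
  rewrite ler_pM2r ?invr_gt0 //.
  have [h1 h2] := H n; rewrite ler_norml; apply/andP; split.
    by rewrite lerNl opprB lerBlDl -natrD ler_nat.
  by rewrite lerBlDl -natrD ler_nat.
have -> : v - (b n)%:R / n%:R = (v - (a n)%:R / n%:R) + ((a n)%:R / n%:R - (b n)%:R / n%:R).
  by rewrite addrA subrK.
by apply: le_lt_trans (ler_normD _ _) _; rewrite [ltRHS](splitr e) ltr_leD // ltW //
  (le_lt_trans ab).
Unshelve. all: by end_near.
Qed.

Lemma cl_limit_bounded_eq x y v : bounded_eq x y -> (forall n, derived (x n)) ->
  cl_limit x v -> cl_limit y v.
Proof.
by move=> xy dx; have [K H] := bounded_eq_cl xy dx; apply: cvg_div_bounded H.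
Qed.

Lemma cl_limit_comp x v M : (0 < M)%N -> cl_limit x v ->
  cl_limit (fun n => x (M * n)%N) (M%:R * v).
Proof.
move=> M0 xv.
rewrite /cl_limit.
have -> : (fun n => (cl (x (M * n)%N))%:R / n%:R : R) =
    (fun n => M%:R * ((cl (x (M * n)%N))%:R / (M * n)%:R)).
  apply/funext => n.
  by rewrite natrM invfM mulrCA [M%:R * _]mulrA divff ?mul1r // pnatr_eq0 -lt0n.
apply: cvgMr.
apply: (cvg_comp (fun n => (M * n)%N) (fun n => (cl (x n))%:R / n%:R : R) _ xv).
move=> A [N _ NA]; exists N => // n /= Nn; apply: NA => /=.
by apply: leq_trans Nn _; rewrite leq_pmull.
Qed.

Lemma cl_limit_ge0 x v : cl_limit x v -> 0 <= v.
Proof.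
move=> xv; rewrite -(cvg_lim (@Rhausdorff R) xv); apply: limr_ge.
  exact: cvgP xv.
by apply: nearW => n; rewrite divr_ge0.
Qed.

Lemma cl_limitM x y u v w : (forall n, derived (x n)) -> (forall n, derived (y n)) ->
  cl_limit x u -> cl_limit y v -> cl_limit (fun n => x n * y n)%g w -> w <= u + v.
Proof.
move=> dx dy xu yv xyw.
apply: (ler_cvg_to xyw (cvgD xu yv)); apply: nearW => n /=.
apply: (@le_trans _ _ (((cl (x n))%:R + (cl (y n))%:R) / n%:R)); last by rewrite mulrDl.
rewrite ler_wpM2r ?invr_ge0 // -natrD ler_nat; apply: cl_leq.
by apply: commutator_productM; apply: cl_spec.
Qed.

Lemma cl_limitV x v : cl_limit x v -> cl_limit (fun n => (x n)^-1)%g v.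
Proof.
have clV g : cl (g^-1)%g = cl g.
  rewrite /cl; congr least; apply/funext => n; apply/propext.
  by split=> /commutator_productV; rewrite ?invgK.
by rewrite /cl_limit; under eq_fun do rewrite -clV.
Qed.

End StableLimits.

(** * Stable commutator length of rational chains *)

Section SclRational.
Variables (R : realType) (G : groupType).
Local Notation chain := {freeg G / R}.
Implicit Types (g h : G) (c d : chain) (N M n : nat).

Lemma prod_close (I : Type) (r : seq I) (F F' : I -> G) :
  (forall i, commutator_product 1 (F i * (F' i)^-1)%g) ->
  commutator_product (size r) ((\prod_(i <- r) F i) * (\prod_(i <- r) F' i)^-1)%g.
Proof.
move=> H; elim: r => [|i r IH].
  by rewrite !big_nil mulgV; apply/commutator_product0.
rewrite !big_cons /= -addn1.
have -> : (F i * (\prod_(j <- r) F j) * (F' i * \prod_(j <- r) F' j)^-1 =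
    ((\prod_(j <- r) F j) * (\prod_(j <- r) F' j)^-1) ^ (F i)^-1 *
    (F i * (F' i)^-1))%g.
  by rewrite /conjg invgK invgM !mulgA mulgVK.
by apply: commutator_productM => //; apply: commutator_productJ.
Qed.

(** Conjugating each factor changes the product by at most [size t] commutators. For the powers of a
    fixed chain this bound is constant, so the minimization over conjugators leaves no trace in the
    limit. *)
Lemma cl_sum_bound (t : seq G) : derived (\prod_(g <- t) g)%g ->
  (cl_sum t <= cl (\prod_(g <- t) g)%g + size t)%N /\
  (cl (\prod_(g <- t) g)%g <= cl_sum t + size t)%N.
Proof.
move=> dt.
pose P n := exists h : 'I_(size t) -> G,
    n = cl (\prod_(i < size t) (h i * nth 1%g t i * (h i)^-1))%g.
have [[h hE] _] := @least_spec P _ (ex_intro _ (fun=> 1%g) erefl).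
rewrite -/(cl_sum t) in hE.
have tE : (\prod_(g <- t) g = \prod_(i < size t) nth 1 t i)%g.
  by rewrite (big_nth 1%g) big_mkord.
have sz : size (index_enum 'I_(size t)) = size t.
  by rewrite [index_enum _]unlock -enumT size_enum_ord.
have close : commutator_product (size t)
    ((\prod_(i < size t) (h i * nth 1 t i * (h i)^-1)) * (\prod_(g <- t) g)^-1)%g.
  rewrite tE -{1}sz; apply: prod_close => i.
  have -> : (h i * nth 1 t i * (h i)^-1 * (nth 1 t i)^-1 =
      [~ (h i)^-1, (nth 1 t i)^-1])%g by rewrite (commgCV (h i)) -!mulgA mulVKg mulgV mulg1.
  exact: commutator_product1.
have dh : derived (\prod_(i < size t) (h i * nth 1 t i * (h i)^-1))%g.
  rewrite -[X in derived X](mulgVK (\prod_(g <- t) g)%g); apply: derivedM => //.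
  by exists (size t).
rewrite hE; split; apply: cl_leq.
  rewrite -[X in commutator_product _ X](mulgVK (\prod_(g <- t) g)%g) addnC.
  by apply: commutator_productM => //; apply: cl_spec.
rewrite -[X in commutator_product _ X](mulgVK
  (\prod_(i < size t) (h i * nth 1 t i * (h i)^-1))%g) addnC.
apply: commutator_productM; last exact: cl_spec.
by rewrite -[X in commutator_product _ X]invgK; apply: commutator_productV; rewrite invgM invgK.
Qed.

Lemma cleared_power1 c N : cleared_power c N 1 = (\prod_(g <- cleared N c) g)%g.
Proof. by apply: eq_bigr => g _; rewrite expg1. Qed.

Lemma clears_derived c N n : clears c N -> derived (cleared_power c N n).
Proof.
move=> [_ _ d]; apply: quasi_power_derived; first exact: quasi_cleared_power.
  exact: cleared_power0.
by rewrite cleared_power1.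
Qed.

Lemma clearsM c N M : (0 < M)%N -> clears c N -> clears c (M * N).
Proof.
move=> M0 cN; have [N0 I d] := cN; split; first by rewrite muln_gt0 M0.
  exact: clears_intM.
rewrite -cleared_power1 cleared_powerM // muln1; exact: clears_derived.
Qed.

Lemma scl_sumP c N : clears c N ->
  cl_limit (cleared_power c N) (scl_sum R (cleared N c)).
Proof.
move=> cN; have [v Hv] := cl_limit_ex R (quasi_cleared_power c N)
  (fun n => clears_derived n cN).
suff -> : scl_sum R (cleared N c) = v by [].
apply: cvg_lim => //.
apply: (cvg_div_bounded (K := size (cleared N c)) _ Hv) => n.
have E : cleared_power c N n = (\prod_(g <- [seq g ^+ n | g <- cleared N c]) g)%g.
  by rewrite big_map.
have := @cl_sum_bound [seq (g ^+ n)%g | g <- cleared N c].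
rewrite -E size_map => H; have [h1 h2] := H (clears_derived n cN).
by split.
Qed.

(** Removes the dependence on the least clearing integer [N0]: the sequences for [N] and [N0] have a
    common subsequence, the one for [N * N0]. *)
Lemma scl_rationalP c N : clears c N ->
  cl_limit (cleared_power c N) (N%:R * scl_rational c).
Proof.
move=> cN; have [cN0 _] := @least_spec (clears c) N cN.
rewrite /scl_rational; set N0 := least (clears c) in cN0 *.
have [N_gt0 I _] := cN; have [N0_gt0 I0 _] := cN0.
have P := scl_sumP cN; have P0 := scl_sumP cN0.
set v := scl_sum R (cleared N c) in P; set v0 := scl_sum R (cleared N0 c) in P0 *.
have := cl_limit_comp N0_gt0 P; have := cl_limit_comp N_gt0 P0.
have -> : (fun n => cleared_power c N0 (N * n)%N) = cleared_power c (N * N0).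
  by apply/funext => n; rewrite cleared_powerM.
have -> : (fun n => cleared_power c N (N0 * n)%N) = cleared_power c (N * N0).
  by apply/funext => n; rewrite [(N * N0)%N]mulnC cleared_powerM.
move=> h1 h2; have E := cl_limit_unique h1 h2.
by rewrite mulrA E mulrAC divff ?mul1r // pnatr_eq0 -lt0n.
Qed.

Definition clearable c := exists N, clears c N.

Lemma clearsD c d N : clears c N -> clears d N -> clears (c + d) N.
Proof.
move=> cN dN; have [N0 Ic _] := cN; have [_ Id _] := dN.
split=> //; first exact: clears_intD.
rewrite -cleared_power1; apply: (bounded_eq_derived (bounded_eq_sym (cleared_powerD Ic Id))).
by move=> n; apply: derivedM; apply: clears_derived.
Qed.

Lemma clearable_common c d : clearable c -> clearable d ->
  exists N, clears c N /\ clears d N.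
Proof.
move=> [N cN] [M dM]; exists (M * N)%N; have [N0 _ _] := cN; have [M0 _ _] := dM.
by split; [apply: clearsM|rewrite mulnC; apply: clearsM].
Qed.

Lemma clearableD c d : clearable c -> clearable d -> clearable (c + d).
Proof.
by move=> cc cd; have [N [cN dN]] := clearable_common cc cd; exists N; apply: clearsD.
Qed.

Lemma clears_bounded_eq c d N : clears c N -> clears_int N d ->
  bounded_eq (cleared_power c N) (cleared_power d N) -> clears d N.
Proof.
move=> cN Id cd; have [N0 _ _] := cN; split=> //.
rewrite -cleared_power1; exact: (bounded_eq_derived cd (fun n => clears_derived n cN)).
Qed.

Lemma scl_rational_bounded_eq c d N : clears c N -> clears_int N d ->
  bounded_eq (cleared_power c N) (cleared_power d N) ->
  scl_rational c = scl_rational d.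
Proof.
move=> cN Id cd; have dN := clears_bounded_eq cN Id cd.
have h1 := cl_limit_bounded_eq cd (fun n => clears_derived n cN) (scl_rationalP cN).
have := cl_limit_unique h1 (scl_rationalP dN); apply: mulfI.
by have [N0 _ _] := cN; rewrite pnatr_eq0 -lt0n.
Qed.

Lemma scl_rational_ge0 c : clearable c -> 0 <= scl_rational c.
Proof.
case=> N cN; have [N0 _ _] := cN.
by have := cl_limit_ge0 (scl_rationalP cN); rewrite pmulr_rge0 // ltr0n.
Qed.

Lemma scl_rationalD c d : clearable c -> clearable d ->
  scl_rational (c + d) <= scl_rational c + scl_rational d.
Proof.
move=> cc cd; have [N [cN dN]] := clearable_common cc cd.
have [N0 Ic _] := cN; have [_ Id _] := dN.
have h := cl_limit_bounded_eq (cleared_powerD Ic Id)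
  (fun n => clears_derived n (clearsD cN dN)) (scl_rationalP (clearsD cN dN)).
have := cl_limitM (fun n => clears_derived n cN) (fun n => clears_derived n dN)
  (scl_rationalP cN) (scl_rationalP dN) h.
by rewrite -mulrDr ler_pM2l // ltr0n.
Qed.

Lemma clearsN c N : clears c N -> clears (- c) N.
Proof.
move=> cN; have [N0 I _] := cN; split=> //; first exact: clears_intN.
rewrite -cleared_power1; apply: (bounded_eq_derived (bounded_eq_sym (cleared_powerN I))).
by move=> n; apply: derivedV; apply: clears_derived.
Qed.

Lemma clearableN c : clearable c -> clearable (- c).
Proof. by case=> N /clearsN; exists N. Qed.

Lemma scl_rationalN c : clearable c -> scl_rational (- c) = scl_rational c.
Proof.
case=> N cN; have [N0 I _] := cN.
have h1 := cl_limitV (scl_rationalP cN).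
have := cl_limit_bounded_eq (cleared_powerN I) (fun n => clears_derived n (clearsN cN))
  (scl_rationalP (clearsN cN)).
move=> h2; have := cl_limit_unique h2 h1; apply: mulfI.
by rewrite pnatr_eq0 -lt0n.
Qed.

Lemma clears0 : clears (0 : chain) 1.
Proof.
split=> //; first exact: clears_int0.
by rewrite /cleared dom0 big_nil; exists 0%N; apply/commutator_product0.
Qed.

Lemma clears_scale c N (u v : nat) : (0 < v)%N -> clears c N ->
  clears ((u%:R / v%:R) *: c) (v * N) /\
  bounded_eq (cleared_power ((u%:R / v%:R) *: c) (v * N))
    (fun n => cleared_power c N (u * n)%N).
Proof.
move=> v0 cN; have [N0 I _] := cN.
have E g : (v * N)%:R * coeff g ((u%:R / v%:R) *: c) = u%:R * (N%:R * coeff g c).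
  rewrite coeffZ natrM; field; by rewrite pnatr_eq0 -lt0n.
have J : clears_int (v * N) ((u%:R / v%:R) *: c).
  by move=> g; rewrite E rpredM // natr_int.
have P : bounded_eq (cleared_power ((u%:R / v%:R) *: c) (v * N))
    (fun n => cleared_power c N (u * n)%N).
  apply: bounded_eq_trans (@cleared_power_sup _ _ _ (v * N) (dom c) (uniq_dom c) _) _.
    by move=> g; rewrite !mem_dom coeffZ; apply: contraNneq => ->; rewrite mulr0.
  apply: eq_bounded_eq => n; rewrite cleared_powerE; apply: eq_bigr => g _.
  rewrite E -[u%:R * _]/(u%:~R * _) -{1}(floorK (I g)) -intrM intrKfloor mulrC.
  by rewrite expgzMn expgnA.
split=> //; split=> //; first by rewrite muln_gt0 v0.
rewrite -cleared_power1; apply: (bounded_eq_derived (bounded_eq_sym P)) => n.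
exact: clears_derived.
Qed.

Lemma rat_fraction (a : rat) : 0 <= a ->
  exists u v : nat, (0 < v)%N /\ ratr a = u%:R / v%:R :> R.
Proof.
move=> a0; exists `|numq a|%N, `|denq a|%N; split.
  by rewrite absz_gt0 denq_neq0.
have E (z : int) : 0 <= z -> z%:~R = `|z|%N%:R :> R by case: z.
by rewrite /ratr !E ?numq_ge0 ?denq_ge0.
Qed.

Lemma scl_rational0 : scl_rational (0 : chain) = 0.
Proof.
have := scl_rationalP clears0; rewrite mul1r => h; apply: cl_limit_unique h _.
rewrite /cl_limit; have -> : (fun n => (cl (cleared_power (0 : chain) 1 n))%:R / n%:R : R) =
    (fun=> 0).
  apply/funext => n; rewrite cleared_power_zero.
  have /cl_leq : commutator_product 0 (1%g : G) by apply/commutator_product0.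
  by rewrite leqn0 => /eqP ->; rewrite mul0r.
exact: cvg_cst.
Qed.

Lemma scl_rationalZ_ge0 c (a : rat) : 0 <= a -> clearable c ->
  clearable (ratr a *: c) /\ scl_rational (ratr a *: c) = ratr a * scl_rational c.
Proof.
move=> /rat_fraction[[|u] [v [v0 ->]]] cc.
  by rewrite !mul0r scale0r; split; [exists 1%N; exact: clears0|exact: scl_rational0].
have [N cN] := cc; have [cN' E] := clears_scale u.+1 v0 cN.
split; first by exists (v * N)%N.
have [N0 _ _] := cN.
have h1 := cl_limit_comp (ltn0Sn u) (scl_rationalP cN).
have h2 := cl_limit_bounded_eq E (fun n => clears_derived n cN') (scl_rationalP cN').
have /(congr1 (fun x => (v * N)%:R^-1 * x)) := cl_limit_unique h2 h1.
rewrite mulKf ?pnatr_eq0 -?lt0n ?muln_gt0 ?v0 // => ->.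
by rewrite natrM; field; rewrite !pnatr_eq0 -!lt0n v0.
Qed.

Lemma scl_rationalZ c (a : rat) : clearable c ->
  clearable (ratr a *: c) /\ scl_rational (ratr a *: c) = `|ratr a| * scl_rational c.
Proof.
move=> cc; have [a0|a0] := leP 0 a.
  by rewrite ger0_norm ?ler0q //; apply: scl_rationalZ_ge0.
have na0 : 0 <= - a by rewrite oppr_ge0 ltW.
have [c1 e1] := scl_rationalZ_ge0 na0 cc.
have -> : ratr a *: c = - (ratr (- a) *: c) by rewrite raddfN /= scaleNr opprK.
split; first exact: clearableN.
by rewrite scl_rationalN // e1 raddfN /= ltr0_norm // ltrq0.
Qed.

Lemma freegZU (b q : R) g : b *: << q *g g >> = << b * q *g g >>.
Proof. by apply/eqP/freeg_eqP => h; rewrite coeffZ !coeffU mulrA. Qed.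

Lemma clears_intU N (a : R) g : N%:R * a \is a Num.int -> clears_int N << a *g g >>.
Proof. by move=> Ia h; rewrite coeffU mulrA rpredM // natr_int. Qed.

Lemma cleared_power_sum N (r : seq (R * G)) :
  (forall p, p \in r -> N%:R * p.1 \is a Num.int) ->
  clears_int N (\sum_(p <- r) << p.1 *g p.2 >>) /\
  bounded_eq (cleared_power (\sum_(p <- r) << p.1 *g p.2 >>) N)
    (fun n => \prod_(p <- r) expgz p.2 (Num.floor (N%:R * p.1)) ^+ n)%g.
Proof.
elim: r => [|p r IH] H.
  rewrite big_nil; split; first exact: clears_int0.
  by apply: eq_bounded_eq => n; rewrite cleared_power_zero big_nil.
have Ip := H p (mem_head _ _).
have [I E] := IH (fun q qr => H q (mem_behead (s := p :: r) qr)).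
rewrite big_cons; split; first by apply: clears_intD => //; exact: clears_intU.
apply: bounded_eq_trans (cleared_powerD (clears_intU p.2 Ip) I) _.
apply: bounded_eq_trans (bounded_eqM (cleared_powerU p.1 p.2 N) E) _.
by apply: eq_bounded_eq => n; rewrite big_cons.
Qed.

(** For a power relator the exponents of [g] cancel exactly; for a conjugation relator they cancel
    after removing a conjugation, which costs a bounded number of commutators. *)
Lemma cleared_power_relator N (a : R) (r : chain) : N%:R * a \is a Num.int ->
  homogeneity_relator r ->
  clears_int N (a *: r) /\ bounded_eq (cleared_power (a *: r) N) (fun=> 1%g).
Proof.
move=> Ia.
have two g h (b : R) : N%:R * b \is a Num.int ->
    clears_int N (<< a *g h >> - << b *g g >>) /\
    bounded_eq (cleared_power (<< a *g h >> - << b *g g >>) N)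
      (fun n => expgz h (Num.floor (N%:R * a)) ^+ n *
                expgz g (- Num.floor (N%:R * b)) ^+ n)%g.
  move=> Ib; have := @cleared_power_sum N [:: (a, h); (- b, g)].
  rewrite !big_cons big_nil /= addr0 -freegUN => C.
  have [] := C => [p|I B].
    by rewrite !inE => /orP[/eqP->|/eqP->] //=; rewrite mulrN rpredN.
  split=> //; apply: bounded_eq_trans B _; apply: eq_bounded_eq => n.
  rewrite !big_cons big_nil /= mulg1 mulrN -{1}(floorK Ib) -mulrNz intrKfloor.
  by [].
case=> [[g [m ->]]|[g [h ->]]]; rewrite scalerBr ?scalerA !freegZU !mulr1.
  have Iam : N%:R * (a * m%:~R) \is a Num.int.
    by rewrite mulrA rpredM // intr_int.
  have [I B] := two g (expgz g m) _ Iam; split=> //.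
  apply: bounded_eq_trans B _; apply: eq_bounded_eq => n.
  have -> : Num.floor (N%:R * (a * m%:~R)) = Num.floor (N%:R * a) * m.
    by rewrite mulrA -{1}(floorK Ia) -intrM intrKfloor.
  by rewrite -expgzM (mulrC m) -!expgzMn -expgzD -mulrDl addrN mul0r.
have [I B] := two (h * g * h^-1)%g g _ Ia; split=> //.
apply: bounded_eq_trans B _; set z := Num.floor _.
apply: (bounded_eq_trans (y := fun n => expgz g z ^+ n * (expgz g z ^+ n)^-1)%g); last first.
  by apply: eq_bounded_eq => n; rewrite mulgV.
apply: bounded_eqM; first exact: bounded_eq_refl.
apply: (bounded_eq_trans _ (bounded_eqJ (fun n => (expgz g z ^+ n)^-1)%g h)).
by apply: eq_bounded_eq => n; rewrite -expgzMn expgz_conj mulNr expgzN expgzMn.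
Qed.

Lemma scl_rational_relator c (a : rat) (r : chain) : clearable c ->
  homogeneity_relator r ->
  clearable (c + ratr a *: r) /\ scl_rational (c + ratr a *: r) = scl_rational c.
Proof.
move=> [N cN] hr; pose v := `|denq a|%N.
have v0 : (0 < v)%N by rewrite absz_gt0 denq_neq0.
have cN' := clearsM v0 cN; have [_ I _] := cN'.
have Ia : (v * N)%:R * ratr a \is a @Num.int R.
  have -> : (v * N)%:R * ratr a = N%:R * (numq a)%:~R :> R.
    rewrite natrM /ratr.
    have -> : v%:R = (denq a)%:~R :> R by rewrite /v; case: (denq a) (denq_gt0 a).
    by field; rewrite intr_eq0 denq_neq0.
  by rewrite rpredM ?natr_int ?intr_int.
have [J B] := cleared_power_relator Ia hr.
have cE : bounded_eq (cleared_power c (v * N)) (cleared_power (c + ratr a *: r) (v * N)).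
  apply: bounded_eq_sym; apply: bounded_eq_trans (cleared_powerD I J) _.
  apply: bounded_eq_trans (bounded_eqM (bounded_eq_refl _) B) _.
  by apply: eq_bounded_eq => n; rewrite mulg1.
have K := clears_intD I J.
split; first by exists (v * N)%N; apply: clears_bounded_eq cE.
by rewrite (scl_rational_bounded_eq cN' K cE).
Qed.

Lemma scl_rational_relators c (s : seq (rat * chain)) : clearable c ->
  (forall p, p \in s -> homogeneity_relator p.2) ->
  clearable (c + \sum_(p <- s) ratr p.1 *: p.2) /\
  scl_rational (c + \sum_(p <- s) ratr p.1 *: p.2) = scl_rational c.
Proof.
elim: s c => [|p s IH] c cc H; first by rewrite big_nil addr0.
have [c1 e1] := scl_rational_relator p.1 cc (H p (mem_head _ _)).
by rewrite big_cons addrA -e1; apply: IH => // q qs; apply: H; rewrite inE qs orbT.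
Qed.

End SclRational.

Section SclMorphism.
Variables (R : realType) (G K : groupType) (phi : {multiplicative G -> K}).
Hypothesis cl_phi : forall g, derived g -> cl (phi g) = cl g.

Lemma scl_rational_morph (c : {freeg G / R}) : clearable c ->
  clearable (chain_map phi c) /\ scl_rational (chain_map phi c) = scl_rational c.
Proof.
move=> [N cN]; have [N0 I _] := cN.
(* The sum runs over the support of [c] and not of its image, since [phi] may identify elements of
   the support. *)
have E : chain_map phi c =
    \sum_(p <- [seq (coeff g c, phi g) | g <- dom c]) << p.1 *g p.2 >>.
  rewrite big_map -{1}[c]freeg_sumE raddf_sum; apply: eq_bigr => g _.
  by rewrite /= chain_mapU.
have [J B] : clears_int N (chain_map phi c) /\ bounded_eq (cleared_power (chain_map phi c) N)
    (fun n => \prod_(p <- [seq (coeff g c, phi g) | g <- dom c])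
       expgz p.2 (Num.floor (N%:R * p.1)) ^+ n)%g.
  rewrite E; apply: cleared_power_sum => p /mapP[g _ ->]; exact: I.
have {}B : bounded_eq (fun n => phi (cleared_power c N n)) (cleared_power (chain_map phi c) N).
  apply: bounded_eq_sym; apply: bounded_eq_trans B _; apply: eq_bounded_eq => n.
  rewrite big_map cleared_powerE; elim: (dom c) => [|g r IH].
    by rewrite !big_nil Defs.morph1.
  by rewrite !big_cons gmulfM IH Defs.morphX expgz_morph.
have dphi n : derived (phi (cleared_power c N n)) by apply/derived_morph/clears_derived.
have cN' : clears (chain_map phi c) N.
  by split=> //; rewrite -cleared_power1; apply: (bounded_eq_derived B).
split; first by exists N.
have h : cl_limit (fun n => phi (cleared_power c N n)) (N%:R * scl_rational c).
  rewrite /cl_limit.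
  have -> : (fun n => (cl (phi (cleared_power c N n)))%:R / n%:R : R) =
      (fun n => (cl (cleared_power c N n))%:R / n%:R).
    by apply/funext => n; rewrite cl_phi //; apply: clears_derived cN.
  exact: scl_rationalP cN.
have := cl_limit_unique (scl_rationalP cN') (cl_limit_bounded_eq B dphi h).
by apply: mulfI; rewrite pnatr_eq0 -lt0n.
Qed.

End SclMorphism.

(** * Simultaneous rational approximation *)

Section RationalApproximation.
Variable R : realType.
Implicit Types (x y : R) (X w : seq R) (a : nat -> R).

Definition is_rational x := exists q : rat, x = ratr q.

Lemma rationalD x y : is_rational x -> is_rational y -> is_rational (x + y).
Proof. by case=> p -> [q ->]; exists (p + q); rewrite raddfD. Qed.

Lemma rationalM x y : is_rational x -> is_rational y -> is_rational (x * y).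
Proof. by case=> p -> [q ->]; exists (p * q); rewrite rmorphM. Qed.

Lemma rationalN x : is_rational x -> is_rational (- x).
Proof. by case=> p ->; exists (- p); rewrite raddfN. Qed.

Lemma rationalV x : is_rational x -> is_rational x^-1.
Proof. by case=> p ->; exists p^-1; rewrite fmorphV. Qed.

Lemma rational_int (z : int) : is_rational z%:~R.
Proof. by exists z%:~R; rewrite ratr_int. Qed.

Lemma rational0 : is_rational 0. Proof. exact: rational_int 0. Qed.

Lemma rational1 : is_rational 1. Proof. exact: rational_int 1. Qed.

Lemma rational_sum (I : eqType) (r : seq I) (F : I -> R) :
  (forall i, i \in r -> is_rational (F i)) -> is_rational (\sum_(i <- r) F i).
Proof.
move=> H; rewrite big_seq; elim/big_ind: _ => //; first exact: rational0.
exact: rationalD.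
Qed.

Definition comb w a := \sum_(s < size w) a s * w`_s.

Lemma comb_cons x w a : comb (x :: w) a = a 0%N * x + comb w (a \o succn).
Proof. by rewrite /comb big_ord_recl. Qed.

Definition rational_fun a := forall s, is_rational (a s).

Definition rational_free w :=
  forall a, rational_fun a -> comb w a = 0 -> forall s, (s < size w)%N -> a s = 0.

(** A basis over the rationals of the space spanned by [X], built by keeping an element only if it
    is independent of those already kept. *)
Lemma rational_basis X : exists w, rational_free w /\
  forall x, x \in X -> exists a, rational_fun a /\ x = comb w a.
Proof.
elim: X => [|x X [w [wF wX]]]; first by exists [::].
have [[a [ra xE]]|N] := pselect (exists a, rational_fun a /\ x = comb w a).
  exists w; split=> // y; rewrite inE => /orP[/eqP->|/wX //]; by exists a.
exists (x :: w); split.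
  move=> a ra; rewrite comb_cons => H.
  have a0 : a 0%N = 0.
    apply: contrapT => /eqP a0; apply: N; exists (fun s => - (a 0%N)^-1 * a s.+1); split.
      by move=> s; apply: rationalM => //; apply/rationalN/rationalV.
    have -> : comb w (fun s => - (a 0%N)^-1 * a s.+1) = - (a 0%N)^-1 * comb w (a \o succn).
      by rewrite /comb mulr_sumr; apply: eq_bigr => s _; rewrite /= mulrA.
    have -> : comb w (a \o succn) = - (a 0%N * x) by apply/eqP; rewrite -addr_eq0 addrC H.
    by rewrite mulrNN mulKf.
  move: H; rewrite a0 mul0r add0r => /wF H [|s] //= sw.
  by apply: (H _ s sw) => t; apply: ra.
move=> y; rewrite inE => /orP[/eqP->|/wX[a [ra ->]]].
  exists (fun s => (s == 0%N)%:R); split=> [s|].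
    by case: (s == 0%N); [exact: rational1|exact: rational0].
  rewrite comb_cons mul1r /comb big1 ?addr0 // => s _; by rewrite /= mul0r.
exists (fun s => if s is s'.+1 then a s' else 0); split=> [[|s]|]; rewrite ?comb_cons //.
  exact: rational0.
by rewrite mul0r add0r.
Qed.

(* Moving a basis over the rationals to a nearby rational vector gives a
   rational approximation that preserves all rational linear relations. *)
Lemma rational_approximation X (e : R) : 0 < e -> exists theta : R -> R,
  [/\ forall x, is_rational (theta x), forall x, x \in X -> `|theta x - x| < e &
    forall s : seq (R * R), (forall p, p \in s -> p.1 \in X /\ is_rational p.2) ->
      \sum_(p <- s) p.1 * p.2 = 0 -> \sum_(p <- s) theta p.1 * p.2 = 0].
Proof.
move=> e0; have [w [wF wX]] := rational_basis X.
have /choice[co coP] : forall x, exists a, rational_fun a /\ (x \in X -> x = comb w a).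
  move=> x; have [/wX[a [ra xE]]|nx] := boolP (x \in X); first by exists a.
  by exists (fun=> 0); split=> // s; exact: rational0.
(* [D] dominates the total size of the coordinates of each [x] in [X], so moving the basis by less
   than [e / (1 + D)] moves [x] by less than [e]. The 1 keeps the denominator positive. *)
pose D := \sum_(x <- X) \sum_(s < size w) `|co x s|.
have D0 : 0 <= D by apply: sumr_ge0 => x _; apply: sumr_ge0.
have d0 : 0 < e / (1 + D) by rewrite divr_gt0 // ltr_wpDr.
have /choice[w' w'P] : forall s : nat, exists y, is_rational y /\ `|y - w`_s| < e / (1 + D).
  move=> s; have [q] := rat_in_itvoo (ltr_pwDr d0 (lexx w`_s)).
  rewrite in_itv /= => /andP[h1 h2]; exists (ratr q); split; first by exists q.
  by rewrite gtr0_norm ?subr_gt0 // ltrBlDl.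
pose theta x := \sum_(s < size w) co x s * w' s.
exists theta; split.
- move=> x; apply: rational_sum => s _; apply: rationalM; last by have [] := w'P s.
  by have [] := coP x.
- move=> x xX; have [_ /(_ xX) xE] := coP x; rewrite {2}xE /theta /comb -sumrB.
  apply: (@le_lt_trans _ _ (D * (e / (1 + D)))); last first.
    by rewrite mulrA ltr_pdivrMr ?ltr_wpDr // mulrC ltr_pM2l // ltrDr.
  apply: (@le_trans _ _ (\sum_(s < size w) `|co x s| * (e / (1 + D)))).
    apply: le_trans (ler_norm_sum _ _ _) _; apply: ler_sum => s _.
    rewrite -mulrBr normrM ler_wpM2l //; apply: ltW; by have [] := w'P s.
  rewrite -mulr_suml ler_wpM2r ?(ltW d0) // /D (big_rem x) //= lerDl.
  by apply: sumr_ge0 => y _; apply: sumr_ge0.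
move=> s sX H.
(* Independence of the basis splits a rational relation into one relation for each coordinate, and
   these do not involve the values of the basis. *)
have Z t : (t < size w)%N -> \sum_(p <- s) co p.1 t * p.2 = 0.
  apply: (wF (fun t => \sum_(p <- s) co p.1 t * p.2)).
    move=> u; apply: rational_sum => p ps; apply: rationalM; last by have [] := sX p ps.
    by have [] := coP p.1.
  transitivity (\sum_(p <- s) p.1 * p.2); last exact: H.
  rewrite /comb; under eq_bigr do rewrite mulr_suml.
  rewrite exchange_big; apply: eq_big_seq => p ps /=.
  have [pX _] := sX p ps; have [_ /(_ pX) {2}->] := coP p.1.
  by rewrite /comb mulr_suml; apply: eq_bigr => u _; rewrite mulrAC.
rewrite /theta; under eq_bigr do rewrite mulr_suml.
rewrite exchange_big big1 // => u _ /=.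
transitivity ((\sum_(p <- s) co p.1 u * p.2) * w' u); last by rewrite Z ?mul0r.
by rewrite mulr_suml; apply: eq_bigr => p _; rewrite mulrAC.
Qed.

End RationalApproximation.

Section RationalChains.
Variables (R : realType) (G : groupType).
Local Notation chain := {freeg G / R}.
Implicit Types (g h : G) (c d : chain) (X : seq R).

Definition rational_chain c := forall g, is_rational (coeff g c).

Lemma rational_chainU (a : R) g : is_rational a -> rational_chain << a *g g >>.
Proof.
move=> ra h; rewrite coeffU; apply: rationalM => //.
by case: (g == h); [exact: rational1|exact: rational0].
Qed.

Lemma rational_chain1 g : rational_chain << g >>.
Proof. exact/rational_chainU/rational1. Qed.

Lemma rational_chainD c d : rational_chain c -> rational_chain d -> rational_chain (c + d).
Proof. by move=> rc rd g; rewrite coeffD; apply: rationalD. Qed.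

Lemma rational_chainN c : rational_chain c -> rational_chain (- c).
Proof. by move=> rc g; rewrite coeffN; apply: rationalN. Qed.

Lemma rational_chainZ (a : R) c : is_rational a -> rational_chain c -> rational_chain (a *: c).
Proof. by move=> ra rc g; rewrite coeffZ; apply: rationalM. Qed.

Lemma bar_relator_rational c : bar_relator c -> rational_chain c.
Proof.
case=> g [h ->]; apply: rational_chainD; last exact/rational_chainN/rational_chain1.
by apply: rational_chainD; exact: rational_chain1.
Qed.

Lemma homogeneity_relator_rational c : homogeneity_relator c -> rational_chain c.
Proof.
case=> [[g [n ->]]|[g [h ->]]]; apply: rational_chainD; try exact: rational_chain1.
  by apply/rational_chainN/rational_chainZ; [exact: rational_int|exact: rational_chain1].
exact/rational_chainN/rational_chain1.
Qed.

Lemma chain_relation X (theta : R -> R) (s : seq (R * chain)) :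
  (forall s : seq (R * R), (forall p, p \in s -> p.1 \in X /\ is_rational p.2) ->
      \sum_(p <- s) p.1 * p.2 = 0 -> \sum_(p <- s) theta p.1 * p.2 = 0) ->
  (forall p, p \in s -> p.1 \in X /\ rational_chain p.2) ->
  \sum_(p <- s) p.1 *: p.2 = 0 -> \sum_(p <- s) theta p.1 *: p.2 = 0.
Proof.
move=> H sX s0; apply/eqP/freeg_eqP => g; rewrite coeff0.
have cE (f : R * chain -> R) : coeff g (\sum_(p <- s) f p *: p.2) =
    \sum_(p <- s) f p * coeff g p.2.
  by rewrite raddf_sum; apply: eq_bigr => p _; rewrite /= coeffZ.
have := H [seq (p.1, coeff g p.2) | p <- s].
rewrite !big_map cE; apply=> [p /mapP[q /sX[qX rq] ->]|]; first by split; [|exact: rq].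
by rewrite -cE s0 coeff0.
Qed.

Lemma rational_clears c : rational_chain c -> exists2 N, (0 < N)%N & clears_int N c.
Proof.
move=> rc.
have [N N0 H] : exists2 N, (0 < N)%N & forall g, g \in dom c ->
    N%:R * coeff g c \is a Num.int.
  elim: (dom c) => [|g X [N N0 H]]; first by exists 1%N.
  have [q qE] := rc g; pose v := `|denq q|%N.
  have v0 : (0 < v)%N by rewrite absz_gt0 denq_neq0.
  have vE : v%:R = (denq q)%:~R :> R by rewrite /v; case: (denq q) (denq_gt0 q).
  exists (v * N)%N; first by rewrite muln_gt0 v0.
  move=> h; rewrite inE => /orP[/eqP->|/H Ih]; last first.
    by rewrite natrM -mulrA rpredM // natr_int.
  have -> : (v * N)%:R * coeff g c = N%:R * (numq q)%:~R :> R.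
    by rewrite qE natrM vE /ratr; field; rewrite intr_eq0 denq_neq0.
  by rewrite rpredM ?natr_int ?intr_int.
exists N => // g; have [/H //|/coeff_outdom ->] := boolP (g \in dom c).
by rewrite mulr0 rpred0.
Qed.

Lemma sum_coeff_sup c (X : seq G) : uniq X -> {subset dom c <= X} ->
  c = \sum_(g <- X) coeff g c *: << g >>.
Proof.
move=> UX cX; apply/eqP/freeg_eqP => h; rewrite raddf_sum /=.
under eq_bigr => g _ do rewrite coeffZ coeffU mul1r.
have [hX|hX] := boolP (h \in X).
  rewrite (bigD1_seq h) //= eqxx mulr1 big1 ?addr0 // => g /negPf ->.
  by rewrite mulr0.
rewrite coeff_outdom; last by apply: contra hX; apply: cX.
rewrite big1_seq // => g /andP[_ gX]; case: eqP => [e|_]; last by rewrite mulr0.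
by rewrite -e gX in hX.
Qed.

End RationalChains.

(** * Continuity on chains of a free group *)

Section FreeChains.
Variables (R : realType) (k : nat).
Local Notation chain := {freeg (free_group k) / R}.
Implicit Types (g h : free_group k) (c d : chain).

Definition chain_expsum i c : R :=
  fglift (fun g => (expsum i g)%:~R : R^o) c.

HB.instance Definition _ i := GRing.isZmodMorphism.Build chain R
  (chain_expsum i) (lift_is_additive (fun g => (expsum i g)%:~R : R^o)).

Lemma chain_expsumU i (a : R) g : chain_expsum i << a *g g >> = a * (expsum i g)%:~R.
Proof. by rewrite /chain_expsum liftU. Qed.

Lemma chain_expsumE i c :
  chain_expsum i c = \sum_(g <- dom c) coeff g c * (expsum i g)%:~R.
Proof.
rewrite -{1}[c]freeg_sumE raddf_sum; apply: eq_bigr => g _.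
exact: chain_expsumU.
Qed.

Lemma chain_expsumZ i (a : R) c : chain_expsum i (a *: c) = a * chain_expsum i c.
Proof.
rewrite -[c]freeg_sumE scaler_sumr !raddf_sum mulr_sumr; apply: eq_bigr => g _ /=.
by rewrite freegZU !chain_expsumU mulrA.
Qed.

Definition balanced c := forall i, chain_expsum i c = 0.

Lemma boundary_balanced c : boundary c -> balanced c.
Proof.
move=> /asboolP[s sS ->] i; rewrite raddf_sum big1_seq // => p /andP[_ /sS[g [h ->]]] /=.
rewrite chain_expsumZ raddfB raddfD /= !chain_expsumU !mul1r expsumM rmorphD /=.
by rewrite subrr mulr0.
Qed.

Lemma expsum1 i : expsum i (1%g : free_group k) = 0.
Proof. by apply: (addrI (expsum i 1%g)); rewrite -expsumM mulg1 addr0. Qed.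

Lemma expsumV i g : expsum i (g^-1)%g = - expsum i g.
Proof. by apply: (addIr (expsum i g)); rewrite -expsumM mulVg expsum1 addNr. Qed.

Lemma expsumX i g n : expsum i (g ^+ n)%g = expsum i g * n%:Z.
Proof.
elim: n => [|n IH]; first by rewrite expg0 expsum1 mulr0.
by rewrite expgS expsumM IH -addn1 PoszD mulrDr mulr1 addrC.
Qed.

Lemma expsum_expgz i g z : expsum i (expgz g z) = expsum i g * z.
Proof. by case: z => n /=; rewrite ?expsumV expsumX // NegzE mulrN. Qed.

(** Vanishing exponent sums put the product in the derived subgroup, by [derived_expsum]; clearing a
    balanced chain thus reduces to clearing its denominators. *)
Lemma balanced_clears c N : (0 < N)%N -> clears_int N c -> balanced c -> clears c N.
Proof.
move=> N0 I B; split=> //; apply/derived_expsum => i.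
have -> : expsum i (\prod_(g <- cleared N c) g)%g =
    \sum_(g <- dom c) expsum i g * Num.floor (N%:R * coeff g c).
  rewrite /cleared; elim: (dom c) => [|g r IH]; first by rewrite !big_nil expsum1.
  by rewrite /= !big_cons expsumM IH expsum_expgz.
apply/eqP; rewrite -(@intr_eq0 R) rmorph_sum /=; apply/eqP.
transitivity (N%:R * chain_expsum i c); last by rewrite B mulr0.
rewrite chain_expsumE mulr_sumr; apply: eq_bigr => g _.
by rewrite rmorphM /= mulrC floorK // mulrA.
Qed.

Lemma balanced_clearable c : rational_chain c -> balanced c -> clearable c.
Proof. by move=> /rational_clears[N N0 I] B; exists N; apply: balanced_clears. Qed.

(** The element [g] minus the combination of generators with the same homology class: a rational
    balanced chain, on which [scl_rational] has a value. *)
Definition balanced_part g : chain :=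
  << g >> - \sum_(i < k) (expsum i g)%:~R *: << free_gen i >>.

Lemma expsum_gen (i j : 'I_k) : expsum i (free_gen j) = (i == j)%:Z.
Proof. by rewrite /expsum /= big_mkcond big_seq1 /= eq_sym; case: eqP. Qed.

Lemma balanced_part_balanced g : balanced (balanced_part g).
Proof.
move=> i; rewrite /balanced_part raddfB raddf_sum /= chain_expsumU mul1r.
rewrite (bigD1 i) //= big1 ?addr0 => [|j /negPf ij].
  by rewrite chain_expsumZ chain_expsumU expsum_gen eqxx !mulr1 subrr.
by rewrite chain_expsumZ chain_expsumU expsum_gen eq_sym ij !mulr0.
Qed.

Lemma balanced_part_rational g : rational_chain (balanced_part g).
Proof.
apply: rational_chainD; first exact: rational_chain1.
apply: rational_chainN => h; rewrite raddf_sum; apply: rational_sum => i _ /=.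
by apply: rational_chainZ; [exact: rational_int|exact: rational_chain1].
Qed.

Lemma balanced_part_clearable g : clearable (balanced_part g).
Proof.
exact: balanced_clearable (balanced_part_rational g) (balanced_part_balanced g).
Qed.

(** The correction terms add up to the exponent sums of [c], which vanish. *)
Lemma balanced_decomposition c (X : seq (free_group k)) :
  uniq X -> {subset dom c <= X} -> balanced c ->
  c = \sum_(g <- X) coeff g c *: balanced_part g.
Proof.
move=> UX cX B; rewrite {1}(sum_coeff_sup UX cX) /balanced_part.
under [RHS]eq_bigr do rewrite scalerBr scaler_sumr.
rewrite sumrB [X in _ - X]exchange_big [X in _ - X]big1 ?subr0 // => i _.
under eq_bigr do rewrite scalerA.
rewrite -scaler_suml -[RHS](scale0r << free_gen i >>); congr (_ *: _).
transitivity (chain_expsum i c); last exact: B.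
rewrite [in RHS](sum_coeff_sup UX cX) raddf_sum; apply: eq_bigr => g _ /=.
by rewrite chain_expsumZ chain_expsumU mul1r.
Qed.

(** Subadditivity and homogeneity applied to [balanced_decomposition]. The constant depends on the
    support [X], which is why approximants of a chain are confined to its support. *)
Lemma scl_rational_lipschitz (X : seq (free_group k)) : uniq X ->
  exists2 C : R, 0 <= C & forall c (M : R), rational_chain c -> balanced c ->
    {subset dom c <= X} -> (forall g, `|coeff g c| <= M) -> scl_rational c <= C * M.
Proof.
move=> UX; exists (\sum_(g <- X) scl_rational (balanced_part g)).
  by apply: sumr_ge0 => g _; apply/scl_rational_ge0/balanced_part_clearable.
move=> c M rc B cX cM; rewrite {1}(balanced_decomposition UX cX B).
suff [_ ->] : clearable (\sum_(g <- X) coeff g c *: balanced_part g) /\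
    scl_rational (\sum_(g <- X) coeff g c *: balanced_part g) <=
    (\sum_(g <- X) scl_rational (balanced_part g)) * M by [].
elim: X {UX cX} => [|g X [IHc IH]].
  rewrite !big_nil scl_rational0 mul0r; split=> //.
  by exists 1%N; exact: clears0.
rewrite !big_cons; have [q qE] := rc g; rewrite qE.
have [c1 e1] := scl_rationalZ q (balanced_part_clearable g).
split; first exact: clearableD.
apply: le_trans (scl_rationalD c1 IHc) _; rewrite mulrDl lerD // e1 mulrC.
by rewrite ler_wpM2l ?scl_rational_ge0 -?qE ?cM //; apply: balanced_part_clearable.
Qed.

Definition approximant c (e : R) d := [/\ boundary d, rational_chain d,
  {subset dom d <= dom c} & forall g, `|coeff g d - coeff g c| < e].

Lemma balancedB c d : balanced c -> balanced d -> balanced (c - d).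
Proof. by move=> Bc Bd i; rewrite raddfB /= Bc Bd subrr. Qed.

Lemma scl_rational_close c : exists2 C : R, 0 <= C &
  forall e d d', approximant c e d -> approximant c e d' ->
    scl_rational d <= scl_rational d' + C * (2 * e).
Proof.
have [C C0 H] := scl_rational_lipschitz (uniq_dom c).
exists C => // e d d' [bd rd sd nd] [bd' rd' sd' nd'].
have Bd := boundary_balanced bd; have Bd' := boundary_balanced bd'.
have rdd : rational_chain (d - d') by apply/rational_chainD/rational_chainN.
have Bdd := balancedB Bd Bd'.
have -> : scl_rational d = scl_rational (d' + (d - d')) by rewrite addrC subrK.
apply: le_trans (scl_rationalD _ _) _; rewrite ?lerD2l; try exact: balanced_clearable.
apply: H => // [g /domB|g]; first by rewrite mem_cat => /orP[/sd|/sd'].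
rewrite coeffB.
have -> : coeff g d - coeff g d' = (coeff g d - coeff g c) - (coeff g d' - coeff g c).
  by rewrite opprB addrA subrK.
apply: le_trans (ler_normB _ _) _; rewrite mulrDl mul1r.
by apply: lerD; apply: ltW.
Qed.

(** Approximants at every scale make the filter proper, and [scl_rational_close] makes the values
    Cauchy; hence the [lim] in [scl_chain] is a genuine limit. *)
Lemma scl_chain_limit c : (forall e, 0 < e -> exists d, approximant c e d) ->
  forall e, 0 < e -> exists2 t, 0 < t &
    forall d, approximant c t d -> `|scl_chain c - scl_rational d| < e.
Proof.
move=> ex.
have PF : ProperFilter (rational_approx c).
  apply: filter_from_proper; last by move=> e /= /ex[d [h1 h2 h3 h4]]; exists d.
  apply: filter_from_filter; first by exists 1 => /=.
  move=> e e' /= e0 e'0; exists (Num.min e e'); first by rewrite /= lt_min e0.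
  move=> d [h1 h2 h3 h4]; split; split=> // g; have := h4 g; rewrite lt_min => /andP[] //.
suff /cvg_ex[v Hv] : cvg (@scl_rational R _ @ rational_approx c).
  move=> e e0; rewrite /scl_chain (cvg_lim (@Rhausdorff R) Hv).
  move/cvgrPdist_lt: Hv => /(_ _ e0)[t /= t0 Ht].
  by exists t => // d [h1 h2 h3 h4]; apply: Ht; split.
apply: cauchy_cvg; apply: cauchy_exP => e e0.
have [C C0 H] := scl_rational_close c.
(* Chosen so that [C * (2 * dl) < e], including when [C = 0]. *)
pose dl := e / (2 * C + 1) / 2.
have dl0 : 0 < dl by rewrite !divr_gt0 // ltr_wpDl // mulr_ge0.
have [d0 Ad0] := ex _ dl0; exists (scl_rational d0).
exists dl => //= d [h1 h2 h3 h4].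
have Ad : approximant c dl d by split.
have small : C * (2 * dl) < e.
  have -> : C * (2 * dl) = C * e / (2 * C + 1).
    rewrite /dl; field; by rewrite gt_eqF // ltr_wpDl // mulr_ge0.
  by rewrite ltr_pdivrMr ?ltr_wpDl ?mulr_ge0 // mulrC ltr_pM2l //; move: C0; lra.
have h := H _ _ _ Ad Ad0; have h' := H _ _ _ Ad0 Ad.
rewrite /ball /= /ball_ /= ltr_norml; move: h h' small; move: (C * _) => z; lra.
Qed.

End FreeChains.

Section MapCoefficients.
Variables (R : realType) (G : groupType) (X : seq R) (theta : R -> R).
Local Notation chain := {freeg G / R}.
Hypothesis theta_rel : forall s : seq (R * R),
  (forall p, p \in s -> p.1 \in X /\ is_rational p.2) ->
  \sum_(p <- s) p.1 * p.2 = 0 -> \sum_(p <- s) theta p.1 * p.2 = 0.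

Definition map_coeffs (c : chain) : chain :=
  \sum_(g <- dom c) theta (coeff g c) *: << g >>.

Lemma coeff_map_coeffs c g :
  coeff g (map_coeffs c) = if g \in dom c then theta (coeff g c) else 0.
Proof.
rewrite /map_coeffs raddf_sum /=; under eq_bigr do rewrite coeffZ coeffU mul1r.
case: ifP => gc.
  rewrite (bigD1_seq g) ?uniq_dom //= eqxx mulr1 big1 ?addr0 // => h /negPf ->.
  by rewrite mulr0.
rewrite big1_seq // => h /andP[_ hc]; case: eqP => [E|_]; last by rewrite mulr0.
by rewrite -E hc in gc.
Qed.

(** Evaluated at each group element, the identity is a linear relation with rational coefficients
    between real numbers in [X], so it survives [theta]. *)
Lemma map_coeffs_span c (s : seq (R * chain)) :
  (forall g, g \in dom c -> coeff g c \in X) ->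
  (forall p, p \in s -> p.1 \in X /\ rational_chain p.2) ->
  c = \sum_(p <- s) p.1 *: p.2 -> map_coeffs c = \sum_(p <- s) theta p.1 *: p.2.
Proof.
move=> cX sX cE.
have sumE (F : R -> R) : \sum_(p <- [seq (coeff g c, << g >>) | g <- dom c] ++
      [seq (p.1, - p.2) | p <- s]) F p.1 *: p.2 =
    \sum_(g <- dom c) F (coeff g c) *: << g >> - \sum_(p <- s) F p.1 *: p.2 :> chain.
  rewrite big_cat !big_map /= -sumrN; congr (_ + _).
  by apply: eq_bigr => p _; rewrite scalerN.
apply/eqP; rewrite -subr_eq0 /map_coeffs -sumE; apply/eqP.
apply: (chain_relation theta_rel).
  move=> p; rewrite mem_cat => /orP[] /mapP[q qs ->] /=; split.
  - exact: cX.
  - exact: rational_chain1.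
  - by have [] := sX q qs.
  - by apply: rational_chainN; have [] := sX q qs.
by rewrite (sumE id) -cE -(sum_coeff_sup (uniq_dom c)) // subrr.
Qed.

Lemma map_coeffs_close c (e : R) : 0 < e ->
  (forall x, x \in X -> `|theta x - x| < e) ->
  (forall g, g \in dom c -> coeff g c \in X) ->
  forall g, `|coeff g (map_coeffs c) - coeff g c| < e.
Proof.
move=> e0 H cX g; rewrite coeff_map_coeffs.
case: ifPn => [/cX/H //|/coeff_outdom ->]; by rewrite subrr normr0.
Qed.

Lemma dom_map_coeffs c : {subset dom (map_coeffs c) <= dom c}.
Proof.
by move=> g; rewrite [g \in dom (_ c)]mem_dom coeff_map_coeffs; case: ifP => //; rewrite eqxx.
Qed.

Hypothesis theta_rat : forall x, is_rational (theta x).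

Lemma map_coeffs_rational c : rational_chain (map_coeffs c).
Proof. by move=> g; rewrite coeff_map_coeffs; case: ifP => // _; exact: rational0. Qed.

End MapCoefficients.

(** * Isometry for one small cancellation homomorphism *)

Section Isometry.
Variables (R : realType) (k l tau : nat) (f : 'I_k -> free_group l).
Hypothesis sc : small_cancellation tau (fun a => letter_val f a : seq (letter l)).

Local Notation phi := (free_hom f).

(** A single [theta] is applied to every real number that occurs: the coefficients of [c] and [d],
    those witnessing that both are boundaries, and those expressing [d - phi c] by relators. The
    approximants are then boundaries, and they still correspond under [phi] up to rational multiples
    of relators, which do not change [scl_rational]. *)
Lemma common_approximants (c : {freeg (free_group k) / R})
    (d : {freeg (free_group l) / R}) (e : R) :
  boundary c -> boundary d ->
  chain_span (@homogeneity_relator R (free_group l)) (d - chain_map phi c) ->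
  0 < e -> exists c' d', [/\ approximant c e c', approximant d e d' &
    scl_rational c' = scl_rational d'].
Proof.
move=> /asboolP[sb sbP cE] /asboolP[sd sdP dE] [sh shP hE] e0.
pose X := [seq coeff g c | g <- dom c] ++ [seq p.1 | p <- sb] ++
  [seq coeff g d | g <- dom d] ++ [seq p.1 | p <- sd] ++ [seq p.1 | p <- sh].
have [theta [th_rat th_close th_rel]] := rational_approximation X e0.
have memX1 g : g \in dom c -> coeff g c \in X.
  by move=> gc; rewrite !mem_cat (map_f (fun g => coeff g c) gc) ?orbT.
have memX2 p : p \in sb -> p.1 \in X.
  by move=> pb; rewrite !mem_cat (map_f (fun p => p.1) pb) !orbT.
have memX3 g : g \in dom d -> coeff g d \in X.
  by move=> gd; rewrite !mem_cat (map_f (fun g => coeff g d) gd) !orbT.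
have memX4 p : p \in sd -> p.1 \in X.
  by move=> pb; rewrite !mem_cat (map_f (fun p => p.1) pb) !orbT.
have memX5 p : p \in sh -> p.1 \in X.
  by move=> pb; rewrite !mem_cat (map_f (fun p => p.1) pb) !orbT.
have c'E : map_coeffs theta c = \sum_(p <- sb) theta p.1 *: p.2.
  apply: (map_coeffs_span th_rel) cE => // p pb; split; first exact: memX2.
  exact/bar_relator_rational/sbP.
have d'E : map_coeffs theta d = \sum_(p <- sd) theta p.1 *: p.2.
  apply: (map_coeffs_span th_rel) dE => // p pb; split; first exact: memX4.
  exact/bar_relator_rational/sdP.
have c'A : approximant c e (map_coeffs theta c).
  split; [|exact: map_coeffs_rational|exact: dom_map_coeffs|exact: (map_coeffs_close (X := X))].
  apply/asboolP; exists [seq (theta p.1, p.2) | p <- sb].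
    by move=> _ /mapP[p /sbP pb ->].
  by rewrite big_map.
have d'A : approximant d e (map_coeffs theta d).
  split; [|exact: map_coeffs_rational|exact: dom_map_coeffs|exact: (map_coeffs_close (X := X))].
  apply/asboolP; exists [seq (theta p.1, p.2) | p <- sd].
    by move=> _ /mapP[p /sdP pb ->].
  by rewrite big_map.
exists (map_coeffs theta c), (map_coeffs theta d); split=> //.
have phi_c (F : R -> R) : chain_map phi (\sum_(g <- dom c) F (coeff g c) *: << g >>) =
    \sum_(g <- dom c) F (coeff g c) *: << phi g >>.
  rewrite raddf_sum; apply: eq_bigr => g _ /=.
  by rewrite !freegZU chain_mapU.
have E : map_coeffs theta d = chain_map phi (map_coeffs theta c) +
    \sum_(p <- sh) theta p.1 *: p.2.
  have sumE (F : R -> R) :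
      \sum_(p <- [seq (coeff g c, << phi g >>) | g <- dom c] ++ sh) F p.1 *: p.2 =
      \sum_(g <- dom c) F (coeff g c) *: << phi g >> + \sum_(p <- sh) F p.1 *: p.2
      :> {freeg (free_group l) / R}.
    by rewrite big_cat big_map.
  rewrite /map_coeffs phi_c -sumE; apply: (map_coeffs_span th_rel memX3).
    move=> p; rewrite mem_cat => /orP[/mapP[g gc ->]|ps] /=.
      by split; [exact: memX1|exact: rational_chain1].
    by split; [exact: memX5|exact/homogeneity_relator_rational/shP].
  rewrite (sumE id) -hE -(phi_c id) -(sum_coeff_sup (uniq_dom c)) //.
  by rewrite addrC subrK.
have /choice[q qE] : forall x, exists q : rat, theta x = ratr q by [].
have c'cl : clearable (map_coeffs theta c).
  case: c'A => bc rc _ _; exact: balanced_clearable (boundary_balanced bc).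
have [c1 e1] := scl_rational_morph (cl_free_hom sc) c'cl.
have [|_ e2] := scl_rational_relators (s := [seq (q p.1, p.2) | p <- sh]) c1.
  by move=> _ /mapP[p ps ->]; apply: shP.
rewrite E -e1 -e2 big_map; congr (scl_rational (_ + _)).
by apply: eq_bigr => p _; rewrite qE.
Qed.

Lemma scl_isometry_free_hom : scl_isometry R (phi : {multiplicative _ -> _}).
Proof.
move=> Gamma; rewrite /scl; set c := val (generic_quotient.repr Gamma); set d := val (generic_quotient.repr _).
have bc : boundary c by exact: valP (generic_quotient.repr Gamma).
have bd : boundary d by exact: valP (generic_quotient.repr _).
(* [scl] evaluates a chosen representative; the one chosen for the image class agrees with the image
   of [c] only modulo the subspace of relators. *)
have H : chain_span (@homogeneity_relator R (free_group l)) (d - chain_map phi c).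
  have : homogeneous (generic_quotient.repr (B1H_map phi Gamma) - B1_map phi (generic_quotient.repr Gamma)).
    rewrite -[homogeneous _]/(_ \in @homogeneous R (free_group l)).
    by rewrite Quotient.idealrBE reprK.
  by move/asboolP.
have ex e (e0 : 0 < e) := common_approximants bc bd H e0.
have /scl_chain_limit cl_c : forall e, 0 < e -> exists c', approximant c e c'.
  by move=> e /ex[c' [_ [Ac _ _]]]; exists c'.
have /scl_chain_limit cl_d : forall e, 0 < e -> exists d', approximant d e d'.
  by move=> e /ex[_ [d' [_ Ad _]]]; exists d'.
apply/eqP; rewrite -subr_eq0 -normr_le0; apply/ler_addgt0Pr => e e0; rewrite add0r.
have e2 : 0 < e / 2 by rewrite divr_gt0.
have [u u0 Hu] := cl_c _ e2.
have [v v0 Hv] := cl_d _ e2.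
have uv0 : 0 < Num.min u v by rewrite lt_min u0.
have [c' [d' [[b1 r1 s1 n1] [b2 r2 s2 n2] pE]]] := ex _ uv0.
have h1 : `|scl_chain c - scl_rational c'| < e / 2.
  by apply: Hu; split=> // g; have := n1 g; rewrite lt_min => /andP[].
have h2 : `|scl_chain d - scl_rational d'| < e / 2.
  by apply: Hv; split=> // g; have := n2 g; rewrite lt_min => /andP[].
rewrite -pE in h2; move: h1 h2; rewrite !ltr_norml ler_norml.
by move: (scl_chain c) (scl_chain d) (scl_rational c') => a1 a2 a3; lra.
Qed.

End Isometry.

(** * Random homomorphisms *)

Section Asymptotics.
Variable R : realType.

Lemma bernoulli_ge (x : R) n : -1 <= x -> 1 + n%:R * x <= (1 + x) ^+ n.
Proof.
move=> x1; elim: n => [|n IH]; first by rewrite mul0r addr0 expr0.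
have h : 0 <= 1 + x by rewrite -lerBlDl sub0r.
rewrite exprS; apply: le_trans (ler_wpM2l h IH).
have -> : (1 + x) * (1 + n%:R * x) = 1 + n.+1%:R * x + n%:R * x ^+ 2.
  by rewrite -natr1; ring.
by rewrite lerDl mulr_ge0 // sqr_ge0.
Qed.

(** With [C = 101 / 100], the estimate [C ^+ 35 <= 3] gives [C ^+ (5 * n) <= 3 * 3 ^+ (n %/ 7)], the
    leading 3 covering the remainder modulo 7. Four of the five factors [C ^+ n] absorb the
    polynomial, through [n.+1 <= 100 * C ^+ n]; the fifth is the decay that remains. *)
Lemma polynomial_exponential_bound n :
  (n.+1%:R ^+ 4 <= 3 * 100 ^+ 4 * (101 / 100) ^- n * 3 ^+ (n %/ 7) :> R).
Proof.
set C : R := 101 / 100.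
have C0 : 0 < C by rewrite divr_gt0.
have C1 : 1 <= C by rewrite /C; lra.
(* Bernoulli's inequality for the inverse: [1 - 35 / 101] is at least [1 / 3]. *)
have C35 : C ^+ 35 <= 3.
  have h : 1 / 3 <= C ^- 35.
    rewrite -exprVn; have -> : C^-1 = 1 + - (1 / 101) by rewrite /C; field.
    by apply: le_trans (bernoulli_ge _ _); lra.
  rewrite -[X in X <= _]invrK -[X in _ <= X]invrK lef_pV2 ?posrE ?invr_gt0 ?exprn_gt0 //.
  by move: h; rewrite div1r.
have lin : n.+1%:R <= 100 * C ^+ n.
  have -> : C = 1 + 1 / 100 by rewrite /C; field.
  have x1 : -1 <= 1 / 100 :> R by lra.
  have := bernoulli_ge n x1; rewrite -(natr1 n).
  have n0 : 0 <= n%:R :> R by [].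
  by move: n0; move: (n%:R) (_ ^+ n) => m c; lra.
have exp : C ^+ (5 * n) <= 3 * 3 ^+ (n %/ 7).
  apply: (@le_trans _ _ (C ^+ (35 * (n %/ 7) + 30))).
    apply: ler_weXn2l => //; move: (divn_eq n 7) (ltn_pmod n (isT : (0 < 7)%N)).
    by move: (n %/ 7)%N (n %% 7)%N => a b; lia.
  rewrite exprD exprM mulrC; apply: ler_pM; rewrite ?exprn_ge0 ?(ltW C0) //.
    by apply: le_trans C35; apply: ler_weXn2l.
  by rewrite lerXn2r ?nnegrE ?exprn_ge0 ?(ltW C0).
apply: (@le_trans _ _ ((100 * C ^+ n) ^+ 4)).
  by rewrite lerXn2r ?nnegrE // mulr_ge0 // exprn_ge0 // ltW.
have -> : (100 * C ^+ n) ^+ 4 = 100 ^+ 4 * C ^- n * C ^+ (5 * n).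
  have -> : (5 * n = n + n * 4)%N by lia.
  have D0 : C ^+ n != 0 by rewrite expf_neq0 // gt_eqF.
  by rewrite exprD exprM; move: (C ^+ n) D0 => D D0; field.
have -> : 3 * 100 ^+ 4 / C ^+ n * 3 ^+ (n %/ 7) =
    100 ^+ 4 / C ^+ n * (3 * 3 ^+ (n %/ 7)) by rewrite [RHS]mulrCA !mulrA.
by rewrite ler_wpM2l // mulr_ge0 ?invr_ge0 ?exprn_ge0 // ltW.
Qed.

End Asymptotics.

Section RandomHom.
Variables (R : realType) (k l : nat).
Hypothesis l_gt1 : (1 < l)%N.

Lemma random_hom_probC n (E : {multiplicative free_group k -> free_group l} -> Prop) :
  1 - random_hom_prob R n E =
  #|[pred f : {ffun 'I_k -> short_words l n} |
      ~~ `[< E (free_hom (fun i => free_of_short (f i))) >]]|%:R /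
  #|{ffun 'I_k -> short_words l n}|%:R.
Proof.
have S0 : (0 < #|short_words l n|)%N.
  by apply: leq_trans (card_short_words_geq l_gt1 n); rewrite expn_gt0; apply/orP; left; lia.
have F0 : (0 < #|{ffun 'I_k -> short_words l n}|)%N by rewrite card_ffun expn_gt0 S0.
have -> : random_hom_prob R n E = #|[pred f : {ffun 'I_k -> short_words l n} |
    `[< E (free_hom (fun i => free_of_short (f i))) >]]|%:R /
    #|{ffun 'I_k -> short_words l n}|%:R.
  rewrite /random_hom_prob; under eq_bigr do rewrite prodr_const card_ord.
  by rewrite sumr_const -[LHS]mulr_natl card_ffun card_ord natrX exprVn.
set P := [pred f | `[< _ >]]; rewrite -(cardC P) natrD.
have h : (#|P| + #|[predC P]|)%:R != 0 :> R by rewrite pnatr_eq0 cardC -lt0n.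
rewrite natrD in h; field; exact: h.
Qed.

(** Union bound over [k] events of short images and [2 * k ^ 2 * n.+1 ^ 2] events of repeated
    subwords, all with the same bound. *)
Lemma non_isometry_count n tau : (0 < tau)%N -> (7 * tau <= n)%N ->
  (#|[pred f : {ffun 'I_k -> short_words l n} |
     ~~ `[< scl_isometry R (free_hom (fun i => free_of_short (f i))
            : {multiplicative free_group k -> free_group l}) >]]| * #|short_words l n| <=
   (k + 2 * k ^ 2 * n.+1 ^ 2) *
   (4 * n.+1 ^ 2 * (2 * l - 1) ^ (n - tau) * #|{ffun 'I_k -> short_words l n}|))%N.
Proof.
move=> tau0 tn; set bad := [pred f | _].
set B := (4 * _ * _ * _)%N.
have sub : (#|bad| <= \sum_x #|[pred f | @short_event k l n tau x f]| +
    \sum_e #|[pred f | @overlap_event k l n tau e f]|)%N.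
  have cE (P : {ffun 'I_k -> short_words l n} -> bool) :
      (#|[pred f | P f]| = \sum_f P f)%N by rewrite -big_mkcond sum1_card.
  under eq_bigr do rewrite cE; under [X in (_ <= _ + X)%N]eq_bigr do rewrite cE.
  rewrite exchange_big [X in (_ <= _ + X)%N]exchange_big -big_split /= /bad cE.
  apply: leq_sum => f _; case: asboolP => // bf.
  apply: contrapT => /negP; rewrite -ltnNge ltnS leqn0 addn_eq0 !sum_nat_eq0.
  move=> /andP[/forallP h1 /forallP h2]; apply: bf.
  apply: scl_isometry_free_hom; apply: (@no_event_small_cancellation _ _ n tau) => //.
    by move=> x; have := h1 x; rewrite implyTb eqb0.
  by move=> e; have := h2 e; rewrite implyTb eqb0.
apply: leq_trans (leq_mul sub (leqnn _)) _.
rewrite mulnDl !big_distrl /= mulnDl; apply: leq_add.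
  rewrite -[X in (X * _)%N]card_ord -sum_nat_const; apply: leq_sum => x _.
  exact: short_event_bound.
have -> : (2 * k ^ 2 * n.+1 ^ 2 = #|{: 'I_k * 'I_k * 'I_n.+1 * 'I_n.+1 * bool}|)%N.
  by rewrite !card_prod !card_ord card_bool -!mulnn; ring.
rewrite -sum_nat_const; apply: leq_sum => e _.
exact: overlap_event_bound.
Qed.

(** [tau = n %/ 7] is the largest value allowed by [7 * tau <= n], and positive for [n >= 7]. The
    factor 36 is 3 from the number of events, 4 from the bound for each, and 3 from
    [polynomial_exponential_bound]. As [2 * l - 1 >= 3], the powers of 3 serve for every [l]. *)
Lemma non_isometry_probability n : (7 <= n)%N ->
  `|1 - random_hom_prob R n (@scl_isometry R (free_group k) (free_group l))| <=
  36 * k%:R ^+ 2 * 100 ^+ 4 * (101 / 100) ^- n.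
Proof.
move=> n7; set tau := (n %/ 7)%N.
have tau0 : (0 < tau)%N by rewrite divn_gt0.
have tn : (7 * tau <= n)%N by rewrite mulnC leq_divM.
rewrite random_hom_probC ger0_norm ?divr_ge0 //.
have := non_isometry_count tau0 tn; set b := #|_|; set F := #|{ffun _ -> _}|; set S := #|_|.
move=> H.
have q3 : (3 <= 2 * l - 1)%N by lia.
set q := (2 * l - 1)%N in q3 H.
have SE : (q ^ (n - tau) * q ^ tau <= S)%N.
  rewrite -expnD subnK; first exact: card_short_words_geq.
  by apply: leq_trans tn; rewrite leq_pmull.
have F0 : (0 < F)%N.
  rewrite /F card_ffun card_ord expn_gt0 -/S; apply/orP; left.
  by apply: leq_trans SE; rewrite muln_gt0 !expn_gt0 (leq_trans _ q3).
have Hb : (b * 3 ^ tau <= 12 * k ^ 2 * n.+1 ^ 4 * F)%N.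
  have q0 : (0 < q ^ (n - tau))%N by rewrite expn_gt0 (leq_trans _ q3).
  rewrite -(leq_pmul2r q0); apply: (@leq_trans (b * S)%N).
    rewrite -mulnA leq_mul2l; apply/orP; right; apply: leq_trans SE.
    by rewrite mulnC leq_mul2l leq_exp2r ?q3 ?orbT.
  apply: leq_trans H _.
  have M : (k + 2 * k ^ 2 * n.+1 ^ 2 <= 3 * k ^ 2 * n.+1 ^ 2)%N.
    have -> : (3 * k ^ 2 * n.+1 ^ 2 = k ^ 2 * n.+1 ^ 2 + 2 * k ^ 2 * n.+1 ^ 2)%N by ring.
    rewrite leq_add2r; apply: (@leq_trans (k ^ 2)%N); last by rewrite leq_pmulr.
    by rewrite -mulnn; case: (k) => // m; rewrite leq_pmulr.
  apply: leq_trans (leq_mul M (leqnn _)) _.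
  by move: (q ^ _)%N => u; rewrite leq_eqVlt; apply/orP; left; apply/eqP; ring.
rewrite ler_pdivrMr ?ltr0n // -(@ler_pM2r _ (3 ^+ tau)) ?exprn_gt0 //.
have {}Hb : b%:R * 3 ^+ tau <= 12 * k%:R ^+ 2 * n.+1%:R ^+ 4 * F%:R :> R.
  by rewrite -!natrX -!natrM ler_nat.
apply: le_trans Hb _; rewrite [leRHS]mulrAC ler_wpM2r //.
have := polynomial_exponential_bound R n; rewrite -/tau => P.
have k0 : 0 <= 12 * k%:R ^+ 2 :> R by rewrite mulr_ge0 // exprn_ge0.
apply: le_trans (ler_wpM2l k0 P) _; rewrite le_eqVlt; apply/orP; left; apply/eqP.
by move: (_ ^- n) (3 ^+ tau) => c t; ring.
Qed.

End RandomHom.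

Theorem theorem3p16 (R : realType) (k l : nat) (hk : (2 <= k)%N) (hl : (2 <= l)%N) :
  exists2 C : R, 1 < C &
    (fun n : nat => 1 - random_hom_prob R n (@scl_isometry R (free_group k) (free_group l)))
      =O_\oo (fun n : nat => C ^- n).
Proof.
exists (101 / 100); first by lra.
apply/eqOP; exists (36 * k%:R ^+ 2 * 100 ^+ 4); split; first exact: num_real.
move=> y ky; exists 7%N => // n /= n7.
apply: le_trans (non_isometry_probability R k hl n7) _.
have C0 : 0 <= 101 / 100 :> R by lra.
rewrite [X in _ <= _ * X]ger0_norm ?invr_ge0 ?exprn_ge0 //.
by rewrite ler_wpM2r ?invr_ge0 ?exprn_ge0 // ltW.
Qed.
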